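(* Let $\phi$ be a linear fractional self-map of the unit disk $\mathbb D$, and let $C_\phi:H^2(\mathbb D)\to H^2(\mathbb D)$, $C_\phi f=f\circ\phi$. Then $C_\phi$ is recurrent if and only if $\phi$ is either hyperbolic with no fixed point in $\mathbb D$, or a parabolic automorphism of $\mathbb D$, or an elliptic automorphism of $\mathbb D$.
   Context: $H^2(\mathbb D)$ is the Hardy space of holomorphic $f$ on $\mathbb D$ with $\|f\|^2=\sup_{0\le r<1}\frac1{2\pi}\int_0^{2\pi}|f(re^{i\theta})|^2d\theta<\infty$. A linear fractional self-map of $\mathbb D$ is a map $\phi(z)=(az+b)/(cz+d)$ with $ad-bc\neq0$ and $\phi(\mathbb D)\subset\mathbb D$; it is an automorphism if $\phi(\mathbb D)=\mathbb D$. Such a map has one or two fixed points in the extended plane $\hat{\mathbb C}$. It is parabolic if it has no fixed point in $\mathbb D$ and a unique (attractive) fixed point, lying on $\mathbb T=\partial\mathbb D$; it is hyperbolic (with attractive fixed point on $\mathbb T$) if it has an attractive fixed point $\alpha\in\mathbb T$ and a second fixed point $\beta\in\hat{\mathbb C}\setminus\mathbb D$; it is an elliptic automorphism if it is an automorphism of $\mathbb D$ having a fixed point in $\mathbb D$ (the second fixed point lying in $\hat{\mathbb C}\setminus\overline{\mathbb D}$). An operator $T$ on a Banach space $X$ is recurrent if for every non-empty open $U\subset X$ there is a positive integer $k$ with $U\cap T^{-k}(U)\neq\emptyset$. *)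

(* Defs.v *)
From Stdlib Require Import Reals.
From Coquelicot Require Import Coquelicot.
Open Scope R_scope.

Definition in_disk (z : C) : Prop := Cmod z < 1.
Definition on_circle (z : C) : Prop := Cmod z = 1.

Definition holo_on_disk (f : C -> C) : Prop :=
  forall z : C, in_disk z ->
    @ex_derive C_AbsRing (AbsRing_NormedModule C_AbsRing) f z.

Definition int_mean2 (f : C -> C) (r : R) : R :=
  / (2 * PI) *
  RInt (fun t : R => (Cmod (f (r * cos t, r * sin t)%R)) ^ 2) 0 (2 * PI).

Definition H2 (f : C -> C) : Prop :=
  holo_on_disk f /\
  exists M : R, forall r : R, 0 <= r < 1 -> int_mean2 f r <= M.

Definition H2_norm (f : C -> C) : R :=
  sqrt (real (Lub_Rbar (fun x : R => exists r : R, 0 <= r < 1 /\ x = int_mean2 f r))).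

Definition H2_open (U : (C -> C) -> Prop) : Prop :=
  forall f, U f -> exists eps : R, 0 < eps /\
    forall g, H2 g -> H2_norm (fun z => (f z - g z)%C) < eps -> U g.

Definition recurrent (T : (C -> C) -> (C -> C)) : Prop :=
  forall U : (C -> C) -> Prop,
    (forall f, U f -> H2 f) -> H2_open U -> (exists f, U f) ->
    exists k : nat, (1 <= k)%nat /\ exists f, U f /\ U (Nat.iter k T f).

Definition comp_op (phi : C -> C) (f : C -> C) : C -> C := fun z => f (phi z).

Definition lf (a b c d : C) (z : C) : C := ((a * z + b) / (c * z + d))%C.

(* action on the extended plane C u {oo}; None stands for oo *)
Definition lf_ext (a b c d : C) (w : option C) : option C :=
  match w with
  | Some z => if Ceq_dec (c * z + d)%C 0%C then None else Some (lf a b c d z)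
  | None => if Ceq_dec c 0%C then None else Some (a / c)%C
  end.

Definition fixed_pt (a b c d : C) (w : option C) : Prop := lf_ext a b c d w = w.

Definition lf_selfmap (a b c d : C) : Prop :=
  (a * d - b * c)%C <> 0%C /\
  forall z, in_disk z -> (c * z + d)%C <> 0%C /\ in_disk (lf a b c d z).

Definition lf_automorphism (a b c d : C) : Prop :=
  lf_selfmap a b c d /\
  forall w, in_disk w -> exists z, in_disk z /\ lf a b c d z = w.

Definition ext_in_disk (w : option C) : Prop :=
  match w with Some z => in_disk z | None => False end.

Definition has_fixed_pt_in_disk (a b c d : C) : Prop :=
  exists z, in_disk z /\ fixed_pt a b c d (Some z).

Definition attractive (a b c d : C) (alpha : C) : Prop :=
  forall z, in_disk z ->
    is_lim_seq (fun n => Cmod (Nat.iter n (lf a b c d) z - alpha)%C) 0.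

Definition parabolic (a b c d : C) : Prop :=
  ~ has_fixed_pt_in_disk a b c d /\
  exists alpha : C, on_circle alpha /\ fixed_pt a b c d (Some alpha) /\
    forall w, fixed_pt a b c d w -> w = Some alpha.

Definition hyperbolic (a b c d : C) : Prop :=
  exists alpha : C, on_circle alpha /\ fixed_pt a b c d (Some alpha) /\
    attractive a b c d alpha /\
    exists beta : option C, beta <> Some alpha /\ fixed_pt a b c d beta /\
      ~ ext_in_disk beta.

Definition elliptic_automorphism (a b c d : C) : Prop :=
  lf_automorphism a b c d /\ has_fixed_pt_in_disk a b c d.

(* Main.v *)
(* Idea of the proof.  A function f in H^2 has integral means sum |a_n|^2 r^(2n), so polynomials are
   dense and evaluations (and differences of evaluations) are controlled by the norm.

   Recurrence.  In the coordinate u = (z - alpha)/(z - beta) a hyperbolic map is u -> kappa u, and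
   u(D) is a disk or half-plane with 0 on its boundary, so that kappa is in (0,1) and u(D) lies in a
   half-plane Re y > 0 that is invariant under kappa^n for every integer n.  With s = 1/(1 + y), polynomials in s
   that vanish at 0 and 1 are dense; such a function f tends to 0 when y is replaced by kappa^n y,
   n -> +oo or n -> -oo.  If g_n is the result for -n, then f + g_n is near f, and so is its image
   under the n-th power of C_phi.  The same works for the translation y -> y + i t of a
   parabolic automorphism.  An elliptic automorphism is a rotation v -> omega v, and
   omega^n is close to 1 for some n >= 1.

   Non-recurrence.  If phi is not an automorphism and fixes p in D, then in the disk coordinate v
   centred at p the orbit of the point v = 1/2 stays away from 1/2, which contradicts recurrence near
   f = v.  If phi is parabolic and not an automorphism, it is a translation y -> y + w
   with Re w > 0, two orbits phi^n(q), phi^n(q') are at distance O(n^-2) while 1 - |phi^n(q)| is of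
   order 1/n, and f(phi^n(q)) - f(phi^n(q')) -> 0 uniformly on bounded sets of H^2, which contradicts
   recurrence near f = z. *)

Require Import Defs.
From Stdlib Require Import Reals Lra Lia Psatz ZArith Classical FunctionalExtensionality.
From Coquelicot Require Import Coquelicot.
Open Scope R_scope.

(** * Complex differentiability *)

(** Polynomials in s are dense because s is an affine function of a Blaschke factor: both are
    Moebius maps with the same pole, outside the closed disk. Vanishing at 0 and 1 is imposed
    because the iterates drive s to one of these values in each direction of time. It costs nothing
    in mean, although it would in sup norm: s is close to 0 or to 1 only near a boundary point, and
    short arcs carry little mean.

    For non-recurrence the obstacle is that recurrence yields some exponent k >= 1 of unknown size.
    In the parabolic case the decay rules out only large k: at points with 1 - |z|^2 >= c / k a
    difference of values of f costs a factor k^(3/2), and a distance of order k^(-2) leaves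
    k^(-1/2). The finitely many smaller k are excluded because the orbit of 0 keeps a fixed distance
    from 0; the neighbourhood is shrunk for them after the threshold on k has been fixed, which is
    possible since the threshold depends on the map alone. *)

Definition cdiff (f : C -> C) (z l : C) : Prop :=
  forall eps, 0 < eps -> exists delta, 0 < delta /\
    forall w, Cmod (w - z) < delta ->
      Cmod (f w - f z - l * (w - z)) <= eps * Cmod (w - z).

Lemma cdiff_is_derive f z l :
  cdiff f z l -> @is_derive C_AbsRing (AbsRing_NormedModule C_AbsRing) f z l.
Proof.
  intros H. split.
  - apply (is_linear_scal_l (K:=C_AbsRing) (V:=AbsRing_NormedModule C_AbsRing)).
  - intros x Hx eps.
    apply (is_filter_lim_locally_unique (K:=C_AbsRing) (V:=AbsRing_NormedModule C_AbsRing)) in Hx. subst x.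
    destruct (H (pos eps) (cond_pos eps)) as (d & Hd & Hw).
    exists (mkposreal d Hd). intros w Hb.
    specialize (Hw w Hb).
    replace (l * (w - z))%C with ((w - z) * l)%C in Hw by ring. exact Hw.
Qed.

Lemma is_derive_cdiff f z l :
  @is_derive C_AbsRing (AbsRing_NormedModule C_AbsRing) f z l -> cdiff f z l.
Proof.
  intros [_ H] eps He.
  destruct (H z (fun P HP => HP) (mkposreal eps He)) as (d & Hd).
  exists d. split; [apply cond_pos|]. intros w Hw.
  replace (l * (w - z))%C with ((w - z) * l)%C by ring.
  exact (Hd w Hw).
Qed.

Definition holo (f : C -> C) : Prop := forall z, in_disk z -> exists l, cdiff f z l.

Lemma holo_iff f : holo_on_disk f <-> holo f.
Proof.
  split; intros H z Hz; destruct (H z Hz) as [l Hl]; exists l.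
  - now apply is_derive_cdiff.
  - now apply cdiff_is_derive.
Qed.

Lemma Cmod_sub_sym (x y : C) : Cmod (x - y) = Cmod (y - x).
Proof. rewrite <- Cmod_opp. f_equal. ring. Qed.

Lemma Cmod_triangle_sub (x y : C) : Cmod (x - y) <= Cmod x + Cmod y.
Proof. unfold Cminus. rewrite <- (Cmod_opp y). apply Cmod_triangle. Qed.

Lemma Cmod_triangle_rev (x y : C) : Cmod x - Cmod y <= Cmod (x - y).
Proof.
  assert (H := Cmod_triangle (x - y) y).
  replace (x - y + y)%C with x in H by ring. lra.
Qed.

Definition ccont (f : C -> C) (z : C) : Prop :=
  forall eps, 0 < eps -> exists delta, 0 < delta /\
    forall w, Cmod (w - z) < delta -> Cmod (f w - f z) <= eps.

Lemma cdiff_ccont f z l : cdiff f z l -> ccont f z.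
Proof.
  intros H eps He.
  destruct (H 1 Rlt_0_1) as (d & Hd & Hw).
  assert (Hl := Cmod_ge_0 l).
  exists (Rmin d (eps / (1 + Cmod l))). split.
  { apply Rmin_pos; auto. apply Rdiv_lt_0_compat; lra. }
  intros w Hwz.
  assert (H1 := Rlt_le_trans _ _ _ Hwz (Rmin_l _ _)).
  assert (H2 := Rlt_le_trans _ _ _ Hwz (Rmin_r _ _)).
  specialize (Hw w H1).
  replace (f w - f z)%C with ((f w - f z - l * (w - z)) + l * (w - z))%C by ring.
  eapply Rle_trans. apply Cmod_triangle. rewrite Cmod_mult.
  apply Rle_trans with (1 * Cmod (w - z) + Cmod l * Cmod (w - z)). lra.
  replace eps with ((1 + Cmod l) * (eps / (1 + Cmod l))) by (field; lra).
  rewrite <- Rmult_plus_distr_r.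
  apply Rmult_le_compat_l; lra.
Qed.

Lemma cdiff_const c z : cdiff (fun _ => c) z 0.
Proof.
  intros eps He. exists 1. split. lra. intros w _.
  replace (c - c - 0 * (w - z))%C with (RtoC 0) by ring. rewrite Cmod_0.
  apply Rmult_le_pos; [lra|apply Cmod_ge_0].
Qed.

Lemma cdiff_id z : cdiff (fun w => w) z 1.
Proof.
  intros eps He. exists 1. split. lra. intros w _.
  replace (w - z - 1 * (w - z))%C with (RtoC 0) by ring. rewrite Cmod_0.
  apply Rmult_le_pos; [lra|apply Cmod_ge_0].
Qed.

Lemma cdiff_plus f g z l m :
  cdiff f z l -> cdiff g z m -> cdiff (fun w => (f w + g w)%C) z (l + m)%C.
Proof.
  intros Hf Hg eps He.
  destruct (Hf (eps / 2)) as (d1 & Hd1 & H1). lra.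
  destruct (Hg (eps / 2)) as (d2 & Hd2 & H2). lra.
  exists (Rmin d1 d2). split. now apply Rmin_pos.
  intros w Hw.
  specialize (H1 w (Rlt_le_trans _ _ _ Hw (Rmin_l _ _))).
  specialize (H2 w (Rlt_le_trans _ _ _ Hw (Rmin_r _ _))).
  replace (f w + g w - (f z + g z) - (l + m) * (w - z))%C
    with ((f w - f z - l * (w - z)) + (g w - g z - m * (w - z)))%C by ring.
  eapply Rle_trans. apply Cmod_triangle. lra.
Qed.

Lemma cdiff_mult f g z l m :
  cdiff f z l -> cdiff g z m ->
  cdiff (fun w => (f w * g w)%C) z (l * g z + f z * m)%C.
Proof.
  intros Hf Hg.
  apply is_derive_cdiff.
  apply (is_derive_mult (K:=C_AbsRing) f g z l m);
    [now apply cdiff_is_derive | now apply cdiff_is_derive |].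
  intros n p. apply Cmult_comm.
Qed.

Lemma cdiff_comp f g z l m :
  cdiff f (g z) l -> cdiff g z m -> cdiff (fun w => f (g w)) z (m * l)%C.
Proof.
  intros Hf Hg. apply is_derive_cdiff.
  apply (is_derive_comp (K:=C_AbsRing) (V:=AbsRing_NormedModule C_AbsRing) f g z l m);
   now apply cdiff_is_derive.
Qed.

Lemma cdiff_inv (z : C) : z <> 0 -> cdiff (fun w => / w)%C z (- / (z * z))%C.
Proof.
  intros Hz eps He.
  assert (Hm : 0 < Cmod z) by now apply Cmod_gt_0.
  set (m := Cmod z) in *.
  (* The error is (w - z)^2 / (w z^2). Staying within m / 2 of z gives |w| > m / 2, so the
     denominator exceeds m^3 / 2; the second bound compensates for it. *)
  exists (Rmin (m / 2) (eps * (m * m * m) / 2)). split.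
  { apply Rmin_pos. lra. apply Rdiv_lt_0_compat; [|lra].
    repeat apply Rmult_lt_0_compat; lra. }
  intros w Hw.
  assert (H1 := Rlt_le_trans _ _ _ Hw (Rmin_l _ _)).
  assert (H2 := Rlt_le_trans _ _ _ Hw (Rmin_r _ _)).
  assert (Hwm : m / 2 < Cmod w).
  { assert (H := Cmod_triangle_rev z w). rewrite Cmod_sub_sym in H. fold m in H. lra. }
  assert (Hw0 : w <> 0). { apply Cmod_gt_0. lra. }
  replace (/ w - / z - - / (z * z) * (w - z))%C
    with ((w - z) * ((w - z) * / (w * (z * z))))%C by (field; auto).
  assert (Hn : (w * (z * z))%C <> 0) by (apply Cmult_neq_0; [|apply Cmult_neq_0]; assumption).
  rewrite !Cmod_mult, Cmod_inv, !Cmod_mult by exact Hn.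
  fold m. rewrite Rmult_comm. apply Rmult_le_compat_r. apply Cmod_ge_0.
  assert (Hp : 0 < Cmod w * (m * m)) by (repeat apply Rmult_lt_0_compat; lra).
  apply Rmult_le_reg_r with (Cmod w * (m * m)). exact Hp.
  rewrite Rmult_assoc, Rinv_l by lra.
  apply Rle_trans with (eps * (m * m * m) / 2). lra.
  assert (0 <= eps * (m * m)) by nra. nra.
Qed.

Lemma cdiff_ext_loc f g z l d : 0 < d ->
  (forall w, Cmod (w - z) < d -> f w = g w) -> cdiff f z l -> cdiff g z l.
Proof.
  intros Hd E H eps He. destruct (H eps He) as (e & He' & Hw).
  exists (Rmin d e). split. now apply Rmin_pos.
  intros w Hwz. rewrite <- !E.
  - apply Hw. eapply Rlt_le_trans. exact Hwz. apply Rmin_r.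
  - replace (z - z)%C with (RtoC 0) by ring. now rewrite Cmod_0.
  - eapply Rlt_le_trans. exact Hwz. apply Rmin_l.
Qed.

Lemma holo_const c : holo (fun _ => c).
Proof. intros z _. exists 0. apply cdiff_const. Qed.
Lemma holo_id : holo (fun z => z).
Proof. intros z _. exists 1. apply cdiff_id. Qed.
Lemma holo_plus f g : holo f -> holo g -> holo (fun z => f z + g z)%C.
Proof.
  intros Hf Hg z Hz. destruct (Hf z Hz) as [l Hl]. destruct (Hg z Hz) as [m Hm].
  exists (l + m)%C. now apply cdiff_plus.
Qed.
Lemma holo_mult f g : holo f -> holo g -> holo (fun z => f z * g z)%C.
Proof.
  intros Hf Hg z Hz. destruct (Hf z Hz) as [l Hl]. destruct (Hg z Hz) as [m Hm].
  eexists. apply cdiff_mult; eassumption.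
Qed.
Lemma holo_ext f g : (forall z, in_disk z -> f z = g z) -> holo f -> holo g.
Proof.
  intros E Hf z Hz. destruct (Hf z Hz) as [l Hl]. exists l.
  apply (cdiff_ext_loc f g z l (1 - Cmod z)); auto.
  - unfold in_disk in Hz. lra.
  - intros w Hw. apply E. unfold in_disk in *.
    assert (H := Cmod_triangle_rev w z). lra.
Qed.
Lemma holo_minus f g : holo f -> holo g -> holo (fun z => f z - g z)%C.
Proof.
  intros Hf Hg. apply holo_ext with (fun z => f z + (RtoC (-1)) * g z)%C.
  - intros z _. replace (RtoC (-1)) with (- RtoC 1)%C. ring.
    unfold RtoC, Copp; simpl; f_equal; ring.
  - apply holo_plus; auto. apply holo_mult; auto. apply holo_const.
Qed.
Lemma holo_inv f : holo f -> (forall z, in_disk z -> f z <> 0) -> holo (fun z => / f z)%C.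
Proof.
  intros Hf Hn z Hz. destruct (Hf z Hz) as [l Hl].
  eexists. apply (cdiff_comp (fun w => / w)%C f). apply cdiff_inv. now apply Hn. exact Hl.
Qed.
Lemma holo_ccont f z : holo f -> in_disk z -> ccont f z.
Proof. intros H Hz. destruct (H z Hz) as [l Hl]. eapply cdiff_ccont. exact Hl. Qed.

(** * Goursat's theorem *)

Lemma nested_point (a b : nat -> R) :
  (forall n, a n <= a (S n)) -> (forall n, b (S n) <= b n) ->
  (forall n, a n <= b n) -> exists x, forall n, a n <= x <= b n.
Proof.
  intros Ha Hb Hab.
  assert (Hm : forall n k, a n <= a (n + k)%nat /\ b (n + k)%nat <= b n).
  { intros n k. induction k as [|k [I1 I2]].
    - rewrite Nat.add_0_r. lra.
    - rewrite Nat.add_succ_r. specialize (Ha (n + k)%nat). specialize (Hb (n + k)%nat). lra. }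
  assert (Hc : forall n m, a n <= b m).
  { intros n m. destruct (Hm n m) as [H1 _]. destruct (Hm m n) as [_ H2].
    rewrite Nat.add_comm in H2. specialize (Hab (n + m)%nat). lra. }
  destruct (completeness (fun x => exists n, x = a n)) as [x [Hu Hl]].
  - exists (b O). intros y [n ->]. apply Hc.
  - exists (a O). now exists O.
  - exists x. intros n. split.
    + apply Hu. now exists n.
    + apply Hl. intros y [m ->]. apply Hc.
Qed.

(* Goursat's bisection argument, isolated from contour integrals: [N a b c d] stands for
   the modulus of the integral over the boundary of the rectangle [a,b] x [c,d]. *)
Lemma bisection_vanish (N : R -> R -> R -> R -> R) (a0 b0 c0 d0 : R) :
  a0 <= b0 -> c0 <= d0 ->
  (forall a b c d, a0 <= a -> a <= b -> b <= b0 -> c0 <= c -> c <= d -> d <= d0 ->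
     N a b c d <= N a ((a + b) / 2) c ((c + d) / 2) + N ((a + b) / 2) b c ((c + d) / 2)
                + N a ((a + b) / 2) ((c + d) / 2) d + N ((a + b) / 2) b ((c + d) / 2) d) ->
  (forall x y, a0 <= x <= b0 -> c0 <= y <= d0 -> forall eps, 0 < eps ->
     exists delta, 0 < delta /\
     forall a b c d, a0 <= a <= x -> x <= b <= b0 -> c0 <= c <= y -> y <= d <= d0 ->
       b - a < delta -> d - c < delta -> N a b c d <= eps * ((b - a) + (d - c)) ^ 2) ->
  N a0 b0 c0 d0 <= 0.
Proof.
  intros Hab Hcd Hsub Hloc. apply Rnot_lt_le. intros Hpos.
  set (T := (R * R * (R * R))%type).
  set (NN := fun q : T => N (fst (fst q)) (snd (fst q)) (fst (snd q)) (snd (snd q))).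
  set (ok := fun q : T => a0 <= fst (fst q) /\ fst (fst q) <= snd (fst q) /\ snd (fst q) <= b0 /\
         c0 <= fst (snd q) /\ fst (snd q) <= snd (snd q) /\ snd (snd q) <= d0).
  set (rel := fun q q' : T =>
      fst (fst q) <= fst (fst q') /\ snd (fst q') <= snd (fst q) /\
      fst (snd q) <= fst (snd q') /\ snd (snd q') <= snd (snd q) /\
      snd (fst q') - fst (fst q') = (snd (fst q) - fst (fst q)) / 2 /\
      snd (snd q') - fst (snd q') = (snd (snd q) - fst (snd q)) / 2 /\
      NN q / 4 <= NN q').
  assert (Hstep : forall q : T, { q' : T | ok q -> ok q' /\ rel q q' }).
  { intros [[a b] [c d]].
    set (m := (a + b) / 2). set (n := (c + d) / 2).
    destruct (Rle_dec (N a b c d / 4) (N a m c n)) as [H1|H1];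
     [ exists ((a, m), (c, n)) |
    destruct (Rle_dec (N a b c d / 4) (N m b c n)) as [H2|H2];
     [ exists ((m, b), (c, n)) |
    destruct (Rle_dec (N a b c d / 4) (N a m n d)) as [H3|H3];
     [ exists ((a, m), (n, d)) | exists ((m, b), (n, d)) ]]];
    unfold ok, rel, NN; simpl; intros (K1 & K2 & K3 & K4 & K5 & K6);
    specialize (Hsub a b c d K1 K2 K3 K4 K5 K6); fold m n in Hsub;
    unfold m, n in *; repeat split; lra. }
  set (q := nat_rect (fun _ => T) ((a0, b0), (c0, d0)) (fun _ p => proj1_sig (Hstep p))).
  assert (Hok : forall n, ok (q n)).
  { induction n as [|n IH].
    - unfold ok; simpl; lra.
    - exact (proj1 (proj2_sig (Hstep (q n)) IH)). }
  assert (Hrel : forall n, rel (q n) (q (S n))).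
  { intros n. exact (proj2 (proj2_sig (Hstep (q n)) (Hok n))). }
  destruct (nested_point (fun n => fst (fst (q n))) (fun n => snd (fst (q n)))) as [x Hx].
  { intros n. apply Hrel. } { intros n. apply Hrel. } { intros n. apply Hok. }
  destruct (nested_point (fun n => fst (snd (q n))) (fun n => snd (snd (q n)))) as [y Hy].
  { intros n. apply Hrel. } { intros n. apply Hrel. } { intros n. apply Hok. }
  set (L := (b0 - a0) + (d0 - c0) + 1).
  assert (HL : 0 < L) by (unfold L; lra).
  assert (Hw : forall n, snd (fst (q n)) - fst (fst (q n)) = (b0 - a0) * (/ 2) ^ n /\
                         snd (snd (q n)) - fst (snd (q n)) = (d0 - c0) * (/ 2) ^ n /\
                         N a0 b0 c0 d0 * (/ 4) ^ n <= NN (q n)).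
  { induction n as [|n (I1 & I2 & I3)].
    - unfold NN; simpl; lra.
    - destruct (Hrel n) as (_ & _ & _ & _ & R1 & R2 & R3).
      simpl pow. rewrite R1, R2, I1, I2. lra. }
  (* After n halvings the rectangle carries at least N / 4^n, while this tolerance allows at most N
     / (2 L^2) times (L / 2^n)^2, half of it. The summand 1 in [L] keeps it positive for a
     degenerate rectangle. *)
  destruct (Hloc x y (Hx O) (Hy O) (N a0 b0 c0 d0 / (2 * L ^ 2))) as (dl & Hdl & Hest).
  { apply Rdiv_lt_0_compat; auto. assert (0 < L ^ 2) by (apply pow_lt; auto). lra. }
  destruct (pow_lt_1_zero (/ 2)) with (y := dl / L) as [n Hn].
  { rewrite Rabs_pos_eq; lra. } { now apply Rdiv_lt_0_compat. }
  specialize (Hn n (le_n n)).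
  assert (Hp : 0 < (/ 2) ^ n) by (apply pow_lt; lra).
  rewrite Rabs_pos_eq in Hn by lra.
  assert (Hn' : L * (/ 2) ^ n < dl).
  { apply Rmult_lt_reg_r with (/ L). now apply Rinv_0_lt_compat.
    replace (L * (/ 2) ^ n * / L) with ((/ 2) ^ n) by (field; lra). exact Hn. }
  destruct (Hw n) as (W1 & W2 & W3). destruct (Hok n) as (K1 & K2 & K3 & K4 & K5 & K6).
  assert (E := Hest _ _ _ _ (conj K1 (proj1 (Hx n))) (conj (proj2 (Hx n)) K3)
                 (conj K4 (proj1 (Hy n))) (conj (proj2 (Hy n)) K6)).
  assert (E' := Rle_trans _ _ _ W3 (E ltac:(rewrite W1; unfold L in *; nra)
                                      ltac:(rewrite W2; unfold L in *; nra))).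
  rewrite W1, W2 in E'.
  rewrite <- Rmult_plus_distr_r, Rpow_mult_distr, <- pow_mult, Nat.mul_comm, pow_mult in E'.
  replace ((/ 2) ^ 2) with (/ 4) in E' by field.
  assert (Hp4 : 0 < (/ 4) ^ n) by (apply pow_lt; lra).
  rewrite <- Rmult_assoc in E'. apply Rmult_le_reg_r in E'; auto.
  assert (Hle : (b0 - a0 + (d0 - c0)) ^ 2 <= L ^ 2) by (apply pow_incr; unfold L; lra).
  assert (HL2 : 0 < L ^ 2) by (apply pow_lt; auto).
  apply (Rmult_le_compat_l (N a0 b0 c0 d0 / (2 * L ^ 2))) in Hle.
  2:{ apply Rlt_le, Rdiv_lt_0_compat; lra. }
  replace (N a0 b0 c0 d0 / (2 * L ^ 2) * L ^ 2) with (N a0 b0 c0 d0 / 2) in Hle by (field; lra).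
  lra.
Qed.

(** * Integrals of complex functions of a real variable *)

Definition CI (f : R -> C) (a b : R) : C :=
  (RInt (fun t => Re (f t)) a b, RInt (fun t => Im (f t)) a b).

Definition pcont (f : R -> C) (t : R) : Prop :=
  forall eps, 0 < eps -> exists delta, 0 < delta /\
    forall s, Rabs (s - t) < delta -> Cmod (f s - f t) <= eps.

Lemma im_le_Cmod (z : C) : Rabs (Im z) <= Cmod z.
Proof. eapply Rle_trans; [|apply Rmax_Cmod]. apply Rmax_r. Qed.

Lemma Cmod_le_re_im (z : C) : Cmod z <= Rabs (Re z) + Rabs (Im z).
Proof.
  replace z with (RtoC (Re z) + Ci * RtoC (Im z))%C at 1.
  - eapply Rle_trans. apply Cmod_triangle. rewrite Cmod_mult, Cmod_Ci, !Cmod_R. lra.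
  - destruct z as [x y]. unfold Ci, RtoC, Cplus, Cmult; simpl. f_equal; ring.
Qed.

Lemma continuous_eps (f : R -> R) t :
  (forall eps, 0 < eps -> exists delta, 0 < delta /\
     forall s, Rabs (s - t) < delta -> Rabs (f s - f t) <= eps) -> continuous f t.
Proof.
  intros H P [e He]. destruct (H (e / 2)) as (d & Hd & Hs).
  { destruct e; simpl; lra. }
  exists (mkposreal d Hd). intros s Hb. apply He.
  specialize (Hs s Hb). unfold ball; simpl; unfold AbsRing_ball, abs, minus, plus, opp; simpl.
  unfold Rminus in Hs. destruct e as [e He0]; simpl in *. lra.
Qed.

Lemma pcont_re f t : pcont f t -> continuous (fun t => Re (f t)) t.
Proof.
  intros H. apply continuous_eps. intros e He. destruct (H e He) as (d & Hd & Hs).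
  exists d. split; auto. intros s Hst. eapply Rle_trans; [|apply (Hs s Hst)].
  replace (Re (f s) - Re (f t)) with (Re (f s - f t)%C) by reflexivity. apply re_le_Cmod.
Qed.
Lemma pcont_im f t : pcont f t -> continuous (fun t => Im (f t)) t.
Proof.
  intros H. apply continuous_eps. intros e He. destruct (H e He) as (d & Hd & Hs).
  exists d. split; auto. intros s Hst. eapply Rle_trans; [|apply (Hs s Hst)].
  replace (Im (f s) - Im (f t)) with (Im (f s - f t)%C) by reflexivity. apply im_le_Cmod.
Qed.

Definition pcont_on f a b := forall t, a <= t <= b -> pcont f t.

Lemma pc_re f a b : a <= b -> pcont_on f a b -> ex_RInt (fun t => Re (f t)) a b.
Proof.
  intros Hab H. apply (ex_RInt_continuous (V:=R_CompleteNormedModule)).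
  rewrite Rmin_left, Rmax_right by auto. intros t Ht. apply pcont_re. auto.
Qed.
Lemma pc_im f a b : a <= b -> pcont_on f a b -> ex_RInt (fun t => Im (f t)) a b.
Proof.
  intros Hab H. apply (ex_RInt_continuous (V:=R_CompleteNormedModule)).
  rewrite Rmin_left, Rmax_right by auto. intros t Ht. apply pcont_im. auto.
Qed.

Lemma pcont_const c t : pcont (fun _ => c) t.
Proof.
  intros e He. exists 1. split. lra. intros s _.
  replace (c - c)%C with (RtoC 0) by ring. rewrite Cmod_0. lra.
Qed.

Lemma pcont_minus f g t : pcont f t -> pcont g t -> pcont (fun t => f t - g t)%C t.
Proof.
  intros Hf Hg e He.
  destruct (Hf (e / 2)) as (d1 & Hd1 & H1). lra.
  destruct (Hg (e / 2)) as (d2 & Hd2 & H2). lra.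
  exists (Rmin d1 d2). split. now apply Rmin_pos. intros s Hs.
  specialize (H1 s (Rlt_le_trans _ _ _ Hs (Rmin_l _ _))).
  specialize (H2 s (Rlt_le_trans _ _ _ Hs (Rmin_r _ _))).
  replace (f s - g s - (f t - g t))%C with ((f s - f t) - (g s - g t))%C by ring.
  eapply Rle_trans. apply Cmod_triangle_sub. lra.
Qed.

Lemma pcont_comp (f : C -> C) g t : ccont f (g t) -> pcont g t -> pcont (fun t => f (g t)) t.
Proof.
  intros Hf Hg e He. destruct (Hf e He) as (d & Hd & H1).
  destruct (Hg (d / 2)) as (d2 & Hd2 & H2). lra.
  exists d2. split; auto. intros s Hs. apply H1. specialize (H2 s Hs). lra.
Qed.

Lemma CI_ext f g a b : a <= b -> (forall t, a <= t <= b -> f t = g t) -> CI f a b = CI g a b.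
Proof.
  intros Hab E. unfold CI. f_equal; apply RInt_ext;
  rewrite Rmin_left, Rmax_right by auto; intros t Ht; rewrite E; auto; lra.
Qed.

Lemma CI_plus f g a b : a <= b -> pcont_on f a b -> pcont_on g a b ->
  CI (fun t => f t + g t)%C a b = (CI f a b + CI g a b)%C.
Proof.
  intros Hab Hf Hg. unfold CI, Cplus; simpl. f_equal.
  - apply (RInt_plus (V:=R_CompleteNormedModule) (fun t => Re (f t)) (fun t => Re (g t)));
     now apply pc_re.
  - apply (RInt_plus (V:=R_CompleteNormedModule) (fun t => Im (f t)) (fun t => Im (g t)));
     now apply pc_im.
Qed.

Lemma CI_minus f g a b : a <= b -> pcont_on f a b -> pcont_on g a b ->
  CI (fun t => f t - g t)%C a b = (CI f a b - CI g a b)%C.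
Proof.
  intros Hab Hf Hg. unfold CI, Cminus, Cplus, Copp; simpl. f_equal.
  - apply (RInt_minus (V:=R_CompleteNormedModule) (fun t => Re (f t)) (fun t => Re (g t)));
     now apply pc_re.
  - apply (RInt_minus (V:=R_CompleteNormedModule) (fun t => Im (f t)) (fun t => Im (g t)));
     now apply pc_im.
Qed.

Lemma CI_scal (c : C) f a b : a <= b -> pcont_on f a b ->
  CI (fun t => c * f t)%C a b = (c * CI f a b)%C.
Proof.
  intros Hab Hf. unfold CI, Cmult; simpl.
  assert (Hs : forall (k : R) g, ex_RInt g a b -> RInt (fun t => k * g t) a b = k * RInt g a b).
  { intros k g Hg. apply (RInt_scal (V:=R_CompleteNormedModule) g a b k Hg). }
  assert (Hse : forall (k : R) g, ex_RInt g a b -> ex_RInt (fun t => k * g t) a b).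
  { intros k g Hg. apply (ex_RInt_scal (V:=R_NormedModule) g a b k Hg). }
  assert (Hr := pc_re f a b Hab Hf). assert (Hi := pc_im f a b Hab Hf).
  f_equal.
  - transitivity (RInt (fun t => minus (fst c * Re (f t)) (snd c * Im (f t))) a b). reflexivity.
    rewrite (RInt_minus (V:=R_CompleteNormedModule)) by auto.
    rewrite !Hs by auto. reflexivity.
  - transitivity (RInt (fun t => plus (fst c * Im (f t)) (snd c * Re (f t))) a b). reflexivity.
    rewrite (RInt_plus (V:=R_CompleteNormedModule)) by auto.
    rewrite !Hs by auto. reflexivity.
Qed.

Lemma CI_const c a b : CI (fun _ => c) a b = (RtoC (b - a) * c)%C.
Proof.
  unfold CI. rewrite !RInt_const. unfold scal, Cmult, RtoC; simpl.
  unfold mult; simpl. f_equal; unfold Re, Im; ring.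
Qed.

Lemma CI_Chasles f a m b : a <= m -> m <= b -> pcont_on f a b ->
  CI f a b = (CI f a m + CI f m b)%C.
Proof.
  intros H1 H2 Hf. unfold CI, Cplus; simpl.
  assert (Hf1 : pcont_on f a m) by (intros t Ht; apply Hf; lra).
  assert (Hf2 : pcont_on f m b) by (intros t Ht; apply Hf; lra).
  f_equal; symmetry.
  - apply (RInt_Chasles (V:=R_CompleteNormedModule) (fun t => Re (f t))); now apply pc_re.
  - apply (RInt_Chasles (V:=R_CompleteNormedModule) (fun t => Im (f t))); now apply pc_im.
Qed.

Lemma CI_bound f a b M : a <= b -> pcont_on f a b ->
  (forall t, a <= t <= b -> Cmod (f t) <= M) -> Cmod (CI f a b) <= 2 * (b - a) * M.
Proof.
  intros Hab Hf HM. eapply Rle_trans. apply Cmod_le_re_im. unfold CI; simpl.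
  assert (H1 : Rabs (RInt (fun t => Re (f t)) a b) <= (b - a) * M).
  { apply abs_RInt_le_const; auto. now apply pc_re.
    intros t Ht. eapply Rle_trans. apply re_le_Cmod. auto. }
  assert (H2 : Rabs (RInt (fun t => Im (f t)) a b) <= (b - a) * M).
  { apply abs_RInt_le_const; auto. now apply pc_im.
    intros t Ht. eapply Rle_trans. apply im_le_Cmod. auto. }
  lra.
Qed.

(* [G] is read as a function of the complex variable [x + i t]. *)
Definition strip_diff (G : R -> R -> C) (x t : R) (l : C) : Prop :=
  forall eps, 0 < eps -> exists delta, 0 < delta /\
    forall x' t', Rabs (x' - x) < delta -> Rabs (t' - t) < delta ->
      Cmod (G x' t' - G x t - l * (x' - x, t' - t)%R)
        <= eps * (Rabs (x' - x) + Rabs (t' - t)).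

Lemma strip_diff_pcont_l G x t l : strip_diff G x t l -> pcont (fun x => G x t) x.
Proof.
  intros H e He. destruct (H 1 Rlt_0_1) as (d & Hd & Hx). assert (Hl := Cmod_ge_0 l).
  exists (Rmin d (e / (1 + Cmod l))). split.
  { apply Rmin_pos; auto. apply Rdiv_lt_0_compat; lra. }
  intros s Hs.
  assert (H1 := Rlt_le_trans _ _ _ Hs (Rmin_l _ _)).
  assert (H2 := Rlt_le_trans _ _ _ Hs (Rmin_r _ _)).
  specialize (Hx s t H1). rewrite Rminus_diag, Rabs_R0 in Hx. specialize (Hx Hd).
  replace (G s t - G x t)%C with ((G s t - G x t - l * (s - x, 0)%R) + l * RtoC (s - x))%C
    by (unfold RtoC; ring).
  eapply Rle_trans. apply Cmod_triangle. rewrite Cmod_mult, Cmod_R.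
  replace e with ((1 + Cmod l) * (e / (1 + Cmod l))) by (field; lra).
  apply Rle_trans with ((1 + Cmod l) * Rabs (s - x)). lra.
  apply Rmult_le_compat_l; lra.
Qed.

Lemma strip_diff_pcont_r G x t l : strip_diff G x t l -> pcont (fun t => G x t) t.
Proof.
  intros H e He. destruct (H 1 Rlt_0_1) as (d & Hd & Hx). assert (Hl := Cmod_ge_0 l).
  exists (Rmin d (e / (1 + Cmod l))). split.
  { apply Rmin_pos; auto. apply Rdiv_lt_0_compat; lra. }
  intros s Hs.
  assert (H1 := Rlt_le_trans _ _ _ Hs (Rmin_l _ _)).
  assert (H2 := Rlt_le_trans _ _ _ Hs (Rmin_r _ _)).
  specialize (Hx x s). rewrite Rminus_diag, Rabs_R0 in Hx. specialize (Hx Hd H1).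
  replace (G x s - G x t)%C with ((G x s - G x t - l * (0, s - t)%R) + l * (Ci * RtoC (s - t)))%C.
  2:{ replace (0, s - t)%R with (Ci * RtoC (s - t))%C. ring.
      unfold Ci, RtoC, Cmult; simpl; f_equal; ring. }
  eapply Rle_trans. apply Cmod_triangle. rewrite !Cmod_mult, Cmod_R, Cmod_Ci.
  replace e with ((1 + Cmod l) * (e / (1 + Cmod l))) by (field; lra).
  apply Rle_trans with ((1 + Cmod l) * Rabs (s - t)). lra.
  apply Rmult_le_compat_l; lra.
Qed.

(** The counterclockwise contour integral: bottom minus top, then right minus left with dz = i
    dt. *)
Definition rect_int (G : R -> R -> C) (a b c d : R) : C :=
  (CI (fun x => G x c - G x d) a b + Ci * CI (fun t => G b t - G a t) c d)%C.

(** Near a point G is affine up to an error small against the size of the rectangle. The affine part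
    has boundary integral zero, so a small rectangle carries o(size^2), as the bisection lemma
    requires. *)
Lemma goursat_rect (G : R -> R -> C) a0 b0 c0 d0 : a0 <= b0 -> c0 <= d0 ->
  (forall x t, a0 <= x <= b0 -> exists l, strip_diff G x t l) ->
  rect_int G a0 b0 c0 d0 = 0.
Proof.
  intros Hab Hcd HG.
  assert (Px : forall t a b, a0 <= a -> b <= b0 -> pcont_on (fun x => G x t) a b).
  { intros t a b Ha Hb x Hx. destruct (HG x t) as [l Hl]. lra.
    now apply strip_diff_pcont_l with l. }
  assert (Pt : forall x c d, a0 <= x <= b0 -> pcont_on (fun t => G x t) c d).
  { intros x c d Hx t Ht. destruct (HG x t) as [l Hl]. lra.
    now apply strip_diff_pcont_r with l. }
  apply Cmod_eq_0. apply Rle_antisym; [|apply Cmod_ge_0].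
  apply (bisection_vanish (fun a b c d => Cmod (rect_int G a b c d))); auto.
  - intros a b c d Ha Hb Hc Hd He Hf. set (m := (a + b) / 2). set (n := (c + d) / 2).
    assert (Hm : a <= m <= b) by (unfold m; lra). assert (Hn : c <= n <= d) by (unfold n; lra).
    replace (rect_int G a b c d) with
      (rect_int G a m c n + rect_int G m b c n + rect_int G a m n d + rect_int G m b n d)%C.
    { eapply Rle_trans. apply Cmod_triangle. apply Rplus_le_compat_r.
      eapply Rle_trans. apply Cmod_triangle. apply Rplus_le_compat_r. apply Cmod_triangle. }
    unfold rect_int.
    rewrite !CI_minus by first [lra | apply Px; lra | apply Pt; lra].
    rewrite (CI_Chasles (fun x => G x c) a m b), (CI_Chasles (fun x => G x d) a m b),
      (CI_Chasles (G b) c n d), (CI_Chasles (G a) c n d)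
      by first [lra | apply Px; lra | apply Pt; lra].
    ring.
  - intros x t Hx Ht eps He. destruct (HG x t Hx) as [l Hl].
    (* One factor 2 is lost because two opposite sides are paired, another because [CI_bound] treats
       real and imaginary parts separately. *)
    destruct (Hl (eps / 4)) as (dl & Hdl & Hest). lra.
    exists dl. split; auto. intros a b c d Ha Hb Hc Hd H1 H2.
    set (E := fun x' t' => (G x' t' - G x t - l * (x' - x, t' - t)%R)%C).
    set (S := (b - a) + (d - c)).
    assert (HE : forall x' t', a <= x' <= b -> c <= t' <= d -> Cmod (E x' t') <= eps / 4 * S).
    { intros x' t' Hx' Ht'. eapply Rle_trans. apply Hest; apply Rabs_def1; lra.
      apply Rmult_le_compat_l. lra. unfold S.
      apply Rplus_le_compat; apply Rabs_le; lra. }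
    (* On two opposite sides the affine parts of G differ by a constant. The horizontal pair
       contributes - i l (b - a)(d - c), which cancels the vertical contribution of [Q2]. *)
    assert (Q1 : pcont_on (fun x' => E x' c - E x' d)%C a b /\
                 CI (fun x' => G x' c - G x' d)%C a b =
                 (RtoC (b - a) * (l * (0, c - d)%R) + CI (fun x' => E x' c - E x' d) a b)%C).
    { assert (P : pcont_on (fun x' => E x' c - E x' d)%C a b).
      { intros y Hy e Hee.
        assert (Py : pcont (fun x => G x c - G x d)%C y).
        { apply pcont_minus; [apply (Px c a b) | apply (Px d a b)]; lra. }
        destruct (Py e Hee) as (dd & Hdd & Hdd'). exists dd. split; auto.
        intros s Hs. specialize (Hdd' s Hs). unfold E.
        match goal with |- Cmod ?u <= _ => match type of Hdd' with Cmod ?v <= _ =>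
          replace u with v; [exact Hdd'|] end end.
        unfold Cminus, Cplus, Cmult, Copp; simpl; f_equal; ring. }
      split; auto. rewrite <- CI_const, <- CI_plus; auto; try lra.
      2: intros y Hy; apply pcont_const.
      apply CI_ext. lra. intros y Hy. unfold E.
      unfold Cminus, Cplus, Cmult, Copp; simpl; f_equal; ring. }
    assert (Q2 : pcont_on (fun t' => E b t' - E a t')%C c d /\
                 CI (fun t' => G b t' - G a t')%C c d =
                 (RtoC (d - c) * (l * RtoC (b - a)) + CI (fun t' => E b t' - E a t') c d)%C).
    { assert (P : pcont_on (fun t' => E b t' - E a t')%C c d).
      { intros y Hy e Hee.
        assert (Py : pcont (fun t => G b t - G a t)%C y).
        { apply pcont_minus; [apply (Pt b c d) | apply (Pt a c d)]; lra. }
        destruct (Py e Hee) as (dd & Hdd & Hdd'). exists dd. split; auto.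
        intros s Hs. specialize (Hdd' s Hs). unfold E.
        match goal with |- Cmod ?u <= _ => match type of Hdd' with Cmod ?v <= _ =>
          replace u with v; [exact Hdd'|] end end.
        unfold Cminus, Cplus, Cmult, Copp; simpl; f_equal; ring. }
      split; auto. rewrite <- CI_const, <- CI_plus; auto; try lra.
      2: intros y Hy; apply pcont_const.
      apply CI_ext. lra. intros y Hy. unfold E, RtoC.
      unfold Cminus, Cplus, Cmult, Copp; simpl; f_equal; ring. }
    destruct Q1 as [P1 Q1], Q2 as [P2 Q2].
    unfold rect_int. rewrite Q1, Q2.
    replace (_ + _)%C with (CI (fun x' => E x' c - E x' d) a b
                          + Ci * CI (fun t' => E b t' - E a t') c d)%C.
    2:{ replace (0, c - d)%R with (- (Ci * RtoC (d - c)))%C. ring.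
        unfold Ci, RtoC, Cmult, Copp; simpl; f_equal; ring. }
    eapply Rle_trans. apply Cmod_triangle. rewrite Cmod_mult, Cmod_Ci, Rmult_1_l.
    assert (B1 := CI_bound _ a b (eps / 4 * S + eps / 4 * S) ltac:(lra) P1
      ltac:(intros y Hy; eapply Rle_trans; [apply Cmod_triangle_sub|];
            apply Rplus_le_compat; apply HE; lra)).
    assert (B2 := CI_bound _ c d (eps / 4 * S + eps / 4 * S) ltac:(lra) P2
      ltac:(intros y Hy; eapply Rle_trans; [apply Cmod_triangle_sub|];
            apply Rplus_le_compat; apply HE; lra)).
    eapply Rle_trans. apply Rplus_le_compat; [exact B1|exact B2].
    fold S. right. unfold S. field.
Qed.

(** Equal values at heights c and d make the horizontal sides cancel, so Goursat equates the two
    vertical ones. *)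
Lemma periodic_strip_int (G : R -> R -> C) a b c d : a <= b -> c <= d ->
  (forall x t, a <= x <= b -> exists l, strip_diff G x t l) ->
  (forall x, a <= x <= b -> G x c = G x d) ->
  CI (G a) c d = CI (G b) c d.
Proof.
  intros Hab Hcd HG Hper.
  assert (H := goursat_rect G a b c d Hab Hcd HG). unfold rect_int in H.
  rewrite (CI_ext _ (fun _ => RtoC 0) a b) in H; auto.
  2:{ intros x Hx. rewrite Hper by auto. ring. }
  rewrite CI_const in H.
  assert (Pt : forall x, a <= x <= b -> pcont_on (fun t => G x t) c d).
  { intros x Hx t Ht. destruct (HG x t Hx) as [l Hl]. now apply strip_diff_pcont_r with l. }
  rewrite CI_minus in H; auto; try (apply Pt; lra).
  assert (E : (Ci * (CI (G b) c d - CI (G a) c d))%C = 0).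
  { rewrite <- H. ring. }
  assert (E2 : Cmod (CI (G b) c d - CI (G a) c d) = 0).
  { rewrite <- (Rmult_1_l (Cmod _)), <- Cmod_Ci, <- Cmod_mult, E. apply Cmod_0. }
  apply Cmod_eq_0 in E2.
  replace (CI (G b) c d) with
    ((CI (G b) c d - CI (G a) c d) + CI (G a) c d)%C by ring.
  rewrite E2. ring.
Qed.

(** * Polar coordinates and integrals over circles *)

Definition circ (r t : R) : C := (r * cos t, r * sin t)%R.

Lemma Cmod_circ r t : 0 <= r -> Cmod (circ r t) = r.
Proof.
  intros Hr. unfold Cmod, circ; simpl.
  replace (r * cos t * (r * cos t * 1) + r * sin t * (r * sin t * 1)) with (r * r).
  now apply sqrt_square.
  generalize (sin2_cos2 t). unfold Rsqr. intros H.
  replace (r * cos t * (r * cos t * 1) + r * sin t * (r * sin t * 1))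
    with (r * r * (sin t * sin t + cos t * cos t)) by ring. rewrite H. ring.
Qed.

Lemma circ_add r s t u : circ (r * s) (t + u) = (circ r t * circ s u)%C.
Proof. unfold circ, Cmult; simpl. rewrite cos_plus, sin_plus. f_equal; ring. Qed.

Lemma circ_period r t : circ r (t + 2 * PI) = circ r t.
Proof.
  unfold circ. rewrite cos_plus, sin_plus, cos_2PI, sin_2PI. f_equal; ring.
Qed.

Lemma derivable_eps f l : derivable_pt_lim f 0 l -> forall eps, 0 < eps ->
  exists delta, 0 < delta /\ forall h, Rabs h < delta -> Rabs (f h - f 0 - l * h) <= eps * Rabs h.
Proof.
  intros H eps He. destruct (H eps He) as [d Hd]. exists d. split. apply cond_pos.
  intros h Hh. destruct (Req_dec h 0) as [->|Hn].
  - replace (f 0 - f 0 - l * 0) with 0 by ring. rewrite Rabs_R0. lra.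
  - specialize (Hd h Hn Hh). rewrite Rplus_0_l in Hd.
    replace (f h - f 0 - l * h) with (((f h - f 0) / h - l) * h) by (field; auto).
    rewrite Rabs_mult. apply Rmult_le_compat_r. apply Rabs_pos. lra.
Qed.

(** [circ (exp x) t] is the complex exponential of x + i t. Its derivative at 0 is assembled from
    those of [exp], [cos] and [sin]; the addition formula then carries it to every other point. *)
Lemma circ_exp_diff0 eps : 0 < eps -> exists delta, 0 < delta /\
  forall x t, Rabs x < delta -> Rabs t < delta ->
   Cmod (circ (exp x) t - 1 - (x, t)%R) <= eps * (Rabs x + Rabs t).
Proof.
  intros He.
  destruct (derivable_eps exp 1) with (eps := Rmin 1 (eps / 4)) as (d1 & Hd1 & H1).
  { generalize (derivable_pt_lim_exp 0). now rewrite exp_0. } { apply Rmin_pos; lra. }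
  destruct (derivable_eps cos 0) with (eps := eps / 4) as (d2 & Hd2 & H2).
  { generalize (derivable_pt_lim_cos 0). now rewrite sin_0, Ropp_0. }
  { lra. }
  destruct (derivable_eps sin 1) with (eps := Rmin 1 (eps / 4)) as (d3 & Hd3 & H3).
  { generalize (derivable_pt_lim_sin 0). now rewrite cos_0. } { apply Rmin_pos; lra. }
  exists (Rmin (Rmin d1 d2) (Rmin d3 (Rmin 1 (eps / 16)))). split.
  { repeat apply Rmin_pos; lra. }
  intros x t Hx Ht.
  assert (M := Rmin_l 1 (eps / 4)). assert (M' := Rmin_r 1 (eps / 4)).
  assert (K : forall y, Rabs y < Rmin (Rmin d1 d2) (Rmin d3 (Rmin 1 (eps / 16))) ->
     Rabs y < d1 /\ Rabs y < d2 /\ Rabs y < d3 /\ Rabs y < 1 /\ Rabs y < eps / 16).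
  { intros y Hy.
    assert (A1 := Rmin_l (Rmin d1 d2) (Rmin d3 (Rmin 1 (eps / 16)))).
    assert (A2 := Rmin_r (Rmin d1 d2) (Rmin d3 (Rmin 1 (eps / 16)))).
    assert (A3 := Rmin_l d1 d2). assert (A4 := Rmin_r d1 d2).
    assert (A5 := Rmin_l d3 (Rmin 1 (eps / 16))). assert (A6 := Rmin_r d3 (Rmin 1 (eps / 16))).
    assert (A7 := Rmin_l 1 (eps / 16)). assert (A8 := Rmin_r 1 (eps / 16)). lra. }
  destruct (K x Hx) as (X1 & X2 & X3 & X4 & X5). destruct (K t Ht) as (T1 & T2 & T3 & T4 & T5).
  specialize (H1 x X1). specialize (H2 t T2). specialize (H3 t T3).
  rewrite exp_0 in H1. rewrite cos_0 in H2. rewrite sin_0 in H3.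
  assert (Px := Rabs_pos x). assert (Pt := Rabs_pos t).
  assert (Hc : Rabs (cos t) <= 1). { apply Rabs_le. apply COS_bound. }
  assert (Hs : Rabs (sin t) <= 2 * Rabs t).
  { replace (sin t) with ((sin t - 0 - 1 * t) + t) by ring.
    eapply Rle_trans. apply Rabs_triang.
    assert (Rmin 1 (eps / 4) * Rabs t <= 1 * Rabs t) by (apply Rmult_le_compat_r; lra). lra. }
  assert (Hex : Rabs (exp x - 1) <= 2 * Rabs x).
  { replace (exp x - 1) with ((exp x - 1 - 1 * x) + x) by ring.
    eapply Rle_trans. apply Rabs_triang.
    assert (Rmin 1 (eps / 4) * Rabs x <= 1 * Rabs x) by (apply Rmult_le_compat_r; lra). lra. }
  eapply Rle_trans. apply Cmod_le_re_im. simpl.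
  assert (B1 : Rabs (exp x * cos t + - (1) + - x) <= eps / 4 * Rabs x + 2 * (eps / 4 * Rabs t)).
  { replace (exp x * cos t + - (1) + - x)
      with ((exp x - 1 - 1 * x) * cos t + (1 + x) * (cos t - 1 - 0 * t)) by ring.
    eapply Rle_trans. apply Rabs_triang. rewrite !Rabs_mult.
    apply Rplus_le_compat.
    - apply Rle_trans with (Rabs (exp x - 1 - 1 * x) * 1).
      apply Rmult_le_compat_l; auto. apply Rabs_pos.
      rewrite Rmult_1_r. eapply Rle_trans. exact H1. apply Rmult_le_compat_r; lra.
    - apply Rmult_le_compat; auto using Rabs_pos.
      eapply Rle_trans. apply Rabs_triang. rewrite Rabs_R1. lra. }
  assert (B2 : Rabs (exp x * sin t + - 0 + - t) <= eps / 16 * (2 * Rabs t) * 2 + eps / 4 * Rabs t).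
  { replace (exp x * sin t + - 0 + - t)
      with ((exp x - 1) * sin t + (sin t - 0 - 1 * t)) by ring.
    eapply Rle_trans. apply Rabs_triang. rewrite !Rabs_mult.
    apply Rplus_le_compat.
    - apply Rle_trans with (2 * Rabs x * (2 * Rabs t)).
      apply Rmult_le_compat; auto using Rabs_pos.
      apply Rle_trans with (2 * (eps / 16) * (2 * Rabs t)); [|lra].
      apply Rmult_le_compat_r; lra.
    - eapply Rle_trans. exact H3. apply Rmult_le_compat_r; lra. }
  nra.
Qed.

Lemma circ_exp_diff x t :
  strip_diff (fun x t => circ (exp x) t) x t (circ (exp x) t).
Proof.
  intros eps He. assert (Hp := exp_pos x).
  destruct (circ_exp_diff0 (eps / exp x)) as (d & Hd & H). now apply Rdiv_lt_0_compat.
  exists d. split; auto. intros x' t' Hx Ht. specialize (H _ _ Hx Ht).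
  replace (circ (exp x') t' ) with (circ (exp x) t * circ (exp (x' - x)) (t' - t))%C.
  2:{ rewrite <- circ_add, <- exp_plus. f_equal; [f_equal|]; ring. }
  replace (_ - _ - _)%C with
    (circ (exp x) t * (circ (exp (x' - x)) (t' - t) - 1 - (x' - x, t' - t)%R))%C by ring.
  rewrite Cmod_mult, Cmod_circ by lra.
  apply (Rmult_le_compat_l (exp x)) in H; [|lra].
  eapply Rle_trans. exact H. right. field. lra.
Qed.

Lemma strip_diff_comp (h : C -> C) G x t l m :
  cdiff h (G x t) l -> strip_diff G x t m -> strip_diff (fun x t => h (G x t)) x t (l * m)%C.
Proof.
  intros Hh HG eps He. assert (Pl := Cmod_ge_0 l). assert (Pm := Cmod_ge_0 m).
  destruct (Hh (eps / (2 * (Cmod m + 1)))) as (d1 & Hd1 & H1). apply Rdiv_lt_0_compat; lra.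
  destruct (HG (Rmin 1 (eps / (2 * (Cmod l + 1))))) as (d2 & Hd2 & H2).
  { apply Rmin_pos. lra. apply Rdiv_lt_0_compat; lra. }
  assert (M1 := Rmin_l 1 (eps / (2 * (Cmod l + 1)))).
  assert (M2 := Rmin_r 1 (eps / (2 * (Cmod l + 1)))).
  exists (Rmin d2 (d1 / (2 * (Cmod m + 1)))). split.
  { apply Rmin_pos; auto. apply Rdiv_lt_0_compat; lra. }
  intros x' t' Hx Ht.
  assert (X1 := Rlt_le_trans _ _ _ Hx (Rmin_l _ _)). assert (X2 := Rlt_le_trans _ _ _ Hx (Rmin_r _ _)).
  assert (T1 := Rlt_le_trans _ _ _ Ht (Rmin_l _ _)). assert (T2 := Rlt_le_trans _ _ _ Ht (Rmin_r _ _)).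
  specialize (H2 x' t' X1 T1).
  set (S := Rabs (x' - x) + Rabs (t' - t)) in *.
  assert (HS : 0 <= S) by (unfold S; generalize (Rabs_pos (x' - x)) (Rabs_pos (t' - t)); lra).
  assert (Hs : Cmod (x' - x, t' - t)%R <= S) by apply Cmod_le_re_im.
  set (D := (G x' t' - G x t)%C) in *. set (s := ((x' - x, t' - t)%R : C)) in *.
  assert (HD : Cmod D <= (Cmod m + 1) * S).
  { replace D with ((D - m * s) + m * s)%C by ring. eapply Rle_trans. apply Cmod_triangle.
    rewrite Cmod_mult.
    assert (Rmin 1 (eps / (2 * (Cmod l + 1))) * S <= 1 * S) by (apply Rmult_le_compat_r; lra).
    assert (Cmod m * Cmod s <= Cmod m * S) by (apply Rmult_le_compat_l; lra). lra. }
  assert (HDd : Cmod D < d1).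
  { eapply Rle_lt_trans. exact HD.
    apply Rlt_le_trans with ((Cmod m + 1) * (d1 / (2 * (Cmod m + 1)) + d1 / (2 * (Cmod m + 1)))).
    - apply Rmult_lt_compat_l. lra. unfold S. lra.
    - right. field. lra. }
  specialize (H1 (G x' t') HDd). fold D in H1.
  replace (h (G x' t') - h (G x t) - l * m * s)%C with
    ((h (G x' t') - h (G x t) - l * D) + l * (D - m * s))%C by ring.
  eapply Rle_trans. apply Cmod_triangle. rewrite Cmod_mult.
  apply Rle_trans with (eps / 2 * S + eps / 2 * S); [|right; field].
  apply Rplus_le_compat.
  - eapply Rle_trans. exact H1.
    apply Rle_trans with (eps / (2 * (Cmod m + 1)) * ((Cmod m + 1) * S)).
    apply Rmult_le_compat_l; auto. apply Rlt_le, Rdiv_lt_0_compat; lra.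
    right. field. lra.
  - apply Rle_trans with (Cmod l * (eps / (2 * (Cmod l + 1)) * S)).
    + apply Rmult_le_compat_l; auto. eapply Rle_trans. exact H2. now apply Rmult_le_compat_r.
    + apply Rle_trans with ((Cmod l + 1) * (eps / (2 * (Cmod l + 1)) * S)).
      * apply Rmult_le_compat_r; [|lra]. apply Rmult_le_pos; auto.
        apply Rlt_le, Rdiv_lt_0_compat; lra.
      * right. field. lra.
Qed.

(** The integration is against the angle, that is, of h(z) dz / (i z). Hence Cauchy's formula for
    the coefficient of z^k below has [/ z ^ k] where the contour form has z^(k + 1). *)
Definition circ_int (h : C -> C) (r : R) : C := CI (fun t => h (circ r t)) 0 (2 * PI).

Lemma two_PI_pos : 0 < 2 * PI.
Proof. generalize PI_RGT_0. lra. Qed.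

(** In the coordinate ln z the annulus is a strip on which h becomes 2 pi-periodic, and the two
    circles are its vertical sides. *)
Lemma annulus_const (h : C -> C) r1 r2 : 0 < r1 -> r1 <= r2 ->
  (forall z, r1 <= Cmod z <= r2 -> exists l, cdiff h z l) ->
  circ_int h r1 = circ_int h r2.
Proof.
  intros H0 H12 Hh.
  assert (E := periodic_strip_int (fun x t => h (circ (exp x) t)) (ln r1) (ln r2) 0 (2 * PI)).
  assert (P := two_PI_pos).
  cbv beta in E. unfold circ_int. rewrite !exp_ln in E by lra. apply E.
  - destruct H12 as [H12|H12]; [left; now apply ln_increasing | right; now rewrite H12].
  - lra.
  - intros x t Hx. destruct (Hh (circ (exp x) t)) as [l Hl].
    + rewrite Cmod_circ by (left; apply exp_pos).
      rewrite <- (exp_ln r1), <- (exp_ln r2) by lra. split.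
      * destruct (proj1 Hx) as [K|K]; [left; now apply exp_increasing | right; now rewrite K].
      * destruct (proj2 Hx) as [K|K]; [left; now apply exp_increasing | right; now rewrite K].
    + exists (l * circ (exp x) t)%C. apply (strip_diff_comp h (fun x t => circ (exp x) t)); auto.
      apply circ_exp_diff.
  - intros x _. rewrite <- (circ_period (exp x) 0). do 2 f_equal. ring.
Qed.

Lemma pcont_circ r t : pcont (circ r) t.
Proof.
  intros e He.
  destruct (continuity_cos t (e / (2 * (Rabs r + 1)))) as (d1 & Hd1 & H1).
  { apply Rdiv_lt_0_compat; generalize (Rabs_pos r); lra. }
  destruct (continuity_sin t (e / (2 * (Rabs r + 1)))) as (d2 & Hd2 & H2).
  { apply Rdiv_lt_0_compat; generalize (Rabs_pos r); lra. }
  exists (Rmin d1 d2). split. now apply Rmin_pos. intros s Hs.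
  destruct (Req_dec s t) as [->|Hst].
  { replace (_ - _)%C with (RtoC 0) by ring. rewrite Cmod_0. lra. }
  assert (H1' := H1 s (conj (conj I (not_eq_sym Hst)) (Rlt_le_trans _ _ _ Hs (Rmin_l _ _)))).
  assert (H2' := H2 s (conj (conj I (not_eq_sym Hst)) (Rlt_le_trans _ _ _ Hs (Rmin_r _ _)))).
  simpl in H1', H2'. unfold Rdist in *.
  eapply Rle_trans. apply Cmod_le_re_im. simpl.
  replace (r * cos s + - (r * cos t)) with (r * (cos s - cos t)) by ring.
  replace (r * sin s + - (r * sin t)) with (r * (sin s - sin t)) by ring.
  rewrite !Rabs_mult. assert (P := Rabs_pos r).
  apply Rle_trans with ((Rabs r + 1) * (e / (2 * (Rabs r + 1))) + (Rabs r + 1) * (e / (2 * (Rabs r + 1)))).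
  - apply Rplus_le_compat; apply Rmult_le_compat; try lra; apply Rabs_pos.
  - right. field. lra.
Qed.

Lemma circ_pcont_on (h : C -> C) r a b : 0 <= r ->
  (forall z, Cmod z = r -> ccont h z) -> pcont_on (fun t => h (circ r t)) a b.
Proof.
  intros Hr Hh t _. apply pcont_comp. apply Hh. now apply Cmod_circ. apply pcont_circ.
Qed.

(** * Cauchy's formula and Taylor expansion *)

Lemma circ_joint_cont (x y : R) : forall eps, 0 < eps -> exists delta, 0 < delta /\
  forall u v, Rabs (u - x) < delta -> Rabs (v - y) < delta -> Cmod (circ u v - circ x y) < eps.
Proof.
  intros eps He. destruct (pcont_circ x y (eps / 2)) as (d & Hd & H). lra.
  exists (Rmin d (eps / 2)). split. apply Rmin_pos; lra.
  intros u v Hu Hv.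
  replace (circ u v - circ x y)%C with ((RtoC (u - x) * circ 1 v) + (circ x v - circ x y))%C.
  2:{ unfold circ, RtoC, Cminus, Cplus, Cmult, Copp; simpl; f_equal; ring. }
  eapply Rle_lt_trans. apply Cmod_triangle.
  rewrite Cmod_mult, Cmod_R, Cmod_circ by lra.
  specialize (H v (Rlt_le_trans _ _ _ Hv (Rmin_l _ _))).
  assert (H2 := Rlt_le_trans _ _ _ Hu (Rmin_r _ _)). lra.
Qed.

Lemma circ_int_cont (h : C -> C) r0 : (forall z, in_disk z -> ccont h z) -> 0 < r0 < 1 ->
  forall eps, 0 < eps -> exists delta, 0 < delta /\ forall r, 0 < r < 1 -> Rabs (r - r0) < delta ->
    Cmod (circ_int h r - circ_int h r0) <= eps.
Proof.
  intros Hh Hr0 eps He. assert (PI0 := two_PI_pos).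
  set (a := r0 / 2). set (b := (1 + r0) / 2).
  (* Uniform continuity in (radius, angle) on a compact annulus around the radius [r0], for an
     arbitrary 1-Lipschitz g so that it serves both [Re] and [Im]. *)
  assert (Hc : forall (g : C -> R), (forall u v, Rabs (g u - g v) <= Cmod (u - v)) ->
    forall e : posreal, exists d : posreal, forall x y u v, a <= x <= b -> 0 <= y <= 2 * PI ->
       a <= u <= b -> 0 <= v <= 2 * PI -> Rabs (u - x) < d -> Rabs (v - y) < d ->
        Rabs (g (h (circ u v)) - g (h (circ x y))) < e).
  { intros g Hg. apply (uniform_continuity_2d (fun x t => g (h (circ x t)))).
    intros x y Hx Hy e. destruct (Hh (circ x y)) with (eps := e / 2) as (d & Hd & H).
    { unfold in_disk. rewrite Cmod_circ; unfold a, b in *; lra. } { destruct e; simpl; lra. }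
    destruct (circ_joint_cont x y d Hd) as (d' & Hd' & H').
    exists (mkposreal d' Hd'). simpl. intros u v Hu Hv.
    eapply Rle_lt_trans. apply Hg. eapply Rle_lt_trans. apply H. now apply H'.
    destruct e as [e Hee]; simpl; lra. }
  set (E := mkposreal (eps / (8 * PI)) ltac:(apply Rdiv_lt_0_compat; lra)).
  destruct (Hc Re) with (e := E) as [d1 H1].
  { intros u v. apply (re_le_Cmod (u - v)). }
  destruct (Hc Im) with (e := E) as [d2 H2].
  { intros u v. apply (im_le_Cmod (u - v)). }
  exists (Rmin (Rmin d1 d2) (Rmin (r0 / 2) ((1 - r0) / 2))). split.
  { repeat apply Rmin_pos; try lra; apply cond_pos. }
  intros r Hr Hd.
  assert (X1 := Rlt_le_trans _ _ _ Hd (Rmin_l _ _)). assert (X2 := Rlt_le_trans _ _ _ Hd (Rmin_r _ _)).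
  assert (Y1 := Rlt_le_trans _ _ _ X1 (Rmin_l _ _)). assert (Y2 := Rlt_le_trans _ _ _ X1 (Rmin_r _ _)).
  assert (Z1 := Rlt_le_trans _ _ _ X2 (Rmin_l _ _)). assert (Z2 := Rlt_le_trans _ _ _ X2 (Rmin_r _ _)).
  apply Rabs_def2 in Z1. apply Rabs_def2 in Z2.
  assert (Hra : a <= r <= b) by (unfold a, b; lra).
  assert (Hrb : a <= r0 <= b) by (unfold a, b; lra).
  assert (Pc : forall s, 0 < s < 1 -> pcont_on (fun t => h (circ s t)) 0 (2 * PI)).
  { intros s Hs. apply circ_pcont_on. lra. intros z Hz. apply Hh. unfold in_disk. lra. }
  unfold circ_int. rewrite <- CI_minus; auto; try lra.
  eapply Rle_trans. apply (CI_bound _ 0 (2 * PI) (eps / (4 * PI))); try lra.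
  - intros t Ht. apply pcont_minus; [apply Pc | apply Pc]; lra.
  - intros t Ht. eapply Rle_trans. apply Cmod_le_re_im.
    assert (A1 := H1 r0 t r t Hrb Ht Hra Ht Y1 ltac:(rewrite Rminus_diag, Rabs_R0; apply cond_pos)).
    assert (A2 := H2 r0 t r t Hrb Ht Hra Ht Y2 ltac:(rewrite Rminus_diag, Rabs_R0; apply cond_pos)).
    unfold E in A1, A2; simpl pos in A1, A2.
    replace (eps / (4 * PI)) with (eps / (8 * PI) + eps / (8 * PI)) by (field; lra).
    apply Rlt_le, Rplus_lt_compat; assumption.
  - right. field. lra.
Qed.

Lemma Cmod_small_0 (x : C) K : (forall eps, 0 < eps -> Cmod x <= K * eps) -> x = 0.
Proof.
  intros H. apply Cmod_eq_0. apply Rle_antisym; [|apply Cmod_ge_0].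
  apply Rnot_lt_le. intros Hp.
  specialize (H (Cmod x / (2 * (Rabs K + 1)))). assert (P := Rabs_pos K).
  assert (Q := Rle_abs K).
  assert (0 < Cmod x / (2 * (Rabs K + 1))) by (apply Rdiv_lt_0_compat; lra).
  specialize (H H0).
  assert (K * (Cmod x / (2 * (Rabs K + 1))) <= (Rabs K + 1) * (Cmod x / (2 * (Rabs K + 1)))) by nra.
  replace ((Rabs K + 1) * (Cmod x / (2 * (Rabs K + 1)))) with (Cmod x / 2) in H1 by (field; lra).
  lra.
Qed.

Lemma circ_int_limit0 (h : C -> C) c r0 : 0 < r0 <= 1 ->
  (forall z, in_disk z -> ccont h z) ->
  (forall r, 0 < r < r0 -> circ_int h r = c) -> c = (RtoC (2 * PI) * h 0)%C.
Proof.
  intros Hr0 Hh Hc. assert (PI0 := two_PI_pos).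
  assert (E : (c - RtoC (2 * PI) * h 0)%C = 0).
  { apply (Cmod_small_0 _ (2 * (2 * PI - 0))). intros eps He.
    destruct (Hh 0) with (eps := eps) as (d & Hd & H). { unfold in_disk. rewrite Cmod_0. lra. } auto.
    set (r := Rmin d r0 / 2).
    assert (Hr : 0 < r /\ r < d /\ r < r0).
    { unfold r. assert (0 < Rmin d r0) by (apply Rmin_pos; lra).
      generalize (Rmin_l d r0) (Rmin_r d r0). lra. }
    rewrite <- (Hc r) by lra.
    replace (2 * PI) with (2 * PI - 0) at 1 by ring.
    rewrite <- CI_const. unfold circ_int.
    assert (P : pcont_on (fun t => h (circ r t)) 0 (2 * PI)).
    { apply circ_pcont_on. lra. intros z Hz. apply Hh. unfold in_disk. lra. }
    rewrite <- CI_minus; auto; try lra. 2:{ intros t _. apply pcont_const. }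
    apply CI_bound. lra. { intros t Ht. apply pcont_minus. now apply P. apply pcont_const. }
    intros t _. apply H. replace (circ r t - 0)%C with (circ r t) by ring.
    rewrite Cmod_circ; lra. }
  replace c with ((c - RtoC (2 * PI) * h 0) + RtoC (2 * PI) * h 0)%C by ring. rewrite E. ring.
Qed.

(* The mean value property survives one point of mere continuity, because circle integrals
   depend continuously on the radius; this yields Cauchy's formula from [(f z - f w)/(z - w)]. *)
Lemma mean_value_punctured (h : C -> C) (w : C) r : 0 < r < 1 ->
  (forall z, in_disk z -> ccont h z) ->
  (forall z, in_disk z -> z <> w -> exists l, cdiff h z l) ->
  circ_int h r = (RtoC (2 * PI) * h 0)%C.
Proof.
  intros Hr Hh Hd.
  assert (Hann : forall s1 s2, 0 < s1 -> s1 <= s2 < 1 ->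
     (s2 < Cmod w \/ Cmod w < s1) -> circ_int h s1 = circ_int h s2).
  { intros s1 s2 H1 H2 H3. apply annulus_const; try lra. intros z Hz. apply Hd.
    - unfold in_disk. lra.
    - intros ->. lra. }
  assert (Hin : forall s, 0 < s < 1 -> (s < Cmod w \/ Cmod w <= 0) ->
     circ_int h s = (RtoC (2 * PI) * h 0)%C).
  { intros s Hs Hsw. apply circ_int_limit0 with s; auto; try lra.
    intros u Hu. apply Hann; lra. }
  destruct (Rlt_le_dec r (Cmod w)) as [H1|H1]. { apply Hin; auto. }
  destruct (Rle_lt_dec (Cmod w) 0) as [H2|H2]. { apply Hin; auto. }
  set (r0 := Cmod w) in *.
  (* The circle through w is reached from the inside by continuity in the radius; the larger circles
     are then linked to it from the outside in the same way. *)
  assert (Hmid : circ_int h r0 = (RtoC (2 * PI) * h 0)%C).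
  { assert (E : (circ_int h r0 - RtoC (2 * PI) * h 0)%C = 0).
    { apply (Cmod_small_0 _ 1). intros eps He.
      destruct (circ_int_cont h r0 Hh ltac:(lra) eps He) as (d & Hdp & H).
      set (s := r0 - Rmin d r0 / 2).
      assert (0 < Rmin d r0) by (apply Rmin_pos; lra).
      assert (M1 := Rmin_l d r0). assert (M2 := Rmin_r d r0).
      rewrite <- (Hin s) by (unfold s; lra).
      rewrite Cmod_sub_sym, Rmult_1_l. apply H. unfold s; lra.
      unfold s. apply Rabs_def1; lra. }
    replace (circ_int h r0) with ((circ_int h r0 - RtoC (2 * PI) * h 0) + RtoC (2 * PI) * h 0)%C
      by ring. rewrite E. ring. }
  destruct (Req_dec r r0) as [->|Hne]; auto.
  rewrite <- Hmid.
  assert (E : (circ_int h r - circ_int h r0)%C = 0).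
  { apply (Cmod_small_0 _ 1). intros eps He.
    destruct (circ_int_cont h r0 Hh ltac:(lra) eps He) as (d & Hdp & H).
    set (s := r0 + Rmin d (r - r0) / 2).
    assert (0 < Rmin d (r - r0)) by (apply Rmin_pos; lra).
    assert (M1 := Rmin_l d (r - r0)). assert (M2 := Rmin_r d (r - r0)).
    rewrite <- (Hann s r) by (unfold s; lra).
    rewrite Rmult_1_l. apply H. unfold s; lra.
    unfold s. apply Rabs_def1; lra. }
  replace (circ_int h r) with ((circ_int h r - circ_int h r0) + circ_int h r0)%C by ring.
  rewrite E. ring.
Qed.

Lemma circ_int_bound (h : C -> C) r M : 0 <= r ->
  (forall z, Cmod z = r -> ccont h z) -> (forall z, Cmod z = r -> Cmod (h z) <= M) ->
  Cmod (circ_int h r) <= 4 * PI * M.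
Proof.
  intros Hr Hh HM. assert (P := two_PI_pos).
  replace (4 * PI * M) with (2 * (2 * PI - 0) * M) by ring.
  apply CI_bound. lra. now apply circ_pcont_on.
  intros t _. apply HM. now apply Cmod_circ.
Qed.

Lemma circ_int_ext (h g : C -> C) r : 0 <= r ->
  (forall z, Cmod z = r -> h z = g z) -> circ_int h r = circ_int g r.
Proof.
  intros Hr E. apply CI_ext. apply Rlt_le, two_PI_pos. intros t _. apply E. now apply Cmod_circ.
Qed.

Lemma circ_int_plus (h g : C -> C) r : 0 <= r ->
  (forall z, Cmod z = r -> ccont h z) -> (forall z, Cmod z = r -> ccont g z) ->
  circ_int (fun z => h z + g z)%C r = (circ_int h r + circ_int g r)%C.
Proof.
  intros Hr Hh Hg. unfold circ_int. apply CI_plus. apply Rlt_le, two_PI_pos.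
  now apply circ_pcont_on. now apply circ_pcont_on.
Qed.

Lemma circ_int_scal c (h : C -> C) r : 0 <= r -> (forall z, Cmod z = r -> ccont h z) ->
  circ_int (fun z => c * h z)%C r = (c * circ_int h r)%C.
Proof.
  intros Hr Hh. unfold circ_int. apply (CI_scal c (fun t => h (circ r t))).
  apply Rlt_le, two_PI_pos. now apply circ_pcont_on.
Qed.

Lemma circ_pow r t n : (circ r t ^ n)%C = circ (r ^ n) (INR n * t).
Proof.
  induction n as [|n IH].
  - simpl. unfold circ. rewrite Rmult_0_l, cos_0, sin_0. unfold RtoC. f_equal; ring.
  - rewrite Cpow_S, IH, <- circ_add, S_INR. simpl. f_equal. ring.
Qed.

Lemma RInt_cos_n n : (0 < n)%nat -> RInt (fun t => cos (INR n * t)) 0 (2 * PI) = 0.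
Proof.
  intros Hn. assert (Hn' : INR n <> 0) by (apply not_0_INR; lia).
  apply is_RInt_unique.
  replace 0 with (minus (sin (INR n * (2 * PI)) / INR n) (sin (INR n * 0) / INR n)) at 2.
  - apply (is_RInt_derive (fun t => sin (INR n * t) / INR n)).
    + intros x _. auto_derive; auto. field. auto.
    + intros x _. apply continuity_pt_filterlim. reg.
  - unfold minus, plus, opp; simpl. rewrite Rmult_0_r, sin_0.
    replace (INR n * (2 * PI)) with (0 + 2 * INR n * PI) by ring.
    rewrite sin_period, sin_0. field. auto.
Qed.

Lemma RInt_sin_n n : RInt (fun t => sin (INR n * t)) 0 (2 * PI) = 0.
Proof.
  destruct (Nat.eq_dec n 0) as [->|Hn].
  - rewrite (RInt_ext _ (fun _ => 0)). rewrite RInt_const. unfold scal; simpl. unfold mult; simpl. ring.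
    intros x _. simpl. now rewrite Rmult_0_l, sin_0.
  - assert (Hn' : INR n <> 0) by now apply not_0_INR.
    apply is_RInt_unique.
    replace 0 with (minus (- cos (INR n * (2 * PI)) / INR n) (- cos (INR n * 0) / INR n)) at 2.
    + apply (is_RInt_derive (fun t => - cos (INR n * t) / INR n)).
      * intros x _. auto_derive; auto. field. auto.
      * intros x _. apply continuity_pt_filterlim. reg.
    + unfold minus, plus, opp; simpl. rewrite Rmult_0_r, cos_0.
      replace (INR n * (2 * PI)) with (0 + 2 * INR n * PI) by ring.
      rewrite cos_period, cos_0. field. auto.
Qed.

Lemma circ_int_inv_pow r k : 0 < r -> circ_int (fun z => / z ^ S k)%C r = 0.
Proof.
  intros Hr. assert (P := two_PI_pos).
  assert (Hz : forall z, Cmod z = r -> z <> 0). { intros z Hz. apply Cmod_gt_0. lra. }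
  unfold circ_int.
  rewrite (CI_ext _ (fun t => RtoC (/ r ^ S k) * (cos (INR (S k) * t), - sin (INR (S k) * t))%R)%C);
    [|lra|].
  - rewrite CI_scal; [|lra|].
    + replace (CI _ 0 (2 * PI)) with (RtoC 0). ring.
      unfold CI, RtoC. apply injective_projections; cbn [fst snd Re Im].
      * symmetry. apply (RInt_cos_n (S k)). lia.
      * rewrite (RInt_opp (V:=R_CompleteNormedModule) (fun t => sin (INR (S k) * t))).
        rewrite (RInt_sin_n (S k)). unfold opp; simpl. ring.
        apply (ex_RInt_continuous (V:=R_CompleteNormedModule)). intros t _.
        apply continuity_pt_filterlim. reg.
    + intros t _ e He.
      destruct (pcont_circ 1 (INR (S k) * t) e He) as (d & Hd & H).
      assert (Hk : 0 < INR (S k)) by (apply lt_0_INR; lia).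
      exists (d / INR (S k)). split. now apply Rdiv_lt_0_compat.
      intros s Hs. specialize (H (INR (S k) * s)).
      replace (_ - _)%C with (Cconj (circ 1 (INR (S k) * s) - circ 1 (INR (S k) * t))).
      rewrite Cmod_conj. apply H.
      rewrite <- Rmult_minus_distr_l, Rabs_mult, (Rabs_pos_eq (INR (S k))) by lra.
      apply (Rmult_lt_compat_l (INR (S k))) in Hs; auto.
      replace (INR (S k) * (d / INR (S k))) with d in Hs by (field; lra). exact Hs.
      unfold circ, Cconj, Cminus, Cplus, Copp; simpl fst; simpl snd. f_equal; ring.
  - intros t _. rewrite circ_pow.
    assert (Hr' : r ^ S k <> 0) by (apply pow_nonzero; lra).
    set (R := r ^ S k) in *. set (x := INR (S k) * t).
    assert (Hsc := sin2_cos2 x). unfold Rsqr in Hsc.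
    assert (Hnz : circ R x <> 0).
    { apply Cmod_gt_0. rewrite Cmod_circ. apply pow_lt; auto. apply pow_le; lra. }
    match goal with |- _ = ?u => set (v := u);
      assert (E : (circ R x * v)%C = 1) end.
    { unfold v, circ, RtoC, Cmult; cbn [fst snd Re Im]. apply injective_projections; cbn [fst snd].
      + transitivity (sin x * sin x + cos x * cos x); [field; auto | lra].
      + field. auto. }
    replace v with (/ circ R x * (circ R x * v))%C by (field; auto).
    rewrite E. ring.
Qed.

(** * Taylor coefficients and the remainder *)

Fixpoint csum (u : nat -> C) (n : nat) : C :=
  match n with O => 0 | S n => (csum u n + u n)%C end.

(** The radius 1 / 2 is arbitrary: by [taylor_coef_radius] every radius in (0,1) gives the same
    value. *)
Definition taylor_coef (f : C -> C) (k : nat) : C :=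
  (/ RtoC (2 * PI) * circ_int (fun z => f z * / z ^ k)%C (1 / 2))%C.

Lemma ccont_plus f g z : ccont f z -> ccont g z -> ccont (fun z => f z + g z)%C z.
Proof.
  intros Hf Hg e He.
  destruct (Hf (e / 2)) as (d1 & Hd1 & H1). lra.
  destruct (Hg (e / 2)) as (d2 & Hd2 & H2). lra.
  exists (Rmin d1 d2). split. now apply Rmin_pos. intros s Hs.
  specialize (H1 s (Rlt_le_trans _ _ _ Hs (Rmin_l _ _))).
  specialize (H2 s (Rlt_le_trans _ _ _ Hs (Rmin_r _ _))).
  replace (f s + g s - (f z + g z))%C with ((f s - f z) + (g s - g z))%C by ring.
  eapply Rle_trans. apply Cmod_triangle. lra.
Qed.

Lemma ccont_mult f g z : ccont f z -> ccont g z -> ccont (fun z => f z * g z)%C z.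
Proof.
  intros Hf Hg e He.
  set (M := 1 + Cmod (f z) + Cmod (g z)).
  assert (P1 := Cmod_ge_0 (f z)). assert (P2 := Cmod_ge_0 (g z)).
  assert (PM : 1 <= M) by (unfold M; lra).
  assert (Q : 0 < Rmin 1 (e / (2 * M))).
  { apply Rmin_pos. lra. apply Rdiv_lt_0_compat; lra. }
  assert (Q1 := Rmin_l 1 (e / (2 * M))). assert (Q2 := Rmin_r 1 (e / (2 * M))).
  destruct (Hf (Rmin 1 (e / (2 * M))) Q) as (d1 & Hd1 & H1).
  destruct (Hg (Rmin 1 (e / (2 * M))) Q) as (d2 & Hd2 & H2).
  exists (Rmin d1 d2). split. now apply Rmin_pos. intros s Hs.
  specialize (H1 s (Rlt_le_trans _ _ _ Hs (Rmin_l _ _))).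
  specialize (H2 s (Rlt_le_trans _ _ _ Hs (Rmin_r _ _))).
  replace (f s * g s - f z * g z)%C
    with ((f s - f z) * ((g s - g z) + g z) + f z * (g s - g z))%C by ring.
  eapply Rle_trans. apply Cmod_triangle. rewrite !Cmod_mult.
  assert (B : Cmod ((g s - g z) + g z) <= M - Cmod (f z)).
  { eapply Rle_trans. apply Cmod_triangle. unfold M. lra. }
  set (t := Rmin 1 (e / (2 * M))) in *.
  apply Rle_trans with (t * (M - Cmod (f z)) + Cmod (f z) * t).
  - apply Rplus_le_compat; apply Rmult_le_compat; auto using Cmod_ge_0; lra.
  - replace (t * (M - Cmod (f z)) + Cmod (f z) * t) with (t * M) by ring.
    apply (Rmult_le_compat_r M) in Q2; [|lra].
    replace (e / (2 * M) * M) with (e / 2) in Q2 by (field; lra). lra.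
Qed.

Lemma ccont_const c z : ccont (fun _ => c) z.
Proof. apply cdiff_ccont with (RtoC 0). apply cdiff_const. Qed.

Lemma cdiff_pow z n : exists l, cdiff (fun z => z ^ n)%C z l.
Proof.
  induction n as [|n [l Hl]].
  - exists 0. apply (cdiff_const 1).
  - eexists. apply (cdiff_mult (fun z => z) (fun z => z ^ n)%C). apply cdiff_id. exact Hl.
Qed.

Lemma cdiff_inv_pow (z : C) n : z <> 0 -> exists l, cdiff (fun z => / z ^ n)%C z l.
Proof.
  intros Hz. destruct (cdiff_pow z n) as [l Hl].
  eexists. apply (cdiff_comp (fun w => / w)%C (fun z => z ^ n)%C); [|exact Hl].
  apply cdiff_inv. exact (Cpow_nz z n Hz).
Qed.

Lemma nz_of_Cmod (z : C) : 0 < Cmod z -> z <> 0.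
Proof. apply Cmod_gt_0. Qed.

Lemma cdiff_quot_pow f z n : holo f -> in_disk z -> z <> 0 ->
  exists l, cdiff (fun z => f z * / z ^ n)%C z l.
Proof.
  intros Hf Hz Hnz. destruct (Hf z Hz) as [l Hl]. destruct (cdiff_inv_pow z n Hnz) as [m Hm].
  eexists. apply (cdiff_mult f (fun z => / z ^ n)%C); eassumption.
Qed.

Lemma taylor_coef_radius f k r : holo f -> 0 < r < 1 ->
  circ_int (fun z => f z * / z ^ k)%C r = (RtoC (2 * PI) * taylor_coef f k)%C.
Proof.
  intros Hf Hr. unfold taylor_coef.
  assert (P := two_PI_pos).
  assert (P' : RtoC (2 * PI) <> 0). { apply nz_of_Cmod. rewrite Cmod_R, Rabs_pos_eq; lra. }
  replace (RtoC (2 * PI) * (/ RtoC (2 * PI) * circ_int (fun z => f z * / z ^ k) (1 / 2)))%C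
    with (circ_int (fun z => f z * / z ^ k) (1 / 2))%C by (field; auto).
  assert (A : forall r1 r2, 0 < r1 -> r1 <= r2 < 1 ->
    circ_int (fun z => f z * / z ^ k)%C r1 = circ_int (fun z => f z * / z ^ k)%C r2).
  { intros r1 r2 H1 H2. apply annulus_const; try lra. intros z Hz.
    apply cdiff_quot_pow; auto. unfold in_disk; lra. apply nz_of_Cmod. lra. }
  destruct (Rle_lt_dec r (1 / 2)); [|symmetry]; apply A; lra.
Qed.

Lemma ccont_quot_pow f z n : holo f -> in_disk z -> z <> 0 -> ccont (fun z => f z * / z ^ n)%C z.
Proof.
  intros Hf Hz Hn. destruct (cdiff_quot_pow f z n Hf Hz Hn) as [l Hl].
  eapply cdiff_ccont; exact Hl.
Qed.

(** With l the derivative of f at w this is continuous at w and differentiable elsewhere, exactly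
    the situation of [mean_value_punctured]. *)
Definition diff_quot (f : C -> C) (w l z : C) : C :=
  if Ceq_dec z w then l else ((f z - f w) / (z - w))%C.

Lemma Csub_nz (z w : C) : z <> w -> (z - w)%C <> 0.
Proof.
  intros H E. apply H. replace z with ((z - w) + w)%C by ring. rewrite E. ring.
Qed.

Lemma diff_quot_cdiff f w l z : holo f -> in_disk z -> z <> w ->
  exists m, cdiff (diff_quot f w l) z m.
Proof.
  intros Hf Hz Hzw. destruct (Hf z Hz) as [m Hm].
  assert (D : 0 < Cmod (z - w)) by (apply Cmod_gt_0; now apply Csub_nz).
  eexists. apply (cdiff_ext_loc (fun z => (f z + - f w) * / (z + - w))%C _ z _ (Cmod (z - w))); auto.
  - intros u Hu. unfold diff_quot. destruct (Ceq_dec u w) as [->|Hn].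
    + rewrite Cmod_sub_sym in Hu. lra.
    + reflexivity.
  - apply (cdiff_mult (fun z => f z + - f w)%C (fun z => / (z + - w))%C).
    + apply cdiff_plus. exact Hm. apply cdiff_const.
    + apply (cdiff_comp (fun u => / u)%C (fun z => z + - w)%C).
      * apply cdiff_inv. now apply Csub_nz.
      * apply cdiff_plus. apply cdiff_id. apply cdiff_const.
Qed.

Lemma diff_quot_ccont f w l z : holo f -> in_disk z -> cdiff f w l -> ccont (diff_quot f w l) z.
Proof.
  intros Hf Hz Hl. destruct (Ceq_dec z w) as [->|Hn].
  - intros e He. destruct (Hl e He) as (d & Hd & H). exists d. split; auto.
    intros u Hu. unfold diff_quot at 2. destruct (Ceq_dec w w) as [_|K]; [|now elim K].
    unfold diff_quot. destruct (Ceq_dec u w) as [->|Hu'].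
    + replace (l - l)%C with (RtoC 0) by ring. rewrite Cmod_0. lra.
    + specialize (H u Hu). assert (N := Csub_nz u w Hu').
      replace ((f u - f w) / (u - w) - l)%C with ((f u - f w - l * (u - w)) / (u - w))%C
        by (field; auto).
      rewrite Cmod_div by auto. apply Rmult_le_reg_r with (Cmod (u - w)).
      now apply Cmod_gt_0. unfold Rdiv. rewrite Rmult_assoc, Rinv_l. lra.
      apply Rgt_not_eq. now apply Cmod_gt_0.
  - destruct (diff_quot_cdiff f w l z Hf Hz Hn) as [m Hm]. eapply cdiff_ccont. exact Hm.
Qed.

(** Iterates 1 / (z - w) = 1 / z + (w / z) / (z - w) under the integral. The terms with the constant
    f(w) drop out because negative powers of z have mean zero on the circle. *)
Lemma taylor_remainder f w l r : holo f -> cdiff f w l -> Cmod w < r < 1 -> forall N,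
  circ_int (diff_quot f w l) r =
   (RtoC (2 * PI) * csum (fun k => w ^ k * taylor_coef f (S k)) N +
    circ_int (fun z => (w ^ N * / z ^ N) * diff_quot f w l z) r)%C.
Proof.
  intros Hf Hl Hr N. assert (Hw0 := Cmod_ge_0 w).
  assert (Hz : forall z, Cmod z = r -> z <> 0 /\ in_disk z /\ (z - w)%C <> 0).
  { intros z Hz. split; [apply nz_of_Cmod; lra|]. split. unfold in_disk; lra.
    apply Csub_nz. intros ->. lra. }
  assert (Hc : forall z, Cmod z = r -> ccont (diff_quot f w l) z).
  { intros z E. apply diff_quot_ccont; auto. now apply Hz. }
  assert (Hp : forall z n, Cmod z = r -> ccont (fun z => / z ^ n)%C z).
  { intros z n E. destruct (cdiff_inv_pow z n) as [m Hm]. now apply Hz. eapply cdiff_ccont; exact Hm. }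
  assert (Hpm : forall z n, Cmod z = r ->
     ccont (fun z => (w ^ n * / z ^ n) * diff_quot f w l z)%C z).
  { intros z n E. apply (ccont_mult (fun z => w ^ n * / z ^ n)%C (diff_quot f w l)); auto.
    apply (ccont_mult (fun _ => w ^ n)%C (fun z => / z ^ n)%C); auto. apply ccont_const. }
  assert (Hfp : forall z n, Cmod z = r -> ccont (fun z => f z * / z ^ n)%C z).
  { intros z n E. apply ccont_quot_pow; auto; now apply Hz. }
  induction N as [|N IH].
  - simpl. rewrite Cmult_0_r, Cplus_0_l. apply circ_int_ext. lra. intros z E.
    simpl. field.
  - rewrite IH. clear IH. simpl csum.
    rewrite (circ_int_ext (fun z => w ^ N * / z ^ N * diff_quot f w l z)%C
      (fun z => w ^ N * (f z * / z ^ S N) + (- (w ^ N * f w)) * / z ^ S N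
                + (w ^ S N * / z ^ S N) * diff_quot f w l z)%C).
    + rewrite circ_int_plus; [|lra| |auto].
      rewrite circ_int_plus; [|lra| |].
      rewrite circ_int_scal; [|lra|auto].
      rewrite circ_int_scal; [|lra|auto].
      rewrite taylor_coef_radius, circ_int_inv_pow by (auto; lra). ring.
      * intros z E. apply (ccont_mult (fun _ => w ^ N)%C (fun z => f z * / z ^ S N)%C); auto. apply ccont_const.
      * intros z E. apply (ccont_mult (fun _ => - (w ^ N * f w))%C (fun z => / z ^ S N)%C); auto. apply ccont_const.
      * intros z E. apply ccont_plus.
        -- apply (ccont_mult (fun _ => w ^ N)%C (fun z => f z * / z ^ S N)%C); auto. apply ccont_const.
        -- apply (ccont_mult (fun _ => - (w ^ N * f w))%C (fun z => / z ^ S N)%C); auto. apply ccont_const.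
    + lra.
    + intros z E. destruct (Hz z E) as (Z1 & Z2 & Z3). unfold diff_quot.
      destruct (Ceq_dec z w) as [->|_]. lra.
      rewrite !Cpow_S. assert (Zp := Cpow_nz z N Z1). field. auto.
Qed.

Lemma csum_ext u v n : (forall k, (k < n)%nat -> u k = v k) -> csum u n = csum v n.
Proof.
  induction n as [|n IH]; intros H; simpl; auto.
  rewrite IH, H; auto with arith.
Qed.

Lemma csum_scal c u n : csum (fun k => c * u k)%C n = (c * csum u n)%C.
Proof. induction n as [|n IH]; simpl. ring. rewrite IH. ring. Qed.

Lemma csum_shift u n : csum u (S n) = (u O + csum (fun k => u (S k)) n)%C.
Proof. induction n as [|n IH]. simpl; ring. simpl in *. rewrite IH. ring. Qed.

Lemma taylor_coef_0 f : holo f -> taylor_coef f 0 = f 0.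
Proof.
  intros Hf. assert (P := two_PI_pos).
  assert (P' : RtoC (2 * PI) <> 0). { apply nz_of_Cmod. rewrite Cmod_R, Rabs_pos_eq; lra. }
  unfold taylor_coef. rewrite (circ_int_ext _ f); [|lra|].
  - rewrite (mean_value_punctured f 0); try lra. field; auto.
    + intros z Hz. now apply holo_ccont.
    + intros z Hz _. now apply Hf.
  - intros z _. simpl. field.
Qed.

(** The bound comes from Riemann integrability of the real and imaginary parts in the angle; the
    rest parametrizes the circle by the arc cosine. *)
Lemma circle_bounded (f : C -> C) r : 0 <= r -> (forall z, Cmod z = r -> ccont f z) ->
  exists M, 0 <= M /\ forall z, Cmod z = r -> Cmod (f z) <= M.
Proof.
  intros Hr Hf. assert (P := two_PI_pos).
  assert (Hc : pcont_on (fun t => f (circ r t)) 0 (2 * PI)) by now apply circ_pcont_on.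
  destruct (ex_RInt_ub _ _ _ (pc_re _ _ _ (Rlt_le _ _ P) Hc)) as [M1 H1].
  destruct (ex_RInt_ub _ _ _ (pc_im _ _ _ (Rlt_le _ _ P) Hc)) as [M2 H2].
  exists (Rabs M1 + Rabs M2). split. { generalize (Rabs_pos M1) (Rabs_pos M2). lra. }
  intros z Hz.
  assert (Ht : exists t, 0 <= t <= 2 * PI /\ z = circ r t).
  { destruct z as [x y]. 
    assert (E : x * x + y * y = r * r).
    { rewrite <- Hz. unfold Cmod; simpl. rewrite sqrt_sqrt. ring. nra. }
    destruct (Rle_lt_or_eq_dec 0 r Hr) as [Hr'|<-].
    2:{ exists 0. split. lra. unfold circ. f_equal; nra. }
    assert (Hx : -1 <= x / r <= 1).
    { assert (- r <= x <= r) by nra. split.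
      - apply Rmult_le_reg_r with r; auto. unfold Rdiv. rewrite Rmult_assoc, Rinv_l; lra.
      - apply Rmult_le_reg_r with r; auto. unfold Rdiv. rewrite Rmult_assoc, Rinv_l; lra. }
    assert (B := acos_bound (x / r)).
    assert (Es : (r * sin (acos (x / r))) * (r * sin (acos (x / r))) = y * y).
    { rewrite sin_acos by auto.
      transitivity (r * r * (sqrt (1 - (x / r)²) * sqrt (1 - (x / r)²))). ring.
      rewrite sqrt_sqrt. unfold Rsqr. field_simplify; [nra|lra]. unfold Rsqr. nra. }
    assert (S0 : 0 <= r * sin (acos (x / r))).
    { apply Rmult_le_pos. lra. apply sin_ge_0; lra. }
    destruct (Rle_lt_dec 0 y) as [Hy|Hy].
    - exists (acos (x / r)). split. lra. unfold circ. rewrite cos_acos by auto.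
      f_equal. field; lra. nra.
    - exists (2 * PI - acos (x / r)). split. lra. unfold circ.
      replace (2 * PI - acos (x / r)) with (- acos (x / r) + 2 * 1 * PI) by ring.
      change 1 with (INR 1). rewrite cos_period, sin_period, cos_neg, sin_neg.
      rewrite cos_acos by auto. f_equal. field; lra. nra. }
  destruct Ht as (t & Ht & ->).
  eapply Rle_trans. apply Cmod_le_re_im.
  rewrite Rmin_left, Rmax_right in H1, H2 by lra.
  specialize (H1 t Ht). specialize (H2 t Ht).
  apply Rplus_le_compat; (eapply Rle_trans; [|apply Rle_abs]); assumption.
Qed.

(** The mean over |z| = r of the difference quotient at w is its value at 0, which is (f(w) - f(0))
    / w. Comparing with [taylor_remainder] expresses the Taylor remainder by an integral carrying (w
    / z)^N. The constant K does not depend on w, so the convergence is uniform on the circle. *)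
Theorem taylor_circle f rho r : holo f -> 0 <= rho < r -> r < 1 ->
  exists K, 0 <= K /\ forall w N, Cmod w = rho ->
    Cmod (f w - csum (fun k => taylor_coef f k * w ^ k)%C N) <= K * (rho / r) ^ N.
Proof.
  intros Hf H1 H2. assert (P := two_PI_pos).
  assert (P' : RtoC (2 * PI) <> 0). { apply nz_of_Cmod. rewrite Cmod_R, Rabs_pos_eq; lra. }
  assert (Hq : 0 <= rho / r) by (apply Rmult_le_pos; [lra|apply Rlt_le, Rinv_0_lt_compat; lra]).
  destruct (circle_bounded f rho) as (M1 & M10 & HM1). lra.
  { intros z Hz. apply holo_ccont; auto. unfold in_disk; lra. }
  destruct (circle_bounded f r) as (M2 & M20 & HM2). lra.
  { intros z Hz. apply holo_ccont; auto. unfold in_disk; lra. }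
  set (M := (M2 + M1) / (r - rho)).
  assert (HM : 0 <= M). { apply Rmult_le_pos. lra. apply Rlt_le, Rinv_0_lt_compat; lra. }
  (* [M] bounds the difference quotient on |z| = r. [M1] serves N = 0, and 2 r M comes from rho / (2
     pi) times the bound 4 pi M (rho / r)^N, with one factor rho / r split off. *)
  exists (M1 + 2 * r * M). split. { assert (0 <= r * M) by (apply Rmult_le_pos; lra). lra. }
  intros w N Hw.
  destruct N as [|N].
  { simpl. rewrite Rmult_1_r. replace (f w - 0)%C with (f w) by ring.
    specialize (HM1 w Hw). assert (0 <= r * M) by (apply Rmult_le_pos; lra). lra. }
  destruct (Hf w) as [l Hl]. { unfold in_disk; lra. }
  (* For w = 0 the value at 0 of the difference quotient is the derivative and says nothing about
     f(w); the partial sum is then exact. *)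
  destruct (Ceq_dec w 0) as [->|Hw0].
  { rewrite csum_shift, (csum_ext _ (fun _ => 0 * 0)%C), csum_scal.
    - rewrite taylor_coef_0 by auto. replace (_ - _)%C with (RtoC 0) by (simpl; ring). rewrite Cmod_0.
      apply Rmult_le_pos. assert (0 <= r * M) by (apply Rmult_le_pos; lra). lra. now apply pow_le.
    - intros k _. simpl. ring. }
  assert (E := mean_value_punctured (diff_quot f w l) w r ltac:(lra)
                ltac:(intros; now apply diff_quot_ccont) ltac:(intros; now apply diff_quot_cdiff)).
  rewrite (taylor_remainder f w l r Hf Hl ltac:(lra) N) in E.
  unfold diff_quot at 2 in E. destruct (Ceq_dec 0 w) as [K|_]. now elim Hw0.
  set (I := circ_int (fun z => w ^ N * / z ^ N * diff_quot f w l z)%C r) in *.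
  assert (EI : (f w - csum (fun k => taylor_coef f k * w ^ k) (S N))%C = (w * / RtoC (2 * PI) * I)%C).
  { rewrite csum_shift, taylor_coef_0 by auto.
    rewrite (csum_ext _ (fun k => w * (w ^ k * taylor_coef f (S k)))%C), csum_scal.
    2:{ intros k _. simpl. ring. }
    set (Sg := csum (fun k => w ^ k * taylor_coef f (S k))%C N) in *. simpl.
    replace I with ((RtoC (2 * PI) * Sg + I) - RtoC (2 * PI) * Sg)%C by ring. rewrite E.
    field. split; auto. }
  rewrite EI, !Cmod_mult, Cmod_inv, Cmod_R, Rabs_pos_eq, Hw by (auto; lra).
  assert (HI : Cmod I <= 4 * PI * ((rho / r) ^ N * M)).
  { apply circ_int_bound. lra.
    - intros z Hz. assert (Hzn : z <> 0) by (apply nz_of_Cmod; lra).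
      apply (ccont_mult (fun z => w ^ N * / z ^ N)%C (diff_quot f w l)).
      + apply (ccont_mult (fun _ => w ^ N)%C (fun z => / z ^ N)%C). apply ccont_const.
        destruct (cdiff_inv_pow z N Hzn) as [m Hm]. eapply cdiff_ccont; exact Hm.
      + apply diff_quot_ccont; auto. unfold in_disk; lra.
    - intros z Hz. assert (Hzn : z <> 0) by (apply nz_of_Cmod; lra).
      assert (Hzw : z <> w) by (intros ->; lra).
      rewrite !Cmod_mult, Cmod_inv, !Cmod_pow, Hz, Hw by (now apply Cpow_nz).
      apply Rmult_le_compat.
      + apply Rmult_le_pos. apply pow_le; lra. apply Rlt_le, Rinv_0_lt_compat, pow_lt; lra.
      + apply Cmod_ge_0.
      + right. unfold Rdiv. rewrite Rpow_mult_distr, pow_inv. reflexivity.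
      + unfold diff_quot. destruct (Ceq_dec z w) as [K|_]. now elim Hzw.
        rewrite Cmod_div by now apply Csub_nz. unfold M.
        apply Rmult_le_compat.
        * apply Cmod_ge_0.
        * apply Rlt_le, Rinv_0_lt_compat, Cmod_gt_0. now apply Csub_nz.
        * eapply Rle_trans. apply Cmod_triangle_sub. specialize (HM1 w Hw). specialize (HM2 z Hz). lra.
        * apply Rinv_le_contravar. lra. rewrite <- Hz, <- Hw. apply Cmod_triangle_rev. }
  simpl pow. assert (HqN : 0 <= (rho / r) ^ N) by now apply pow_le.
  apply Rle_trans with (rho * / (2 * PI) * (4 * PI * ((rho / r) ^ N * M))).
  - apply Rmult_le_compat_l; auto. apply Rmult_le_pos. lra. apply Rlt_le, Rinv_0_lt_compat; lra.
  - replace (rho * / (2 * PI) * (4 * PI * ((rho / r) ^ N * M)))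
      with (2 * r * M * (rho / r * (rho / r) ^ N)) by (field; lra).
    apply Rmult_le_compat_r. now apply Rmult_le_pos. lra.
Qed.

(** * Integral means and Taylor coefficients *)

Fixpoint rsum (u : nat -> R) (n : nat) : R :=
  match n with O => 0 | S n => rsum u n + u n end.

Definition circ_cont (f : C -> C) (r : R) := forall z, Cmod z = r -> ccont f z.

Lemma holo_circ_cont f r : holo f -> r < 1 -> circ_cont f r.
Proof. intros Hf Hr z Hz. apply holo_ccont; auto. unfold in_disk; lra. Qed.

Lemma ex_RInt_sq f r : 0 <= r -> circ_cont f r ->
  ex_RInt (fun t => Cmod (f (circ r t)) ^ 2) 0 (2 * PI).
Proof.
  intros Hr Hf. assert (P := two_PI_pos).
  assert (Hp := circ_pcont_on f r 0 (2 * PI) Hr Hf).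
  apply (ex_RInt_continuous (V:=R_CompleteNormedModule)).
  rewrite Rmin_left, Rmax_right by lra. intros t Ht.
  apply (continuous_ext (fun t => plus (mult (Re (f (circ r t))) (Re (f (circ r t))))
                                       (mult (Im (f (circ r t))) (Im (f (circ r t)))))).
  - intros s. rewrite Cmod2_alt. unfold plus, mult; simpl. ring.
  - apply (continuous_plus (V:=R_NormedModule)); apply (continuous_mult (K:=R_AbsRing)).
    all: first [now apply (pcont_re (fun t => f (circ r t))), Hp
               | now apply (pcont_im (fun t => f (circ r t))), Hp].
Qed.

Lemma int_mean2_circ f r :
  int_mean2 f r = / (2 * PI) * RInt (fun t => Cmod (f (circ r t)) ^ 2) 0 (2 * PI).
Proof. reflexivity. Qed.

Lemma int_mean2_nonneg f r : 0 <= r -> circ_cont f r -> 0 <= int_mean2 f r.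
Proof.
  intros Hr Hf. assert (P := two_PI_pos). rewrite int_mean2_circ.
  apply Rmult_le_pos. apply Rlt_le, Rinv_0_lt_compat; lra.
  apply RInt_ge_0. lra. now apply ex_RInt_sq. intros t _. apply pow2_ge_0.
Qed.

Lemma int_mean2_le f g h a b c r : 0 <= r ->
  circ_cont f r -> circ_cont g r -> circ_cont h r ->
  (forall z, Cmod z = r -> Cmod (f z) ^ 2 <= a * Cmod (g z) ^ 2 + b * Cmod (h z) ^ 2 + c) ->
  int_mean2 f r <= a * int_mean2 g r + b * int_mean2 h r + c.
Proof.
  intros Hr Hf Hg Hh H. assert (P := two_PI_pos). rewrite !int_mean2_circ.
  assert (Eg := ex_RInt_sq g r Hr Hg). assert (Eh := ex_RInt_sq h r Hr Hh).
  set (G := fun t => Cmod (g (circ r t)) ^ 2) in *. set (H' := fun t => Cmod (h (circ r t)) ^ 2) in *.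
  assert (I : is_RInt (fun t => plus (plus (scal a (G t)) (scal b (H' t))) c) 0 (2 * PI)
     (plus (plus (scal a (RInt G 0 (2 * PI))) (scal b (RInt H' 0 (2 * PI)))) (scal (2 * PI - 0) c))).
  { apply (is_RInt_plus (V:=R_NormedModule)); [apply (is_RInt_plus (V:=R_NormedModule))|].
    - apply (is_RInt_scal (V:=R_NormedModule)). now apply (RInt_correct (V:=R_CompleteNormedModule)).
    - apply (is_RInt_scal (V:=R_NormedModule)). now apply (RInt_correct (V:=R_CompleteNormedModule)).
    - apply (is_RInt_const (V:=R_NormedModule)). }
  apply Rle_trans with (/ (2 * PI) * RInt (fun t => plus (plus (scal a (G t)) (scal b (H' t))) c) 0 (2 * PI)).
  - apply Rmult_le_compat_l. apply Rlt_le, Rinv_0_lt_compat; lra.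
    apply RInt_le. lra. now apply ex_RInt_sq. eexists; exact I.
    intros t _. apply H. now apply Cmod_circ.
  - right. rewrite (is_RInt_unique _ _ _ _ I).
    unfold plus, scal; simpl. unfold mult; simpl. field. lra.
Qed.

(** Expands the square |g - c z^N|^2; on the circle the conjugate of z^N is r^(2N) / z^N, which
    turns the cross term into the integral of a Taylor coefficient. *)
Lemma int_mean2_sub_monomial g c N r : 0 < r -> circ_cont g r ->
  int_mean2 (fun z => g z - c * z ^ N)%C r =
  int_mean2 g r + Cmod c ^ 2 * r ^ (2 * N)
   - 2 * (/ (2 * PI) * Re (Cconj c * RtoC (r ^ (2 * N)) * circ_int (fun z => g z * / z ^ N)%C r)%C).
Proof.
  intros Hr Hg. assert (P := two_PI_pos).
  assert (Hgn : circ_cont (fun z => g z * / z ^ N)%C r).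
  { intros z Hz. apply (ccont_mult g (fun z => / z ^ N)%C); auto.
    destruct (cdiff_inv_pow z N) as [m Hm]. apply nz_of_Cmod; lra. eapply cdiff_ccont; exact Hm. }
  rewrite <- circ_int_scal by (auto; lra).
  set (h := fun z => (Cconj c * RtoC (r ^ (2 * N)) * (g z * / z ^ N))%C).
  assert (Hh : circ_cont h r).
  { intros z Hz. apply (ccont_mult (fun _ => Cconj c * RtoC (r ^ (2 * N)))%C (fun z => g z * / z ^ N)%C).
    apply ccont_const. now apply Hgn. }
  rewrite !int_mean2_circ. unfold circ_int, CI; cbn [Re fst].
  assert (Eg := ex_RInt_sq g r (Rlt_le _ _ Hr) Hg).
  assert (Eh := pc_re _ _ _ (Rlt_le _ _ P) (circ_pcont_on h r 0 (2 * PI) (Rlt_le _ _ Hr) Hh)).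
  set (G := fun t => Cmod (g (circ r t)) ^ 2) in *. set (H' := fun t => Re (h (circ r t))) in *.
  set (K := Cmod c ^ 2 * r ^ (2 * N)).
  assert (I : is_RInt (fun t => plus (plus (G t) (scal (- 2) (H' t))) K) 0 (2 * PI)
     (plus (plus (RInt G 0 (2 * PI)) (scal (- 2) (RInt H' 0 (2 * PI)))) (scal (2 * PI - 0) K))).
  { apply (is_RInt_plus (V:=R_NormedModule)); [apply (is_RInt_plus (V:=R_NormedModule))|].
    - now apply (RInt_correct (V:=R_CompleteNormedModule)).
    - apply (is_RInt_scal (V:=R_NormedModule)). now apply (RInt_correct (V:=R_CompleteNormedModule)).
    - apply (is_RInt_const (V:=R_NormedModule)). }
  rewrite (RInt_ext _ (fun t => plus (plus (G t) (scal (- 2) (H' t))) K)).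
  - rewrite (is_RInt_unique _ _ _ _ I).
    unfold plus, scal; simpl. unfold mult; simpl. field. lra.
  - intros t _. unfold G, H', h, K.
    assert (Hz := Cmod_circ r t (Rlt_le _ _ Hr)). set (z := circ r t) in *.
    assert (Hz0 : z <> 0) by (apply nz_of_Cmod; lra).
    assert (E : (Cconj c * RtoC (r ^ (2 * N)) * (g z * / z ^ N))%C = (g z * Cconj (c * z ^ N))%C).
    { rewrite pow_mult, <- Hz. rewrite RtoC_pow, Cmod2_conj, Cmult_conj, Cpow_conj, Cpow_mult_l.
      field. now apply Cpow_nz. }
    rewrite E. unfold plus, scal; simpl. unfold mult; simpl.
    replace (r ^ (N + (N + 0))) with (r ^ N * r ^ N) by (rewrite <- pow_add; f_equal; lia).
    rewrite <- Hz, <- Cmod_pow.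
    replace (Cmod c * (Cmod c * 1) * (Cmod (z ^ N) * Cmod (z ^ N))) with (Cmod (c * z ^ N) ^ 2)
      by (rewrite Cmod_mult; ring).
    set (u := g z). set (v := (c * z ^ N)%C).
    change (Cmod (u - v) ^ 2 = Cmod u ^ 2 + -2 * Re (u * Cconj v) + Cmod v ^ 2).
    rewrite !Cmod2_alt. destruct u as [u1 u2], v as [v1 v2]. simpl. ring.
Qed.

Lemma circ_int_psum_orth (a : nat -> C) r M N : 0 < r -> (M <= N)%nat ->
  circ_int (fun z => csum (fun k => a k * z ^ k) M * / z ^ N)%C r = 0.
Proof.
  intros Hr. assert (Hz : forall z, Cmod z = r -> z <> 0).
  { intros z Hz. apply nz_of_Cmod. lra. }
  assert (Hip : forall n, circ_cont (fun z => / z ^ n)%C r).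
  { intros n z E. destruct (cdiff_inv_pow z n (Hz z E)) as [m Hm]. eapply cdiff_ccont; exact Hm. }
  induction M as [|M IH]; intros HMN.
  - rewrite (circ_int_ext _ (fun z => 0 * / z ^ N)%C); try lra.
    + rewrite circ_int_scal by (auto; try lra; apply Hip). ring.
    + intros z _. reflexivity.
  - rewrite (circ_int_ext _ (fun z => csum (fun k => a k * z ^ k) M * / z ^ N
                 + a M * / z ^ S (N - S M))%C); try lra.
    + rewrite circ_int_plus; try lra.
      * rewrite IH by lia. rewrite circ_int_scal by (try lra; apply Hip).
        rewrite circ_int_inv_pow by auto. ring.
      * intros z E. apply (ccont_mult (fun z => csum (fun k => a k * z ^ k) M)%C (fun z => / z ^ N)%C).
        2: now apply Hip.
        clear - z. induction M as [|M IH]; simpl. apply ccont_const.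
        apply (ccont_plus (fun z => csum (fun k => a k * z ^ k) M)%C (fun z => a M * z ^ M)%C); auto.
        apply (ccont_mult (fun _ => a M)). apply ccont_const.
        destruct (cdiff_pow z M) as [m Hm]. eapply cdiff_ccont; exact Hm.
      * intros z E. apply (ccont_mult (fun _ => a M) (fun z => / z ^ S (N - S M))%C).
        apply ccont_const. now apply Hip.
    + intros z E. simpl csum. set (j := (N - S M)%nat).
      assert (EN : N = (M + S j)%nat) by (unfold j; lia). clearbody j. subst N.
      rewrite Cpow_add_r. assert (Q1 := Cpow_nz z M (Hz z E)).
      assert (Q2 := Cpow_nz z (S j) (Hz z E)). field. auto.
Qed.

Lemma holo_pow n : holo (fun z => z ^ n)%C.
Proof. intros z _. apply cdiff_pow. Qed.

Lemma holo_csum a n : holo (fun z => csum (fun k => a k * z ^ k) n)%C.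
Proof.
  induction n as [|n IH]; simpl. apply holo_const.
  apply holo_plus; auto. apply (holo_mult (fun _ => a n)). apply holo_const. apply holo_pow.
Qed.

(** Finite Parseval identity on the circle of radius r. Orthogonality leaves the N-th coefficient of
    the remainder equal to that of f, so each further monomial removes exactly its own square. *)
Lemma int_mean2_taylor f r N : holo f -> 0 < r < 1 ->
  int_mean2 (fun z => f z - csum (fun k => taylor_coef f k * z ^ k) N)%C r =
  int_mean2 f r - rsum (fun k => Cmod (taylor_coef f k) ^ 2 * r ^ (2 * k)) N.
Proof.
  intros Hf Hr. assert (P := two_PI_pos).
  assert (Hext : forall g h, (forall z, g z = h z) -> int_mean2 g r = int_mean2 h r).
  { intros g h E. rewrite !int_mean2_circ. f_equal. apply RInt_ext. intros t _. now rewrite E. }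
  induction N as [|N IH].
  - simpl. rewrite Rminus_0_r. apply Hext. intros z. ring.
  - cbn [csum rsum].
    rewrite (Hext _ (fun z => (f z - csum (fun k => taylor_coef f k * z ^ k) N) - taylor_coef f N * z ^ N)%C).
    2: intros z; ring.
    rewrite int_mean2_sub_monomial; try lra.
    2:{ apply holo_circ_cont; try lra. apply holo_minus; auto. apply holo_csum. }
    rewrite IH.
    rewrite (circ_int_ext _ (fun z => f z * / z ^ N + (-(1)) * (csum (fun k => taylor_coef f k * z ^ k) N * / z ^ N))%C);
      [|lra|intros z _; ring].
    assert (Hc : forall g, holo g -> circ_cont (fun z => g z * / z ^ N)%C r).
    { intros g Hg z E. apply ccont_quot_pow; auto. unfold in_disk; lra. apply nz_of_Cmod; lra. }
    rewrite circ_int_plus; try lra.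
    + rewrite circ_int_scal; try lra. 2: now apply Hc, holo_csum.
      rewrite circ_int_psum_orth, taylor_coef_radius by (auto; lra).
      set (R := r ^ (2 * N)). destruct (taylor_coef f N) as [x y].
      rewrite Cmod2_alt. simpl Cpow. unfold Cmult, Cconj, RtoC, Cplus, Copp, Re, Im; cbn [fst snd].
      field. lra.
    + apply Hc; auto.
    + intros z E. apply (ccont_mult (fun _ => -(1))%C (fun z => csum (fun k => taylor_coef f k * z ^ k) N * / z ^ N)%C).
      apply ccont_const. now apply Hc; [apply holo_csum|].
Qed.

(** A bound on the squared norm, phrased without the supremum. *)
Definition means_le (f : C -> C) (B : R) : Prop :=
  forall r, 0 <= r < 1 -> int_mean2 f r <= B.

Lemma int_mean2_zero f : int_mean2 f 0 = Cmod (f 0) ^ 2.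
Proof.
  rewrite int_mean2_circ. assert (P := two_PI_pos).
  rewrite (RInt_ext _ (fun _ => Cmod (f 0) ^ 2)).
  - rewrite RInt_const. unfold scal; simpl. unfold mult; simpl. field. lra.
  - intros t _. replace (circ 0 t) with (RtoC 0); auto. unfold circ, RtoC. f_equal; ring.
Qed.

(** The defect is (t x - y)^2 / t. The free parameter keeps the constant of the first term close to
    1, which the openness argument in [recurrent_elim] requires; elsewhere t = 1. *)
Lemma sq_add_le x y t : 0 < t -> (x + y) ^ 2 <= (1 + t) * x ^ 2 + (1 + / t) * y ^ 2.
Proof.
  intros Ht.
  assert (H : 0 <= / t * (t * x - y) ^ 2).
  { apply Rmult_le_pos. now apply Rlt_le, Rinv_0_lt_compat. apply pow2_ge_0. }
  replace (/ t * (t * x - y) ^ 2) with (t * x ^ 2 + / t * y ^ 2 - 2 * x * y) in H by (field; lra).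
  nra.
Qed.

Lemma Cmod_sq_add_le (x y : C) t : 0 < t ->
  Cmod (x + y) ^ 2 <= (1 + t) * Cmod x ^ 2 + (1 + / t) * Cmod y ^ 2.
Proof.
  intros Ht. eapply Rle_trans; [|now apply sq_add_le].
  apply pow_incr. split. apply Cmod_ge_0. apply Cmod_triangle.
Qed.

Lemma int_mean2_add f g r t : 0 < t -> 0 <= r -> circ_cont f r -> circ_cont g r ->
  int_mean2 (fun z => f z + g z)%C r <= (1 + t) * int_mean2 f r + (1 + / t) * int_mean2 g r.
Proof.
  intros Ht Hr Hf Hg.
  replace ((1 + t) * int_mean2 f r + (1 + / t) * int_mean2 g r)
    with ((1 + t) * int_mean2 f r + (1 + / t) * int_mean2 g r + 0) by ring.
  apply int_mean2_le; auto. { intros z Hz. apply ccont_plus; auto. }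
  intros z _. rewrite Rplus_0_r. now apply Cmod_sq_add_le.
Qed.

Lemma means_le_add f g A B : holo f -> holo g -> means_le f A -> means_le g B ->
  means_le (fun z => f z + g z)%C (2 * A + 2 * B).
Proof.
  intros Hf Hg HA HB r Hr.
  eapply Rle_trans. apply (int_mean2_add f g r 1); try lra; now apply holo_circ_cont.
  rewrite Rinv_1. specialize (HA r Hr). specialize (HB r Hr). lra.
Qed.

Lemma int_mean2_ext f g r : 0 <= r < 1 -> (forall z, in_disk z -> f z = g z) ->
  int_mean2 f r = int_mean2 g r.
Proof.
  intros Hr E. rewrite !int_mean2_circ. f_equal. apply RInt_ext. intros t _.
  rewrite E; auto. unfold in_disk. rewrite Cmod_circ; lra.
Qed.

Lemma means_le_ext f g B : (forall z, in_disk z -> f z = g z) -> means_le f B -> means_le g B.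
Proof. intros E H r Hr. rewrite <- (int_mean2_ext f g); auto. Qed.

Lemma means_le_sup f K : holo f -> 0 <= K -> (forall z, in_disk z -> Cmod (f z) <= K) ->
  means_le f (K ^ 2).
Proof.
  intros Hf HK H r Hr.
  replace (K ^ 2) with (0 * int_mean2 f r + 0 * int_mean2 f r + K ^ 2) by ring.
  apply int_mean2_le; try lra; try (apply holo_circ_cont; auto; lra).
  intros z Hz. rewrite !Rmult_0_l, !Rplus_0_l. apply pow_incr. split. apply Cmod_ge_0.
  apply H. unfold in_disk; lra.
Qed.

(** The radius 0, at which the formulas with [/ z ^ k] make no sense, is recovered from small
    positive radii by continuity of f at 0. *)
Lemma means_le_pos f B : holo f -> (forall r, 0 < r < 1 -> int_mean2 f r <= B) -> means_le f B.
Proof.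
  intros Hf H r Hr. destruct (Req_dec r 0) as [->|Hn]; [|apply H; lra].
  rewrite int_mean2_zero. apply le_epsilon. intros e He.
  set (m := Cmod (f 0)). assert (Hm : 0 <= m) by apply Cmod_ge_0.
  destruct (holo_ccont f 0 Hf) with (eps := e / (2 * m + 1)) as (d & Hd & Hc).
  { unfold in_disk. rewrite Cmod_0; lra. } { apply Rdiv_lt_0_compat; lra. }
  set (s := Rmin d 1 / 2). assert (0 < Rmin d 1) by (apply Rmin_pos; lra).
  assert (S1 := Rmin_l d 1). assert (S2 := Rmin_r d 1).
  assert (Hs : 0 < s < 1) by (unfold s; lra).
  specialize (H s Hs).
  assert (Q : int_mean2 (fun _ => f 0) s <= 1 * int_mean2 f s + 0 * int_mean2 f s + e).
  { apply int_mean2_le; try lra; try (apply holo_circ_cont; auto; lra).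
    intros z _; apply ccont_const.
    intros z Hz. specialize (Hc z).
    replace (z - 0)%C with z in Hc by ring. specialize (Hc ltac:(unfold s in *; lra)).
    assert (T := Cmod_triangle_rev (f 0) (f z)). rewrite Cmod_sub_sym in T. fold m in T. fold m.
    assert (Z0 := Cmod_ge_0 (f z)). set (u := Cmod (f z)) in *.
    set (q := e / (2 * m + 1)) in *.
    assert (Hq : 0 < q) by (apply Rdiv_lt_0_compat; lra).
    assert (Eq : q * (2 * m + 1) = e) by (unfold q; field; lra).
    destruct (Rle_lt_dec m u). nra. nra. }
  assert (E : int_mean2 (fun _ => f 0) s = m ^ 2).
  { rewrite int_mean2_circ. assert (P := two_PI_pos). rewrite RInt_const.
    unfold scal; simpl. unfold mult; simpl. fold m. field. lra. }
  rewrite E in Q. lra.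
Qed.

Lemma pow_small q eps : 0 <= q < 1 -> 0 < eps ->
  exists N, forall n, (N <= n)%nat -> q ^ n < eps.
Proof.
  intros Hq He. destruct (pow_lt_1_zero q) with (y := eps) as [N HN]; auto.
  rewrite Rabs_pos_eq; lra.
  exists N. intros n Hn. specialize (HN n Hn). rewrite Rabs_pos_eq in HN; auto. apply pow_le; lra.
Qed.

(** Bessel's inequality at radius r, then r -> 1: for fixed N all weights r^(2k) are at least
    r^(2N), and Bernoulli's inequality makes the limit explicit. *)
Lemma taylor_bessel f B N : holo f -> means_le f B -> rsum (fun k => Cmod (taylor_coef f k) ^ 2) N <= B.
Proof.
  intros Hf HB.
  assert (H : forall r, 0 < r < 1 -> rsum (fun k => Cmod (taylor_coef f k) ^ 2 * r ^ (2 * k)) N <= B).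
  { intros r Hr. assert (E := int_mean2_taylor f r N Hf Hr).
    assert (0 <= int_mean2 (fun z => f z - csum (fun k => taylor_coef f k * z ^ k) N)%C r).
    { apply int_mean2_nonneg. lra. apply holo_circ_cont; try lra. apply holo_minus; auto. apply holo_csum. }
    specialize (HB r). lra. }
  assert (Hb : 0 <= B).
  { specialize (H (1 / 2) ltac:(lra)). eapply Rle_trans; [|exact H].
    clear. induction N as [|N IH]; cbn [rsum]. lra.
    assert (0 <= Cmod (taylor_coef f N) ^ 2 * (1 / 2) ^ (2 * N)).
    { apply Rmult_le_pos. apply pow2_ge_0. apply pow_le; lra. } lra. }
  assert (H2 : forall r, 0 < r < 1 -> r ^ (2 * N) * rsum (fun k => Cmod (taylor_coef f k) ^ 2) N <= B).
  { intros r Hr. eapply Rle_trans; [|apply (H r Hr)]. clear - Hr.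
    assert (G : forall M, (M <= N)%nat -> r ^ (2 * N) * rsum (fun k => Cmod (taylor_coef f k) ^ 2) M <=
       rsum (fun k => Cmod (taylor_coef f k) ^ 2 * r ^ (2 * k)) M).
    { induction M as [|M IH]; intros HM; cbn [rsum]. lra.
      specialize (IH ltac:(lia)). rewrite Rmult_plus_distr_l. apply Rplus_le_compat; auto.
      rewrite Rmult_comm. apply Rmult_le_compat_l. apply pow2_ge_0.
      replace (2 * N)%nat with (2 * M + 2 * (N - M))%nat by lia. rewrite pow_add.
      apply Rle_trans with (r ^ (2 * M) * 1); [|lra]. apply Rmult_le_compat_l. apply pow_le; lra.
      rewrite <- (pow1 (2 * (N - M))). apply pow_incr. lra. }
    now apply G. }
  set (Sg := rsum (fun k => Cmod (taylor_coef f k) ^ 2) N) in *.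
  apply Rnot_lt_le. intros Hlt.
  assert (Bern : forall n x, 0 <= x <= 1 -> 1 - INR n * x <= (1 - x) ^ n).
  { intros n x Hx. induction n as [|n IH]. simpl; lra. rewrite S_INR. simpl pow.
    assert (0 <= (1 - x) ^ n) by (apply pow_le; lra).
    assert (0 <= INR n) by apply pos_INR. nra. }
  set (n := (2 * N)%nat) in *. assert (Pn : 0 <= INR n) by apply pos_INR.
  (* With r = 1 - x the loss [Sg * INR n * x] is less than half of [Sg - B], so the weighted sum
     still exceeds B. *)
  set (x := (Sg - B) / (2 * Sg * (INR n + 1))).
  assert (Hx : 0 < x < 1).
  { assert (Sn : 0 <= Sg * INR n) by (apply Rmult_le_pos; lra).
    unfold x. split. apply Rdiv_lt_0_compat. lra. nra.
    apply Rmult_lt_reg_r with (2 * Sg * (INR n + 1)). nra.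
    unfold Rdiv. rewrite Rmult_assoc, Rinv_l by nra. nra. }
  specialize (H2 (1 - x) ltac:(lra)). specialize (Bern n x ltac:(lra)).
  assert (Q : x * (2 * Sg * (INR n + 1)) = Sg - B). { unfold x. field. split; nra. }
  assert (Sg * (1 - INR n * x) <= B). { eapply Rle_trans; [|exact H2]. rewrite Rmult_comm. apply Rmult_le_compat_r; lra. }
  nra.
Qed.

Lemma rsum_nonneg u n : (forall k, 0 <= u k) -> 0 <= rsum u n.
Proof. intros H. induction n as [|n IH]; simpl. lra. specialize (H n). lra. Qed.

Lemma rsum_le u v n : (forall k, (k < n)%nat -> u k <= v k) -> rsum u n <= rsum v n.
Proof.
  induction n as [|n IH]; intros H; simpl. lra.
  specialize (IH ltac:(intros; apply H; lia)). specialize (H n ltac:(lia)). lra.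
Qed.

Lemma rsum_scal c u n : rsum (fun k => c * u k) n = c * rsum u n.
Proof. induction n as [|n IH]; simpl. ring. rewrite IH. ring. Qed.

Lemma rsum_shift u n : rsum u (S n) = u O + rsum (fun k => u (S k)) n.
Proof. induction n as [|n IH]. simpl; ring. simpl in *. rewrite IH. ring. Qed.

Lemma rsum_cauchy u B : (forall k, 0 <= u k) -> (forall n, rsum u n <= B) ->
  forall eps, 0 < eps -> exists N, forall n, rsum u n - rsum u N <= eps.
Proof.
  intros Hu HB eps He.
  destruct (completeness (fun x => exists n, x = rsum u n)) as [s [Hs1 Hs2]].
  - exists B. intros x [n ->]. auto.
  - exists 0. now exists O.
  - destruct (Classical_Prop.classic (exists N, s - eps < rsum u N)) as [[N HN]|Hn].
    + exists N. intros n. assert (rsum u n <= s) by (apply Hs1; now exists n). lra.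
    + exfalso. assert (s <= s - eps); [|lra]. apply Hs2. intros x [n ->].
      apply Rnot_lt_le. intros K. apply Hn. now exists n.
Qed.

(** N is chosen from the tail of the square-summable coefficients, before r. At each radius a
    further index n, depending on r, makes the remainder uniformly small on the circle; by Parseval,
    passing from n back to N costs no more than the tail. *)
Lemma taylor_dense f B eps : holo f -> means_le f B -> 0 < eps ->
  exists N, means_le (fun z => f z - csum (fun k => taylor_coef f k * z ^ k) N)%C eps.
Proof.
  intros Hf HB He.
  set (u := fun k => Cmod (taylor_coef f k) ^ 2).
  assert (Hu : forall k, 0 <= u k) by (intros k; apply pow2_ge_0).
  destruct (rsum_cauchy u B Hu) with (eps := eps / 2) as [N HN]; try lra.
  { intros n. exact (taylor_bessel f B n Hf HB). }
  exists N. apply means_le_pos. { apply holo_minus; auto. apply holo_csum. }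
  intros r Hr. rewrite int_mean2_taylor by auto.
  destruct (taylor_circle f r ((1 + r) / 2)) as (K & HK0 & HK); try lra; auto.
  assert (Hq : 0 <= r / ((1 + r) / 2) < 1).
  { split. apply Rmult_le_pos. lra. apply Rlt_le, Rinv_0_lt_compat; lra.
    apply Rmult_lt_reg_r with ((1 + r) / 2). lra. unfold Rdiv at 1. rewrite Rmult_assoc, Rinv_l; lra. }
  set (q := r / ((1 + r) / 2)) in *.
  set (e := Rmin 1 (eps / 2)). assert (He0 : 0 < e) by (apply Rmin_pos; lra).
  assert (He1 := Rmin_l 1 (eps / 2)). assert (He2 := Rmin_r 1 (eps / 2)). fold e in He1, He2.
  destruct (pow_small q (e / (K + 1)) Hq) as [m Hm]. { apply Rdiv_lt_0_compat; lra. }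
  set (n := Nat.max N m).
  assert (Hsmall : int_mean2 (fun z => f z - csum (fun k => taylor_coef f k * z ^ k) n)%C r <= eps / 2).
  { assert (Hc : circ_cont (fun z => f z - csum (fun k => taylor_coef f k * z ^ k) n)%C r).
    { apply holo_circ_cont; try lra. apply holo_minus; auto. apply holo_csum. }
    apply Rle_trans with (0 * int_mean2 f r + 0 * int_mean2 f r + e ^ 2).
    - apply int_mean2_le; auto; try lra; try (apply holo_circ_cont; auto; lra).
      intros z Hz. rewrite !Rmult_0_l, !Rplus_0_l. apply pow_incr. split. apply Cmod_ge_0.
      eapply Rle_trans. apply HK; auto.
      specialize (Hm n ltac:(unfold n; lia)).
      assert (P : 0 <= q ^ n) by (apply pow_le; lra).
      apply Rle_trans with ((K + 1) * (e / (K + 1))); [|right; field; lra].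
      apply Rmult_le_compat; lra.
    - nra. }
  rewrite int_mean2_taylor in Hsmall by auto.
  assert (Hd : forall n', (N <= n')%nat ->
     rsum (fun k => Cmod (taylor_coef f k) ^ 2 * r ^ (2 * k)) n' - rsum (fun k => Cmod (taylor_coef f k) ^ 2 * r ^ (2 * k)) N
      <= rsum u n' - rsum u N).
  { intros n' Hn'. induction Hn' as [|n' _ IH]. lra. cbn [rsum].
    assert (Cmod (taylor_coef f n') ^ 2 * r ^ (2 * n') <= u n').
    { rewrite <- (Rmult_1_r (u n')). apply Rmult_le_compat_l. apply Hu.
      rewrite <- (pow1 (2 * n')). apply pow_incr. lra. } lra. }
  specialize (Hd n ltac:(unfold n; lia)). specialize (HN n). lra.
Qed.

(** * Point evaluations controlled by the means *)

Lemma csum_cauchy_schwarz a b n :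
  Cmod (csum (fun k => a k * b k)%C n) ^ 2
   <= rsum (fun k => Cmod (a k) ^ 2) n * rsum (fun k => Cmod (b k) ^ 2) n.
Proof.
  induction n as [|n IH]; cbn [csum rsum].
  - rewrite Cmod_0. lra.
  - set (A := rsum (fun k => Cmod (a k) ^ 2) n) in *. set (B := rsum (fun k => Cmod (b k) ^ 2) n) in *.
    assert (HA : 0 <= A) by (apply rsum_nonneg; intros; apply pow2_ge_0).
    assert (HB : 0 <= B) by (apply rsum_nonneg; intros; apply pow2_ge_0).
    set (X := csum (fun k => a k * b k)%C n) in *.
    assert (HT : Cmod (X + a n * b n) <= Cmod X + Cmod (a n) * Cmod (b n)).
    { rewrite <- Cmod_mult. apply Cmod_triangle. }
    assert (s0 := Cmod_ge_0 X). assert (x0 := Cmod_ge_0 (a n)). assert (y0 := Cmod_ge_0 (b n)).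
    set (s := Cmod X) in *. set (x := Cmod (a n)) in *. set (y := Cmod (b n)) in *.
    apply Rle_trans with ((s + x * y) ^ 2). { apply pow_incr. split; auto. apply Cmod_ge_0. }
    assert (H2 : 2 * (s * (x * y)) <= A * y ^ 2 + B * x ^ 2).
    { apply Rsqr_incr_0.
      - unfold Rsqr. set (p := A * y ^ 2). set (q := B * x ^ 2).
        apply Rle_trans with (4 * p * q). 
        + unfold p, q. replace (4 * (A * y ^ 2) * (B * x ^ 2)) with (4 * (x * y) ^ 2 * (A * B)) by ring.
          replace (2 * (s * (x * y)) * (2 * (s * (x * y)))) with (4 * (x * y) ^ 2 * s ^ 2) by ring.
          apply Rmult_le_compat_l; auto. generalize (pow2_ge_0 (x * y)); lra.
        + generalize (pow2_ge_0 (p - q)); nra.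
      - assert (0 <= x * y) by nra. nra.
      - generalize (pow2_ge_0 x) (pow2_ge_0 y); nra. }
    nra.
Qed.

Lemma csum_minus u v n : csum (fun k => u k - v k)%C n = (csum u n - csum v n)%C.
Proof. induction n as [|n IH]; simpl. ring. rewrite IH. ring. Qed.

Lemma taylor_conv f w : holo f -> in_disk w -> forall eps, 0 < eps ->
  exists N, forall n, (N <= n)%nat -> Cmod (f w - csum (fun k => taylor_coef f k * w ^ k)%C n) <= eps.
Proof.
  intros Hf Hw eps He. unfold in_disk in Hw. assert (Hw0 := Cmod_ge_0 w). set (r := Cmod w) in *.
  destruct (taylor_circle f r ((1 + r) / 2)) as (K & HK0 & HK); try lra; auto.
  assert (Hq : 0 <= r / ((1 + r) / 2) < 1).
  { split. apply Rmult_le_pos. lra. apply Rlt_le, Rinv_0_lt_compat; lra.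
    apply Rmult_lt_reg_r with ((1 + r) / 2). lra. unfold Rdiv at 1. rewrite Rmult_assoc, Rinv_l; lra. }
  set (q := r / ((1 + r) / 2)) in *.
  destruct (pow_small q (eps / (K + 1)) Hq) as [m Hm]. { apply Rdiv_lt_0_compat; lra. }
  exists m. intros n Hn. eapply Rle_trans. apply HK; auto.
  specialize (Hm n Hn). assert (P : 0 <= q ^ n) by (apply pow_le; lra).
  apply Rle_trans with ((K + 1) * (eps / (K + 1))); [|right; field; lra].
  apply Rmult_le_compat; lra.
Qed.

Lemma sq_le_limit (x : C) Q : (forall eps, 0 < eps -> exists y, Cmod (x - y) <= eps /\ Cmod y ^ 2 <= Q) ->
  Cmod x ^ 2 <= Q.
Proof.
  intros H. destruct (H 1 Rlt_0_1) as (y0 & _ & Hy0). assert (Q0 := pow2_ge_0 (Cmod y0)).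
  assert (HQ : 0 <= Q) by lra.
  rewrite <- (sqrt_sqrt Q) by auto.
  assert (Hx : Cmod x <= sqrt Q).
  { apply le_epsilon. intros e He. destruct (H e He) as (y & H1 & H2).
    assert (T := Cmod_triangle_rev x y).
    assert (Cmod y <= sqrt Q).
    { rewrite <- (sqrt_pow2 (Cmod y)) by apply Cmod_ge_0. now apply sqrt_le_1_alt. }
    lra. }
  assert (C0 := Cmod_ge_0 x). nra.
Qed.

(** The reproducing-kernel bound: Cauchy-Schwarz on the Taylor series, with the geometric series of
    |w|^2. *)
Lemma eval_le f B w : holo f -> means_le f B -> in_disk w -> Cmod (f w) ^ 2 <= B / (1 - Cmod w ^ 2).
Proof.
  intros Hf HB Hw. apply sq_le_limit. intros eps He.
  destruct (taylor_conv f w Hf Hw eps He) as [N HN].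
  exists (csum (fun k => taylor_coef f k * w ^ k)%C N). split. now apply HN.
  eapply Rle_trans. apply csum_cauchy_schwarz.
  unfold in_disk in Hw. assert (Hw0 := Cmod_ge_0 w).
  assert (Hx : 0 <= Cmod w ^ 2 < 1) by nra.
  assert (Hg : forall n, (1 - Cmod w ^ 2) * rsum (fun k => Cmod (w ^ k) ^ 2) n = 1 - (Cmod w ^ 2) ^ n).
  { induction n as [|n IH]; cbn [rsum]. simpl; ring. rewrite Rmult_plus_distr_l, IH, Cmod_pow.
    replace ((Cmod w ^ n) ^ 2) with ((Cmod w ^ 2) ^ n) by (rewrite <- !pow_mult; f_equal; lia).
    set (x := Cmod w ^ 2). clearbody x. simpl. ring. }
  assert (Hp : 0 <= (Cmod w ^ 2) ^ N) by (apply pow_le; lra).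
  unfold Rdiv. apply Rmult_le_compat.
  - apply rsum_nonneg. intros; apply pow2_ge_0.
  - apply rsum_nonneg. intros; apply pow2_ge_0.
  - exact (taylor_bessel f B _ Hf HB).
  - apply Rmult_le_reg_l with (1 - Cmod w ^ 2). lra. rewrite Hg, Rinv_r by lra. lra.
Qed.

(** These are the terms of the second derivative of the geometric series. Carrying the remainder in
    closed form makes the induction purely algebraic. *)
Lemma rsum_second_deriv x n :
  0 <= x < 1 -> rsum (fun k => (INR k + 1) * (INR k + 2) * x ^ k) n <= 2 / (1 - x) ^ 3.
Proof.
  intros Hx.
  assert (E : (1 - x) ^ 3 * rsum (fun k => (INR k + 1) * (INR k + 2) * x ^ k) n =
     2 - x ^ n * (2 + 2 * INR n * (1 - x) + INR n * (INR n + 1) * (1 - x) ^ 2)).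
  { induction n as [|n IH]; cbn [rsum]. simpl. ring.
    rewrite Rmult_plus_distr_l, IH, S_INR. simpl pow. ring. }
  assert (P3 : 0 < (1 - x) ^ 3) by (apply pow_lt; lra).
  apply Rmult_le_reg_l with ((1 - x) ^ 3); auto. rewrite E.
  replace ((1 - x) ^ 3 * (2 / (1 - x) ^ 3)) with 2 by (field; lra).
  assert (0 <= x ^ n) by (apply pow_le; lra). assert (0 <= INR n) by apply pos_INR.
  assert (0 <= (2 + 2 * INR n * (1 - x) + INR n * (INR n + 1) * (1 - x) ^ 2)).
  { assert (0 <= INR n * (1 - x)) by nra. assert (0 <= (1 - x) ^ 2) by apply pow2_ge_0.
    assert (0 <= INR n * (INR n + 1)) by nra. nra. }
  nra.
Qed.

Lemma Cpow_diff_le (w v : C) rho n : Cmod w <= rho -> Cmod v <= rho ->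
  Cmod (w ^ S n - v ^ S n) <= (INR n + 1) * rho ^ n * Cmod (w - v).
Proof.
  intros Hw Hv. assert (Hr : 0 <= rho) by (generalize (Cmod_ge_0 w); lra).
  induction n as [|n IH].
  - simpl. replace (w * 1 - v * 1)%C with (w - v)%C by ring. lra.
  - replace (w ^ S (S n) - v ^ S (S n))%C with (w * (w ^ S n - v ^ S n) + (w - v) * v ^ S n)%C
      by (simpl; ring).
    eapply Rle_trans. apply Cmod_triangle. rewrite !Cmod_mult, Cmod_pow, S_INR.
    assert (Hp : Cmod v ^ S n <= rho ^ S n) by (apply pow_incr; split; auto; apply Cmod_ge_0).
    assert (H0 := Cmod_ge_0 (w - v)).
    apply Rle_trans with (rho * ((INR n + 1) * rho ^ n * Cmod (w - v)) + Cmod (w - v) * rho ^ S n).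
    + apply Rplus_le_compat. apply Rmult_le_compat; auto using Cmod_ge_0.
      now apply Rmult_le_compat_l.
    + simpl. right. ring.
Qed.

(** Cauchy-Schwarz with |w^(k+1) - v^(k+1)| <= (k + 1) rho^k |w - v|; the square (k + 1)^2 is
    enlarged to (k + 1)(k + 2) so that the sum is known. The exponent 3 is what makes the parabolic
    comparison decay. *)
Lemma eval_diff_le f B w v rho : holo f -> means_le f B -> Cmod w <= rho -> Cmod v <= rho -> rho < 1 ->
  Cmod (f w - f v) ^ 2 <= B * (Cmod (w - v) ^ 2 * (2 / (1 - rho ^ 2) ^ 3)).
Proof.
  intros Hf HB Hw Hv Hr. assert (Hr0 : 0 <= rho) by (generalize (Cmod_ge_0 w); lra).
  apply sq_le_limit. intros eps He.
  destruct (taylor_conv f w Hf ltac:(unfold in_disk; lra) (eps / 2) ltac:(lra)) as [N1 HN1].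
  destruct (taylor_conv f v Hf ltac:(unfold in_disk; lra) (eps / 2) ltac:(lra)) as [N2 HN2].
  set (N := S (Nat.max N1 N2)).
  exists (csum (fun k => taylor_coef f k * (w ^ k - v ^ k))%C N). split.
  - rewrite (csum_ext _ (fun k => taylor_coef f k * w ^ k - taylor_coef f k * v ^ k)%C), csum_minus.
    2: intros; ring.
    match goal with |- Cmod ?x <= _ => replace x with
     ((f w - csum (fun k => taylor_coef f k * w ^ k) N) - (f v - csum (fun k => taylor_coef f k * v ^ k) N))%C by ring end.
    eapply Rle_trans. apply Cmod_triangle_sub.
    specialize (HN1 N ltac:(unfold N; lia)). specialize (HN2 N ltac:(unfold N; lia)). lra.
  - eapply Rle_trans. apply csum_cauchy_schwarz. apply Rmult_le_compat.
    + apply rsum_nonneg. intros; apply pow2_ge_0.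
    + apply rsum_nonneg. intros; apply pow2_ge_0.
    + exact (taylor_bessel f B _ Hf HB).
    + unfold N. rewrite rsum_shift.
      replace (w ^ 0 - v ^ 0)%C with (RtoC 0) by (simpl; ring). rewrite Cmod_0.
      eapply Rle_trans.
      { apply Rplus_le_compat_l. apply rsum_le with
         (v := fun k => Cmod (w - v) ^ 2 * ((INR k + 1) * (INR k + 2) * (rho ^ 2) ^ k)).
        intros k _. apply Rle_trans with (((INR k + 1) * rho ^ k * Cmod (w - v)) ^ 2).
        - apply pow_incr. split. apply Cmod_ge_0. now apply Cpow_diff_le.
        - rewrite <- pow_mult, Nat.mul_comm, pow_mult.
          assert (0 <= INR k) by apply pos_INR.
          assert (0 <= (rho ^ k) ^ 2 * Cmod (w - v) ^ 2) by (apply Rmult_le_pos; apply pow2_ge_0).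
          replace (((INR k + 1) * rho ^ k * Cmod (w - v)) ^ 2)
            with ((INR k + 1) ^ 2 * ((rho ^ k) ^ 2 * Cmod (w - v) ^ 2)) by ring.
          replace (Cmod (w - v) ^ 2 * ((INR k + 1) * (INR k + 2) * (rho ^ k) ^ 2))
            with ((INR k + 1) * (INR k + 2) * ((rho ^ k) ^ 2 * Cmod (w - v) ^ 2)) by ring.
          apply Rmult_le_compat_r; auto. nra. }
      rewrite rsum_scal. replace (0 ^ 2) with 0 by ring. rewrite Rplus_0_l.
      apply Rmult_le_compat_l. apply pow2_ge_0. apply rsum_second_deriv. nra.
Qed.

(** On |z| = r the real part of (gamma + z) / (gamma - z) is (|gamma|^2 - r^2) / |gamma - z|^2. The
    mean value property at 0, where this function is 1, therefore evaluates the mean exactly as 1 /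
    (|gamma|^2 - r^2). *)
Lemma means_le_inv_sub (gamma : C) : 1 < Cmod gamma ->
  means_le (fun z => / (gamma - z))%C (/ (Cmod gamma ^ 2 - 1)).
Proof.
  intros Hg. assert (P := two_PI_pos).
  assert (Hn : forall z, in_disk z -> (gamma - z)%C <> 0).
  { intros z Hz. apply Csub_nz. intros E. unfold in_disk in Hz. rewrite <- E in Hz. lra. }
  assert (Hinv : holo (fun z => / (gamma - z))%C).
  { apply (holo_inv (fun z => gamma - z)%C); auto. apply holo_minus. apply holo_const. apply holo_id. }
  apply means_le_pos; auto. intros r Hr.
  set (h := fun z => ((gamma + z) * / (gamma - z))%C).
  assert (Hh : holo h).
  { apply (holo_mult (fun z => gamma + z)%C); auto. apply holo_plus. apply holo_const. apply holo_id. }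
  assert (Hg2 : 0 < Cmod gamma ^ 2 - 1) by nra.
  assert (Hr2 : 0 < Cmod gamma ^ 2 - r ^ 2) by nra.
  assert (E : int_mean2 (fun z => / (gamma - z))%C r = / (Cmod gamma ^ 2 - r ^ 2)).
  { rewrite int_mean2_circ.
    rewrite (RInt_ext _ (fun t => scal (/ (Cmod gamma ^ 2 - r ^ 2)) (Re (h (circ r t))))).
    - rewrite (RInt_scal (V:=R_CompleteNormedModule) (fun t => Re (h (circ r t)))).
      + change (RInt (fun t => Re (h (circ r t))) 0 (2 * PI)) with (Re (circ_int h r)).
        rewrite (mean_value_punctured h 0); try lra.
        * assert (Eh : h 0 = 1). { unfold h. field. apply nz_of_Cmod. lra. }
          rewrite Eh, Cmult_1_r.
          change (/ (2 * PI) * (/ (Cmod gamma ^ 2 - r ^ 2) * (2 * PI)) = / (Cmod gamma ^ 2 - r ^ 2)).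
          field. lra.
        * intros z Hz. now apply holo_ccont.
        * intros z Hz _. now apply Hh.
      + apply pc_re. lra. apply circ_pcont_on. lra. intros z Hz. apply holo_ccont; auto. unfold in_disk; lra.
    - intros t _. assert (Hz := Cmod_circ r t ltac:(lra)). set (z := circ r t) in *.
      assert (Hz' : in_disk z) by (unfold in_disk; lra). specialize (Hn z Hz').
      change (Cmod (/ (gamma - z)) ^ 2 = / (Cmod gamma ^ 2 - r ^ 2) * Re (h z)).
      assert (Hd : 0 < Cmod (gamma - z) ^ 2). { apply pow_lt. now apply Cmod_gt_0. }
      rewrite Cmod_inv, pow_inv by auto. rewrite <- Hz in *.
      assert (K : Re (h z) * Cmod (gamma - z) ^ 2 = Cmod gamma ^ 2 - Cmod z ^ 2).
      { unfold h. replace ((gamma + z) * / (gamma - z))%C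
          with (RtoC (/ Cmod (gamma - z) ^ 2) * ((gamma + z) * Cconj (gamma - z)))%C.
        - rewrite !Cmod2_alt in *. destruct gamma as [g1 g2], z as [z1 z2]. simpl in *. field.
          intros F. apply (Rlt_irrefl 0). eapply Rlt_le_trans. exact Hd. right. rewrite <- F. ring.
        - rewrite RtoC_inv by lra. rewrite Cmod2_conj. field.
          split; auto. intros F. apply Hn. rewrite <- (Cconj_conj (gamma - z)), F.
          unfold Cconj, RtoC; simpl. f_equal; ring. }
      apply Rmult_eq_reg_r with (Cmod (gamma - z) ^ 2); [|lra].
      rewrite Rinv_l by lra. rewrite Rmult_assoc, K, Rinv_l; lra. }
  rewrite E. apply Rinv_le_contravar; nra.
Qed.

(* The exceptional arc near [alpha] is controlled by the H^2 function
   [2 dl / ((1 + dl) alpha - z)], which is at least 1 in modulus there and has small norm. *)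
Lemma means_le_off_arc (h : C -> C) alpha K eps dl : holo h -> Cmod alpha = 1 -> 0 < dl ->
  0 <= K -> 0 <= eps ->
  (forall z, in_disk z -> Cmod (h z) <= K) ->
  (forall z, in_disk z -> dl <= Cmod (z - alpha) -> Cmod (h z) <= eps) ->
  means_le h (eps ^ 2 + 2 * K ^ 2 * dl).
Proof.
  intros Hh Ha Hd HK He H1 H2 r Hr.
  set (gamma := (RtoC (1 + dl) * alpha)%C).
  assert (Hg : Cmod gamma = 1 + dl).
  { unfold gamma. rewrite Cmod_mult, Cmod_R, Ha, Rabs_pos_eq; lra. }
  assert (M := means_le_inv_sub gamma ltac:(lra) r Hr). rewrite Hg in M.
  assert (Hn : forall z, in_disk z -> (gamma - z)%C <> 0).
  { intros z Hz. apply Csub_nz. intros E. unfold in_disk in Hz. rewrite <- E in Hz. lra. }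
  assert (Hinv : holo (fun z => / (gamma - z))%C).
  { apply (holo_inv (fun z => gamma - z)%C); auto. apply holo_minus. apply holo_const. apply holo_id. }
  assert (Q : int_mean2 h r <= K ^ 2 * (2 * dl) ^ 2 * int_mean2 (fun z => / (gamma - z))%C r
                 + 0 * int_mean2 h r + eps ^ 2).
  { apply int_mean2_le; try lra; try (apply holo_circ_cont; auto; lra).
    intros z Hz. assert (Hzd : in_disk z) by (unfold in_disk; lra).
    specialize (H1 z Hzd). specialize (H2 z Hzd). specialize (Hn z Hzd).
    assert (Hgz : 0 < Cmod (gamma - z)) by now apply Cmod_gt_0.
    assert (H0 := Cmod_ge_0 (h z)). rewrite Cmod_inv by auto.
    rewrite Rmult_0_l, Rplus_0_r.
    assert (T0 : 0 <= K ^ 2 * (2 * dl) ^ 2 * (/ Cmod (gamma - z)) ^ 2).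
    { apply Rmult_le_pos; [apply Rmult_le_pos|]; apply pow2_ge_0. }
    destruct (Rle_lt_dec dl (Cmod (z - alpha))) as [Hc|Hc].
    - specialize (H2 Hc). assert (Cmod (h z) ^ 2 <= eps ^ 2) by (apply pow_incr; lra). lra.
    - assert (Hup : Cmod (gamma - z) <= 2 * dl).
      { replace (gamma - z)%C with (RtoC dl * alpha - (z - alpha))%C.
        eapply Rle_trans. apply Cmod_triangle_sub. rewrite Cmod_mult, Cmod_R, Ha, Rabs_pos_eq; lra.
        unfold gamma. rewrite RtoC_plus. ring. }
      assert (1 <= (2 * dl) ^ 2 * (/ Cmod (gamma - z)) ^ 2).
      { rewrite <- Rpow_mult_distr. rewrite <- (pow1 2). apply pow_incr. split. lra.
        apply Rmult_le_reg_r with (Cmod (gamma - z)); auto.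
        rewrite Rmult_assoc, Rinv_l by lra. lra. }
      assert (Cmod (h z) ^ 2 <= K ^ 2) by (apply pow_incr; lra).
      assert (0 <= K ^ 2) by apply pow2_ge_0. assert (0 <= eps ^ 2) by apply pow2_ge_0. nra. }
  eapply Rle_trans. exact Q. rewrite Rmult_0_l, Rplus_0_r, Rplus_comm. apply Rplus_le_compat_l.
  apply Rle_trans with (K ^ 2 * (2 * dl) ^ 2 * / ((1 + dl) ^ 2 - 1)).
  - apply Rmult_le_compat_l; auto. apply Rmult_le_pos; apply pow2_ge_0.
  - replace ((1 + dl) ^ 2 - 1) with (dl * (2 + dl)) by ring.
    replace (K ^ 2 * (2 * dl) ^ 2 * / (dl * (2 + dl))) with (K ^ 2 * (4 * dl / (2 + dl))) by (field; lra).
    replace (2 * K ^ 2 * dl) with (K ^ 2 * (2 * dl)) by ring.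
    apply Rmult_le_compat_l. apply pow2_ge_0.
    apply Rmult_le_reg_r with (2 + dl). lra.
    replace (4 * dl / (2 + dl) * (2 + dl)) with (4 * dl) by (field; lra). nra.
Qed.

(** Dominated convergence with one exceptional boundary point: off an arc at [alpha] the functions
    are uniformly small, and the arc contributes at most 2 K^2 dl. Each share is made at most eta /
    2. *)
Lemma bounded_convergence (h : nat -> C -> C) alpha K : Cmod alpha = 1 -> 0 <= K ->
  (forall n, holo (h n)) -> (forall n z, in_disk z -> Cmod (h n z) <= K) ->
  (forall dl eps, 0 < dl -> 0 < eps -> exists n0, forall n z, (n0 <= n)%nat -> in_disk z ->
      dl <= Cmod (z - alpha) -> Cmod (h n z) <= eps) ->
  forall eta, 0 < eta -> exists n0, forall n, (n0 <= n)%nat -> means_le (h n) eta.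
Proof.
  intros Ha HK Hh Hb Hc eta He.
  set (dl := eta / (4 * (K ^ 2 + 1))). assert (K2 := pow2_ge_0 K).
  assert (Hd : 0 < dl) by (apply Rdiv_lt_0_compat; lra).
  set (eps := Rmin 1 (eta / 2)). assert (He0 : 0 < eps) by (apply Rmin_pos; lra).
  assert (E1 := Rmin_l 1 (eta / 2)). assert (E2 := Rmin_r 1 (eta / 2)). fold eps in E1, E2.
  destruct (Hc dl eps Hd He0) as [n0 Hn0]. exists n0. intros n Hn r Hr.
  eapply Rle_trans. { apply (means_le_off_arc (h n) alpha K eps dl); auto; try lra. }
  assert (dl * (4 * (K ^ 2 + 1)) = eta) by (unfold dl; field; lra). nra.
Qed.

(** * Density of polynomials and the recurrence criteria *)

(** Polynomials as the closure under sums and products, without coefficients, so that composition,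
    boundedness, Lipschitz bounds and approximation are structural inductions. *)
Inductive polyfun : (C -> C) -> Prop :=
| polyfun_const c : polyfun (fun _ => c)
| polyfun_id : polyfun (fun z => z)
| polyfun_plus p q : polyfun p -> polyfun q -> polyfun (fun z => p z + q z)%C
| polyfun_mult p q : polyfun p -> polyfun q -> polyfun (fun z => p z * q z)%C.

Lemma polyfun_minus p q : polyfun p -> polyfun q -> polyfun (fun z => p z - q z)%C.
Proof.
  intros Hp Hq.
  replace (fun z => p z - q z)%C with (fun z => p z + (- (1)) * q z)%C.
  - apply polyfun_plus; auto. apply (polyfun_mult (fun _ => - (1))%C); auto. apply polyfun_const.
  - apply functional_extensionality. intros z. ring.
Qed.

Lemma polyfun_pow p n : polyfun p -> polyfun (fun z => p z ^ n)%C.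
Proof.
  intros Hp. induction n as [|n IH]; simpl. apply polyfun_const. now apply polyfun_mult.
Qed.

Lemma polyfun_csum (u : nat -> C -> C) n : (forall k, polyfun (u k)) ->
  polyfun (fun z => csum (fun k => u k z) n).
Proof.
  intros H. induction n as [|n IH]; simpl. apply polyfun_const. now apply polyfun_plus.
Qed.

Lemma polyfun_comp p q : polyfun p -> polyfun q -> polyfun (fun z => p (q z)).
Proof.
  intros Hp Hq. induction Hp as [c| |p1 p2 H1 I1 H2 I2|p1 p2 H1 I1 H2 I2]; auto.
  - apply polyfun_const.
  - now apply (polyfun_plus (fun z => p1 (q z)) (fun z => p2 (q z))).
  - now apply (polyfun_mult (fun z => p1 (q z)) (fun z => p2 (q z))).
Qed.

Lemma holo_polyfun p s : polyfun p -> holo s -> holo (fun z => p (s z)).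
Proof.
  intros Hp Hs. induction Hp as [c| |p1 p2 H1 I1 H2 I2|p1 p2 H1 I1 H2 I2]; auto.
  - apply holo_const.
  - now apply holo_plus.
  - now apply holo_mult.
Qed.

Lemma polyfun_bounded p K : polyfun p -> exists M, 0 <= M /\ forall z, Cmod z <= K -> Cmod (p z) <= M.
Proof.
  intros Hp. induction Hp as [c| |p1 p2 H1 (M1 & P1 & I1) H2 (M2 & P2 & I2)|p1 p2 H1 (M1 & P1 & I1) H2 (M2 & P2 & I2)].
  - exists (Cmod c). split. apply Cmod_ge_0. intros; lra.
  - exists (Rabs K). split. apply Rabs_pos. intros z Hz. generalize (Rle_abs K). lra.
  - exists (M1 + M2). split. lra. intros z Hz. eapply Rle_trans. apply Cmod_triangle.
    apply Rplus_le_compat; auto.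
  - exists (M1 * M2). split. now apply Rmult_le_pos. intros z Hz. rewrite Cmod_mult.
    apply Rmult_le_compat; auto using Cmod_ge_0.
Qed.

Lemma polyfun_lipschitz p K : polyfun p -> exists L, 0 <= L /\
  forall z w, Cmod z <= K -> Cmod w <= K -> Cmod (p z - p w) <= L * Cmod (z - w).
Proof.
  intros Hp. induction Hp as [c| |p1 p2 H1 (L1 & P1 & I1) H2 (L2 & P2 & I2)|p1 p2 H1 (L1 & P1 & I1) H2 (L2 & P2 & I2)].
  - exists 0. split. lra. intros. replace (c - c)%C with (RtoC 0) by ring. rewrite Cmod_0. lra.
  - exists 1. split. lra. intros. lra.
  - exists (L1 + L2). split. lra. intros z w Hz Hw.
    replace (p1 z + p2 z - (p1 w + p2 w))%C with ((p1 z - p1 w) + (p2 z - p2 w))%C by ring.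
    eapply Rle_trans. apply Cmod_triangle. specialize (I1 z w Hz Hw). specialize (I2 z w Hz Hw). lra.
  - destruct (polyfun_bounded p1 K H1) as (M1 & Q1 & B1). destruct (polyfun_bounded p2 K H2) as (M2 & Q2 & B2).
    exists (L1 * M2 + M1 * L2). split. { assert (0 <= L1 * M2) by now apply Rmult_le_pos.
      assert (0 <= M1 * L2) by now apply Rmult_le_pos. lra. }
    intros z w Hz Hw.
    replace (p1 z * p2 z - p1 w * p2 w)%C with ((p1 z - p1 w) * p2 z + p1 w * (p2 z - p2 w))%C by ring.
    eapply Rle_trans. apply Cmod_triangle. rewrite !Cmod_mult.
    assert (D0 := Cmod_ge_0 (z - w)).
    apply Rle_trans with (L1 * Cmod (z - w) * M2 + M1 * (L2 * Cmod (z - w))); [|right; ring].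
    apply Rplus_le_compat; apply Rmult_le_compat; auto using Cmod_ge_0.
Qed.

(* A disk automorphism when [|g| < 1], written so that its pole is at [/ g]. *)
Definition blaschke (g z : C) : C := ((z - Cconj g) / (1 - g * z))%C.

Lemma one_minus_nz (g z : C) : Cmod g < 1 -> Cmod z <= 1 -> (1 - g * z)%C <> 0.
Proof.
  intros Hg Hz. apply nz_of_Cmod. assert (T := Cmod_triangle_rev 1 (g * z)).
  rewrite Cmod_1, Cmod_mult in T.
  assert (G0 := Cmod_ge_0 g). assert (Z0 := Cmod_ge_0 z). nra.
Qed.

Lemma blaschke_identity (g z : C) : Cmod g < 1 -> Cmod z <= 1 ->
  1 - Cmod (blaschke g z) ^ 2 = (1 - Cmod g ^ 2) * (1 - Cmod z ^ 2) / Cmod (1 - g * z) ^ 2.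
Proof.
  intros Hg Hz. assert (Hn := one_minus_nz g z Hg Hz).
  unfold blaschke. rewrite Cmod_div by auto.
  assert (Hd : 0 < Cmod (1 - g * z)) by now apply Cmod_gt_0.
  assert (E : Cmod (1 - g * z) ^ 2 - Cmod (z - Cconj g) ^ 2 = (1 - Cmod g ^ 2) * (1 - Cmod z ^ 2)).
  { rewrite !Cmod2_alt. destruct g, z. simpl. ring. }
  rewrite <- E. field. lra.
Qed.

Lemma blaschke_le_1 g z : Cmod g < 1 -> in_disk z -> Cmod (blaschke g z) < 1.
Proof.
  intros Hg Hz. unfold in_disk in Hz. assert (E := blaschke_identity g z Hg ltac:(lra)).
  assert (Hn := one_minus_nz g z Hg ltac:(lra)). assert (Hd : 0 < Cmod (1 - g * z)) by now apply Cmod_gt_0.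
  assert (0 < (1 - Cmod g ^ 2) * (1 - Cmod z ^ 2) / Cmod (1 - g * z) ^ 2).
  { apply Rdiv_lt_0_compat. generalize (Cmod_ge_0 g) (Cmod_ge_0 z). intros.
    apply Rmult_lt_0_compat; nra. now apply pow_lt. }
  assert (B0 := Cmod_ge_0 (blaschke g z)). nra.
Qed.

Lemma holo_blaschke g : Cmod g < 1 -> holo (blaschke g).
Proof.
  intros Hg. apply (holo_mult (fun z => z - Cconj g)%C (fun z => / (1 - g * z))%C).
  - apply holo_minus. apply holo_id. apply holo_const.
  - apply (holo_inv (fun z => 1 - g * z)%C).
    + apply holo_minus. apply holo_const. apply (holo_mult (fun _ => g)). apply holo_const. apply holo_id.
    + intros z Hz. apply one_minus_nz; auto. unfold in_disk in Hz. lra.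
Qed.

(** With v the Blaschke factor, z = (v + conj g) / (1 + g v). The geometric series of 1 / (1 + g v)
    converges uniformly since |g v| <= |g| < 1; cut at N it leaves an error of at most 2 |g|^N / (1
    - |g|). *)
Lemma id_approx_blaschke g eps : Cmod g < 1 -> 0 < eps ->
  exists P, polyfun P /\ forall z, in_disk z -> Cmod (z - P (blaschke g z)) <= eps.
Proof.
  intros Hg He. assert (G0 := Cmod_ge_0 g).
  destruct (pow_small (Cmod g) (eps * (1 - Cmod g) / 2)) as [N HN]; try lra.
  { apply Rdiv_lt_0_compat; [|lra]. apply Rmult_lt_0_compat; lra. }
  specialize (HN N (le_n N)).
  exists (fun v => (v + Cconj g) * csum (fun k => (- g * v) ^ k) N)%C. split.
  - apply (polyfun_mult (fun v => v + Cconj g)%C).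
    + apply (polyfun_plus (fun v => v)). apply polyfun_id. apply polyfun_const.
    + apply (polyfun_csum (fun k v => (- g * v) ^ k)%C). intros k. apply (polyfun_pow (fun v => - g * v)%C).
      apply (polyfun_mult (fun _ => - g)%C). apply polyfun_const. apply polyfun_id.
  - intros z Hz. assert (Hv := blaschke_le_1 g z Hg Hz). set (v := blaschke g z) in *.
    assert (Hz' := Hz). unfold in_disk in Hz'.
    assert (N1 := one_minus_nz g z Hg ltac:(lra)).
    assert (Hw : Cmod (- g) < 1) by now rewrite Cmod_opp.
    assert (N2 := one_minus_nz (- g) v Hw ltac:(lra)).
    assert (Egeo : forall n, (csum (fun k => (- g * v) ^ k) n * (1 - - g * v))%C = (1 - (- g * v) ^ n)%C).
    { induction n as [|n IH]; cbn [csum]. simpl; ring.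
      rewrite Cmult_plus_distr_r, IH. simpl. ring. }
    assert (Ez : (z * (1 - - g * v))%C = (v + Cconj g)%C).
    { unfold v, blaschke. field. auto. }
    replace (z - (v + Cconj g) * csum (fun k => (- g * v) ^ k) N)%C
      with ((v + Cconj g) * (- g * v) ^ N / (1 - - g * v))%C.
    2:{ rewrite <- Ez. set (S := csum (fun k => (- g * v) ^ k)%C N) in *.
        replace ((- g * v) ^ N)%C with (1 - S * (1 - - g * v))%C. field. auto.
        unfold S. rewrite Egeo. ring. }
    rewrite Cmod_div, Cmod_mult, Cmod_pow, Cmod_mult, Cmod_opp by auto.
    assert (D1 : 1 - Cmod g <= Cmod (1 - - g * v)).
    { eapply Rle_trans; [|apply Cmod_triangle_rev]. rewrite Cmod_1, Cmod_mult, Cmod_opp.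
      assert (V0 := Cmod_ge_0 v). nra. }
    assert (D2 : Cmod (v + Cconj g) <= 2).
    { eapply Rle_trans. apply Cmod_triangle. rewrite Cmod_conj. lra. }
    assert (D3 : (Cmod g * Cmod v) ^ N <= Cmod g ^ N).
    { apply pow_incr. assert (V0 := Cmod_ge_0 v). nra. }
    assert (D4 : 0 <= (Cmod g * Cmod v) ^ N).
    { apply pow_le. apply Rmult_le_pos; apply Cmod_ge_0. }
    apply Rle_trans with (2 * Cmod g ^ N / (1 - Cmod g)).
    + unfold Rdiv. apply Rmult_le_compat.
      * apply Rmult_le_pos; auto. apply Cmod_ge_0.
      * apply Rlt_le, Rinv_0_lt_compat. lra.
      * apply Rmult_le_compat; auto. apply Cmod_ge_0.
      * apply Rinv_le_contravar; lra.
    + apply Rmult_le_reg_r with (1 - Cmod g). lra. unfold Rdiv. rewrite Rmult_assoc, Rinv_l; lra.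
Qed.

Lemma polyfun_approx_blaschke g p : Cmod g < 1 -> polyfun p -> forall eps, 0 < eps ->
  exists P, polyfun P /\ forall z, in_disk z -> Cmod (p z - P (blaschke g z)) <= eps.
Proof.
  intros Hg Hp. induction Hp as [c| |p1 p2 H1 I1 H2 I2|p1 p2 H1 I1 H2 I2]; intros eps He.
  - exists (fun _ => c). split. apply polyfun_const. intros z _.
    replace (c - c)%C with (RtoC 0) by ring. rewrite Cmod_0. lra.
  - now apply id_approx_blaschke.
  - destruct (I1 (eps / 2)) as (P1 & Q1 & R1). lra. destruct (I2 (eps / 2)) as (P2 & Q2 & R2). lra.
    exists (fun z => P1 z + P2 z)%C. split. now apply polyfun_plus. intros z Hz.
    set (v := blaschke g z) in *. specialize (R1 z Hz). specialize (R2 z Hz). fold v in R1, R2.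
    replace (p1 z + p2 z - (P1 v + P2 v))%C with ((p1 z - P1 v) + (p2 z - P2 v))%C by ring.
    eapply Rle_trans. apply Cmod_triangle. lra.
  - destruct (polyfun_bounded p1 1 H1) as (M1 & A1 & B1). destruct (polyfun_bounded p2 1 H2) as (M2 & A2 & B2).
    set (e := Rmin 1 (eps / (M1 + M2 + 2))).
    assert (He0 : 0 < e). { apply Rmin_pos. lra. apply Rdiv_lt_0_compat; lra. }
    assert (E1 := Rmin_l 1 (eps / (M1 + M2 + 2))). assert (E2 := Rmin_r 1 (eps / (M1 + M2 + 2))).
    fold e in E1, E2.
    destruct (I1 e He0) as (P1 & Q1 & R1). destruct (I2 e He0) as (P2 & Q2 & R2).
    exists (fun z => P1 z * P2 z)%C. split. now apply polyfun_mult. intros z Hz.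
    set (v := blaschke g z) in *. specialize (R1 z Hz). specialize (R2 z Hz). fold v in R1, R2.
    unfold in_disk in Hz. specialize (B1 z ltac:(lra)). specialize (B2 z ltac:(lra)).
    replace (p1 z * p2 z - P1 v * P2 v)%C
     with ((p1 z - P1 v) * p2 z + (p1 z - (p1 z - P1 v)) * (p2 z - P2 v))%C by ring.
    eapply Rle_trans. apply Cmod_triangle. rewrite !Cmod_mult.
    assert (B3 : Cmod (p1 z - (p1 z - P1 v)) <= M1 + 1).
    { eapply Rle_trans. apply Cmod_triangle_sub. lra. }
    apply Rle_trans with (e * M2 + (M1 + 1) * e).
    + apply Rplus_le_compat; apply Rmult_le_compat; auto using Cmod_ge_0.
    + apply (Rmult_le_compat_r (M1 + M2 + 2)) in E2; [|lra].
      replace (eps / (M1 + M2 + 2) * (M1 + M2 + 2)) with eps in E2 by (field; lra). nra.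
Qed.

Lemma blaschke_dense g f B eps : Cmod g < 1 -> holo f -> means_le f B -> 0 < eps ->
  exists P, polyfun P /\ means_le (fun z => f z - P (blaschke g z))%C eps.
Proof.
  intros Hg Hf HB He.
  destruct (taylor_dense f B (eps / 4) Hf HB ltac:(lra)) as [N HN].
  set (p := fun z => csum (fun k => taylor_coef f k * z ^ k)%C N) in *.
  assert (Hp : polyfun p).
  { apply (polyfun_csum (fun k z => taylor_coef f k * z ^ k)%C). intros k.
    apply (polyfun_mult (fun _ => taylor_coef f k)). apply polyfun_const. apply (polyfun_pow (fun z => z)), polyfun_id. }
  set (e := Rmin 1 (eps / 4)). assert (He0 : 0 < e) by (apply Rmin_pos; lra).
  assert (E1 := Rmin_l 1 (eps / 4)). assert (E2 := Rmin_r 1 (eps / 4)). fold e in E1, E2.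
  destruct (polyfun_approx_blaschke g p Hg Hp e He0) as (P & HP & HPz).
  exists P. split; auto.
  assert (Hh1 : holo (fun z => f z - p z)%C) by (apply holo_minus; auto; apply (holo_polyfun p (fun z => z)); auto; apply holo_id).
  assert (Hh2 : holo (fun z => p z - P (blaschke g z))%C).
  { apply holo_minus. apply (holo_polyfun p (fun z => z)); auto; apply holo_id.
    apply (holo_polyfun P (blaschke g)); auto. now apply holo_blaschke. }
  assert (H2 := means_le_sup _ e Hh2 ltac:(lra) HPz).
  assert (H := means_le_add _ _ _ _ Hh1 Hh2 HN H2).
  intros r Hr. specialize (H r Hr).
  rewrite (int_mean2_ext _ (fun z => f z - p z + (p z - P (blaschke g z)))%C) by (auto; intros; ring).
  nra.
Qed.

(** * Recurrence expressed through bounds on means *)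

Lemma H2_norm_lt f B eps : 0 <= B -> means_le f B -> 0 < eps -> B < eps ^ 2 -> H2_norm f < eps.
Proof.
  intros HB0 HB He H. unfold H2_norm.
  set (E := fun x => exists r, 0 <= r < 1 /\ x = int_mean2 f r).
  destruct (Lub_Rbar_correct E) as [H1 H2].
  (* The supremum lies between the mean at radius 0 and B, hence is finite and [real] does not
     return its default value. *)
  assert (HL : Rbar_le (Lub_Rbar E) B).
  { apply H2. intros x (r & Hr & ->). simpl. now apply HB. }
  assert (HG : Rbar_le (int_mean2 f 0) (Lub_Rbar E)).
  { apply H1. exists 0. split; auto. lra. }
  destruct (Lub_Rbar E) as [l| |]; simpl in *; try contradiction.
  rewrite <- (sqrt_pow2 eps) by lra. apply sqrt_lt_1_alt. split; [|lra].
  eapply Rle_trans; [|exact HG]. rewrite int_mean2_zero. apply pow2_ge_0.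
Qed.

Lemma H2_norm_means f eps : H2 f -> 0 < eps -> H2_norm f < eps -> means_le f (eps ^ 2).
Proof.
  intros [_ [M HM]] He H r Hr. unfold H2_norm in H.
  set (E := fun x => exists r, 0 <= r < 1 /\ x = int_mean2 f r) in *.
  destruct (Lub_Rbar_correct E) as [H1 H2].
  assert (HL : Rbar_le (Lub_Rbar E) M).
  { apply H2. intros x (s & Hs & ->). simpl. now apply HM. }
  assert (HG : Rbar_le (int_mean2 f r) (Lub_Rbar E)).
  { apply H1. exists r. split; auto. }
  assert (H0 : Rbar_le (int_mean2 f 0) (Lub_Rbar E)).
  { apply H1. exists 0. split; auto. lra. }
  destruct (Lub_Rbar E) as [l| |]; simpl in *; try contradiction.
  rewrite int_mean2_zero in H0. assert (Q := pow2_ge_0 (Cmod (f 0))).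
  assert (l < eps ^ 2).
  { rewrite <- (sqrt_sqrt l) by lra. assert (S0 := sqrt_pos l). nra. }
  lra.
Qed.

Lemma H2_of_means f B : holo f -> means_le f B -> H2 f.
Proof. intros Hf HB. split. now apply holo_iff. now exists B. Qed.

Lemma iter_comp_op phi f k :
  Nat.iter k (comp_op phi) f = (fun z => f (Nat.iter k phi z)).
Proof.
  induction k as [|k IH]. reflexivity.
  change (Nat.iter (S k) (comp_op phi) f) with (comp_op phi (Nat.iter k (comp_op phi) f)).
  rewrite IH. apply functional_extensionality. intros z. unfold comp_op.
  rewrite <- Nat.iter_succ_r. reflexivity.
Qed.

(** The approximant g and its image are both to land in the given open set. That they lie in [H2]
    follows from their closeness to f, so only holomorphy is demanded of them. *)
Lemma recurrent_intro phi :
  (forall f eps, H2 f -> 0 < eps -> exists k g, (1 <= k)%nat /\ holo g /\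
      holo (fun z => g (Nat.iter k phi z)) /\ means_le (fun z => f z - g z)%C eps /\
      means_le (fun z => f z - g (Nat.iter k phi z))%C eps) ->
  recurrent (comp_op phi).
Proof.
  intros H U HU Ho [f Hf]. destruct (Ho f Hf) as (eps & He & Hball).
  assert (Hf2 := HU f Hf). destruct Hf2 as [Hfh [M HM]]. apply holo_iff in Hfh.
  destruct (H f (eps ^ 2 / 2) (HU f Hf)) as (k & g & Hk & Hg & Hgk & M1 & M2).
  { assert (0 < eps ^ 2) by now apply pow_lt. lra. }
  assert (He2 : 0 < eps ^ 2) by now apply pow_lt.
  assert (Hin : forall h, holo h -> means_le (fun z => f z - h z)%C (eps ^ 2 / 2) -> U h).
  { intros h Hh Mh. apply Hball.
    - apply (H2_of_means h (2 * M + 2 * (eps ^ 2 / 2))); auto.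
      apply (means_le_ext (fun z => f z + (-(1)) * (f z - h z))%C). { intros; ring. }
      apply means_le_add; auto.
      + apply (holo_mult (fun _ => -(1))%C). apply holo_const. now apply holo_minus.
      + intros r Hr. replace (eps ^ 2 / 2) with (1 * (eps ^ 2 / 2) + 0 * (eps ^ 2 / 2) + 0) by ring.
        eapply Rle_trans.
        { apply (int_mean2_le _ (fun z => f z - h z)%C (fun z => f z - h z)%C 1 0 0); try lra;
          try (apply holo_circ_cont; [|lra]); try now apply holo_minus.
          apply (holo_mult (fun _ => -(1))%C). apply holo_const. now apply holo_minus.
          intros z _. rewrite Cmod_mult, Cmod_m1. lra. }
        specialize (Mh r Hr). lra.
    - apply (H2_norm_lt _ (eps ^ 2 / 2)); auto; lra. }
  exists k. split; auto. exists g. split. now apply Hin.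
  rewrite iter_comp_op. now apply Hin.
Qed.

(** Bounds on means are non-strict, so the open ball about [f0] is encoded by asking for some bound
    d strictly below eps. *)
Lemma recurrent_elim phi f0 B eps : holo f0 -> means_le f0 B -> 0 < eps -> recurrent (comp_op phi) ->
  exists k f, (1 <= k)%nat /\ holo f /\ means_le (fun z => f z - f0 z)%C eps /\
    holo (fun z => f (Nat.iter k phi z)) /\ means_le (fun z => f (Nat.iter k phi z) - f0 z)%C eps.
Proof.
  intros Hf0 HB He Hrec.
  set (U := fun f => H2 f /\ exists d, 0 < d < eps /\ means_le (fun z => f z - f0 z)%C d).
  destruct (Hrec U) as (k & Hk & f & Uf & Uk).
  - intros f [Hf _]. exact Hf.
  - intros f [Hf (d & Hd & Hm)].
    (* With this t and [e2], the bound (1 + t) d + (1 + 1 / t) e2 equals d + (eps - d) / 2, still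
       below eps. *)
    set (t := (eps - d) / (4 * d)). assert (Ht : 0 < t) by (apply Rdiv_lt_0_compat; lra).
    assert (Et : t * d = (eps - d) / 4) by (unfold t; field; lra).
    set (e2 := (eps - d) / 4 / (1 + / t)).
    assert (Hit : 0 < / t) by now apply Rinv_0_lt_compat.
    assert (He2 : 0 < e2) by (apply Rdiv_lt_0_compat; lra).
    exists (sqrt e2). split. now apply sqrt_lt_R0.
    intros g Hg Hn. split; auto. exists ((1 + t) * d + (1 + / t) * e2). 
    assert (E2 : (1 + / t) * e2 = (eps - d) / 4) by (unfold e2; field; lra).
    split. nra.
    assert (Hfh := proj1 (holo_iff f) (proj1 Hf)). assert (Hgh := proj1 (holo_iff g) (proj1 Hg)).
    destruct Hf as [_ [Mf HMf]]. destruct Hg as [_ [Mg HMg]].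
    assert (Hfg : holo (fun z => f z - g z)%C) by now apply holo_minus.
    assert (Hmd : means_le (fun z => f z - g z)%C e2).
    { rewrite <- (sqrt_sqrt e2) by lra. replace (sqrt e2 * sqrt e2) with (sqrt e2 ^ 2) by ring.
      apply H2_norm_means; auto; [|now apply sqrt_lt_R0].
      apply (H2_of_means _ (2 * Mf + 2 * Mg)); auto. intros r Hr.
      eapply Rle_trans.
      { apply (int_mean2_le _ f g 2 2 0); try lra; try (apply holo_circ_cont; auto; lra).
        intros z _. rewrite Rplus_0_r.
        assert (Q := Cmod_sq_add_le (f z) (- g z) 1 ltac:(lra)). rewrite Cmod_opp, Rinv_1 in Q.
        exact Q. }
      specialize (HMf r Hr). specialize (HMg r Hr). lra. }
    intros r Hr.
    rewrite (int_mean2_ext _ (fun z => (f z - f0 z) + (-(1)) * (f z - g z))%C) by (auto; intros; ring).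
    eapply Rle_trans.
    { apply (int_mean2_le _ (fun z => f z - f0 z)%C (fun z => f z - g z)%C (1 + t) (1 + / t) 0);
       try lra; try (apply holo_circ_cont; [|lra]); try now apply holo_minus.
      - apply holo_plus. now apply holo_minus. apply (holo_mult (fun _ => -(1))%C); auto. apply holo_const.
      - intros z _. rewrite Rplus_0_r. eapply Rle_trans. exact (Cmod_sq_add_le _ _ t Ht).
        rewrite Cmod_mult, Cmod_m1, Rmult_1_l. lra. }
    specialize (Hm r Hr). specialize (Hmd r Hr).
    rewrite Rplus_0_r. apply Rplus_le_compat; apply Rmult_le_compat_l; lra.
  - exists f0. split. now apply (H2_of_means f0 B). exists (eps / 2). split. lra.
    intros r Hr. assert (Hz : holo (fun z => f0 z - f0 z)%C) by now apply holo_minus.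
    assert (Q := means_le_sup (fun z => f0 z - f0 z)%C 0 Hz (Rle_refl 0)).
    eapply Rle_trans. apply Q; auto. intros z _. replace (f0 z - f0 z)%C with (RtoC 0) by ring.
    rewrite Cmod_0. lra. lra.
  - exists k, f. destruct Uf as [Hf (d & Hd & Hm)]. destruct Uk as [Hk2 (d' & Hd' & Hm')].
    rewrite iter_comp_op in Hk2, Hm'. split; auto. split. now apply holo_iff, Hf.
    split. { intros r Hr. specialize (Hm r Hr). lra. }
    split. { now apply holo_iff, Hk2. }
    intros r Hr. specialize (Hm' r Hr). lra.
Qed.

Lemma means_le_opp f B : holo f -> means_le f B -> means_le (fun z => - f z)%C B.
Proof.
  intros Hf HB r Hr.
  replace B with (1 * B + 0 * B + 0) by ring.
  apply Rle_trans with (1 * int_mean2 f r + 0 * int_mean2 f r + 0).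
  - apply int_mean2_le; try lra; try (apply holo_circ_cont; auto; lra).
    + apply holo_circ_cont; try lra. apply (holo_ext (fun z => 0 - f z)%C). intros; ring.
      apply holo_minus; auto. apply holo_const.
    + intros z _. rewrite Cmod_opp. lra.
  - specialize (HB r Hr). lra.
Qed.

Lemma means_le_sub f g A B : holo f -> holo g -> means_le f A -> means_le g B ->
  means_le (fun z => f z - g z)%C (2 * A + 2 * B).
Proof.
  intros Hf Hg HA HB. apply means_le_add; auto.
  - apply (holo_ext (fun z => 0 - g z)%C). intros; ring. apply holo_minus; auto. apply holo_const.
  - now apply means_le_opp.
Qed.

Lemma holo_pow_fun f n : holo f -> holo (fun z => f z ^ n)%C.
Proof.
  intros Hf. apply (holo_polyfun (fun w => w ^ n)%C); auto. apply (polyfun_pow (fun w => w)), polyfun_id.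
Qed.

(** * Decay away from a boundary point and the escape criterion *)

Definition away_from (alpha : C) (dl : R) (z : C) : Prop := in_disk z /\ dl <= Cmod (z - alpha).

Lemma means_pow_small (G : nat -> C -> C) w alpha M : Cmod alpha = 1 -> 0 <= M ->
  holo w -> (forall n, holo (G n)) ->
  (forall z, in_disk z -> Cmod (w z) <= 1) -> (forall n z, in_disk z -> Cmod (G n z) <= M) ->
  (forall dl, 0 < dl -> exists q, 0 <= q < 1 /\ forall z, away_from alpha dl z -> Cmod (w z) ^ 2 <= q) ->
  forall eta, 0 < eta -> exists n0, forall n, (n0 <= n)%nat -> means_le (fun z => G n z * w z ^ n)%C eta.
Proof.
  intros Ha HM Hw HG Hw1 HGM Hq. apply (bounded_convergence (fun n z => G n z * w z ^ n)%C alpha M); auto.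
  - intros n. apply holo_mult; auto. now apply holo_pow_fun.
  - intros n z Hz. rewrite Cmod_mult, Cmod_pow. rewrite <- (Rmult_1_r M).
    apply Rmult_le_compat; auto using Cmod_ge_0. apply pow_le, Cmod_ge_0.
    rewrite <- (pow1 n). apply pow_incr. split; auto using Cmod_ge_0.
  - intros dl eps Hd He. destruct (Hq dl Hd) as (q & Hq1 & Hq2).
    set (e := eps / (M + 1)). assert (He0 : 0 < e) by (apply Rdiv_lt_0_compat; lra).
    destruct (pow_small q (e ^ 2)) as [n0 Hn0]; auto. { now apply pow_lt. }
    exists n0. intros n z Hn Hz Hzd. specialize (Hn0 n Hn). rewrite Cmod_mult, Cmod_pow.
    assert (Hs : Cmod (w z) ^ n <= e).
    { assert (S : (Cmod (w z) ^ n) ^ 2 <= e ^ 2).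
      { rewrite <- pow_mult, Nat.mul_comm, pow_mult. apply Rle_trans with (q ^ n); [|lra].
        apply pow_incr. split. apply pow2_ge_0. apply Hq2. now split. }
      assert (0 <= Cmod (w z) ^ n) by (apply pow_le, Cmod_ge_0). nra. }
    apply Rle_trans with ((M + 1) * e); [|right; unfold e; field; lra].
    specialize (HGM n z Hz). apply Rmult_le_compat; auto using Cmod_ge_0; try lra.
    apply pow_le, Cmod_ge_0.
Qed.

Lemma means_lip_small F (s : nat -> C -> C) c alpha : Cmod alpha = 1 -> polyfun F -> F c = 0 ->
  Cmod c <= 1 -> (forall n, holo (s n)) -> (forall n z, in_disk z -> Cmod (s n z) <= 1) ->
  (forall dl eps, 0 < dl -> 0 < eps -> exists n0, forall n z, (n0 <= n)%nat ->
      away_from alpha dl z -> Cmod (s n z - c) <= eps) ->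
  forall eta, 0 < eta -> exists n0, forall n, (n0 <= n)%nat -> means_le (fun z => F (s n z)) eta.
Proof.
  intros Ha HF Hc Hc1 Hs Hs1 Hlim.
  destruct (polyfun_bounded F 1 HF) as (M & HM & HMb).
  destruct (polyfun_lipschitz F 1 HF) as (L & HL & HLb).
  apply (bounded_convergence (fun n z => F (s n z)) alpha M); auto.
  - intros n. now apply holo_polyfun.
  - intros dl eps Hd He. destruct (Hlim dl (eps / (L + 1)) Hd) as [n0 Hn0].
    { apply Rdiv_lt_0_compat; lra. }
    exists n0. intros n z Hn Hz Hzd.
    replace (F (s n z)) with (F (s n z) - F c)%C by (rewrite Hc; ring).
    eapply Rle_trans. { apply HLb; auto. }
    specialize (Hn0 n z Hn (conj Hz Hzd)).
    apply Rle_trans with ((L + 1) * (eps / (L + 1))); [|right; field; lra].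
    apply Rmult_le_compat; auto using Cmod_ge_0; lra.
Qed.

(* [sp k] and [sm k] stand for [s] composed with the k-th iterate of [phi] and of its formal inverse.
   The functions [F (s z)], with [F] vanishing at 0 and 1, are dense, and [F o sp k] and [F o sm k]
   tend to 0; hence [F o s + F o sm k] is almost fixed by the k-th power of the operator. *)
Lemma recurrent_escape phi g lam mu (s : C -> C) (sp sm : nat -> C -> C) a0 a1 ap am cp cm :
  Cmod g < 1 -> holo s -> (forall k, holo (sp k)) -> (forall k, holo (sm k)) ->
  (forall z, in_disk z -> blaschke g z = (lam * s z + mu)%C) ->
  (forall z, in_disk z -> Cmod (s z) <= 1 /\ Cmod (1 - s z) <= 1) ->
  (forall k z, in_disk z -> Cmod (sp k z) <= 1 /\ Cmod (sm k z) <= 1) ->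
  (forall k z, in_disk z -> s (Nat.iter k phi z) = sp k z /\ sm k (Nat.iter k phi z) = s z) ->
  Cmod a0 = 1 -> Cmod a1 = 1 -> Cmod ap = 1 -> Cmod am = 1 ->
  (cp = RtoC 0 \/ cp = RtoC 1) -> (cm = RtoC 0 \/ cm = RtoC 1) ->
  (forall dl, 0 < dl -> exists q, 0 <= q < 1 /\ forall z, away_from a0 dl z -> Cmod (1 - s z) ^ 2 <= q) ->
  (forall dl, 0 < dl -> exists q, 0 <= q < 1 /\ forall z, away_from a1 dl z -> Cmod (s z) ^ 2 <= q) ->
  (forall dl eps, 0 < dl -> 0 < eps -> exists n0, forall n z, (n0 <= n)%nat ->
      away_from ap dl z -> Cmod (sp n z - cp) <= eps) ->
  (forall dl eps, 0 < dl -> 0 < eps -> exists n0, forall n z, (n0 <= n)%nat ->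
      away_from am dl z -> Cmod (sm n z - cm) <= eps) ->
  recurrent (comp_op phi).
Proof.
  intros Hg Hs Hsp Hsm Hv Hs1 Hspm Hiter Ha0 Ha1 Hap Ham Hcp Hcm Hq0 Hq1 Hlp Hlm.
  apply recurrent_intro. intros f eps [Hf [B HB]] He. apply holo_iff in Hf.
  destruct (blaschke_dense g f B (eps / 32) Hg Hf HB ltac:(lra)) as (P & HP & HPm).
  set (p := fun w => P (lam * w + mu)%C).
  assert (Hp : polyfun p).
  { apply (polyfun_comp P (fun w => lam * w + mu)%C); auto.
    apply (polyfun_plus (fun w => lam * w)%C). apply (polyfun_mult (fun _ => lam)).
    apply polyfun_const. apply polyfun_id. apply polyfun_const. }
  destruct (polyfun_bounded p 1 Hp) as (M & HM & HMb).
  assert (Hps : holo (fun z => p (s z))) by now apply holo_polyfun.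
  assert (H1s : holo (fun z => 1 - s z)%C) by (apply holo_minus; auto; apply holo_const).
  assert (Hpm : forall w n, Cmod w <= 1 -> Cmod (w ^ n) <= 1).
  { intros w n Hw. rewrite Cmod_pow, <- (pow1 n). apply pow_incr. split; auto. apply Cmod_ge_0. }
  (* Two corrections are made small in mean: p(s) (1 - s)^N, removed to create a zero at s = 0, and
     p(s) (1 - (1 - s)^N) s^N, removed to create one at s = 1. *)
  destruct (means_pow_small (fun _ z => p (s z)) (fun z => 1 - s z)%C a0 M) with (eta := eps / 32)
    as [N0 HN0]; auto; try lra.
  { intros z Hz. now apply Hs1. } { intros _ z Hz. apply HMb. now apply Hs1. }
  destruct (means_pow_small (fun n z => p (s z) * (1 - (1 - s z) ^ n))%C s a1 (M * 2)) with (eta := eps / 32)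
    as [N1 HN1]; auto; try lra.
  { intros n. apply holo_mult; auto. apply (holo_minus (fun _ => RtoC 1)). apply holo_const.
    now apply (holo_pow_fun (fun z => 1 - s z)%C). }
  { intros z Hz. now apply Hs1. }
  { intros n z Hz. rewrite Cmod_mult. destruct (Hs1 z Hz) as [S1 S2].
    apply Rmult_le_compat; auto using Cmod_ge_0.
    eapply Rle_trans. apply Cmod_triangle_sub. rewrite Cmod_1. specialize (Hpm _ n S2). lra. }
  set (N := Nat.max N0 N1). specialize (HN0 N ltac:(unfold N; lia)). specialize (HN1 N ltac:(unfold N; lia)).
  (* p - F is the sum of the two corrections, and F vanishes at both possible limits of the
     iterates. *)
  set (F := fun w => (p w * ((1 - w ^ N) * (1 - (1 - w) ^ N)))%C).
  assert (HF : polyfun F).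
  { apply (polyfun_mult p); auto. apply (polyfun_mult (fun w => 1 - w ^ N)%C).
    - apply (polyfun_minus (fun _ => RtoC 1)). apply polyfun_const. apply (polyfun_pow (fun w => w)), polyfun_id.
    - apply (polyfun_minus (fun _ => RtoC 1)). apply polyfun_const. apply (polyfun_pow (fun w => 1 - w)%C).
      apply (polyfun_minus (fun _ => RtoC 1)). apply polyfun_const. apply polyfun_id. }
  assert (HF0 : F 0 = 0).
  { unfold F. replace (1 - 0)%C with (RtoC 1) by ring. rewrite Cpow_1_l. ring. }
  assert (HF1 : F 1 = 0).
  { unfold F. rewrite Cpow_1_l. ring. }
  assert (HFc : forall c, c = RtoC 0 \/ c = RtoC 1 -> F c = 0 /\ Cmod c <= 1).
  { intros c [->| ->]; split; auto; rewrite Cmod_R; [rewrite Rabs_R0|rewrite Rabs_R1]; lra. }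
  destruct (HFc cp Hcp) as [Fp Cp]. destruct (HFc cm Hcm) as [Fm Cm].
  destruct (means_lip_small F sp cp ap) with (eta := eps / 32) as [Np HNp]; auto; try lra.
  { intros n z Hz. now apply Hspm. }
  destruct (means_lip_small F sm cm am) with (eta := eps / 32) as [Nm HNm]; auto; try lra.
  { intros n z Hz. now apply Hspm. }
  set (k := S (Nat.max Np Nm)).
  specialize (HNp k ltac:(unfold k; lia)). specialize (HNm k ltac:(unfold k; lia)).
  assert (HFs : holo (fun z => F (s z))) by now apply holo_polyfun.
  assert (HFp : holo (fun z => F (sp k z))) by now apply holo_polyfun.
  assert (HFm : holo (fun z => F (sm k z))) by now apply holo_polyfun.
  assert (HPh : holo (fun z => f z - P (blaschke g z))%C).
  { apply holo_minus; auto. apply holo_polyfun; auto. now apply holo_blaschke. }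
  (* Each sum doubles the squared bounds: this makes 10 eps / 32, and the final comparisons 22 eps /
     32. *)
  assert (Hd : means_le (fun z => f z - F (s z))%C (2 * (eps / 32) + 2 * (2 * (eps / 32) + 2 * (eps / 32)))).
  { apply (means_le_ext (fun z => (f z - P (blaschke g z)) +
      ((p (s z) * (1 - (1 - s z) ^ N)) * s z ^ N + p (s z) * (1 - s z) ^ N))%C).
    - intros z Hz. unfold F, p. rewrite Hv by auto. ring.
    - assert (K1 : holo (fun z => (p (s z) * (1 - (1 - s z) ^ N)) * s z ^ N)%C).
      { apply holo_mult. apply holo_mult; auto. apply (holo_minus (fun _ => RtoC 1)). apply holo_const.
        now apply (holo_pow_fun (fun z => 1 - s z)%C). now apply holo_pow_fun. }
      assert (K2 : holo (fun z => p (s z) * (1 - s z) ^ N)%C).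
      { apply holo_mult; auto. now apply (holo_pow_fun (fun z => 1 - s z)%C). }
      apply means_le_add; auto. now apply holo_plus. now apply means_le_add. }
  assert (Hfs : holo (fun z => f z - F (s z))%C) by now apply holo_minus.
  exists k, (fun z => F (s z) + F (sm k z))%C. split. unfold k; lia. split. now apply holo_plus.
  assert (Ek : forall z, in_disk z -> (F (s (Nat.iter k phi z)) + F (sm k (Nat.iter k phi z)))%C
                = (F (sp k z) + F (s z))%C).
  { intros z Hz. destruct (Hiter k z Hz) as [-> ->]. reflexivity. }
  split; [|split].
  - apply (holo_ext (fun z => F (sp k z) + F (s z))%C). intros z Hz. symmetry. now apply Ek. now apply holo_plus.
  - assert (Q := means_le_sub _ _ _ _ Hfs HFm Hd HNm). intros r Hr. specialize (Q r Hr).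
    rewrite (int_mean2_ext _ (fun z => f z - F (s z) - F (sm k z))%C) by (auto; intros; ring). lra.
  - assert (Q := means_le_sub _ _ _ _ Hfs HFp Hd HNp). intros r Hr. specialize (Q r Hr).
    rewrite (int_mean2_ext _ (fun z => f z - F (s z) - F (sp k z))%C). lra. auto.
    intros z Hz. rewrite Ek by auto. ring.
Qed.

(** * Projective coordinates at the fixed points *)

Lemma Cmult_zero_l (x y : C) : (x * y)%C = 0 -> y <> 0 -> x = 0.
Proof. intros H Hy. replace x with (x * y * / y)%C by (field; auto). rewrite H. ring. Qed.

Lemma Csub_zero (x y : C) : (x - y)%C = 0 -> x = y.
Proof. intros H. replace x with ((x - y) + y)%C by ring. rewrite H. ring. Qed.

(* [(p : q)] is a fixed point of the map on the projective line; [nu] is the eigenvalue of the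
   matrix at the corresponding eigenvector. *)
Definition eigen (a b c d p q nu : C) : Prop :=
  (a * p + b * q)%C = (nu * p)%C /\ (c * p + d * q)%C = (nu * q)%C.

Lemma fixed_pt_eigen a b c d z : fixed_pt a b c d (Some z) ->
  eigen a b c d z 1 (c * z + d)%C /\ (c * z + d)%C <> 0.
Proof.
  unfold fixed_pt, lf_ext. destruct (Ceq_dec (c * z + d)%C 0) as [|Hn]. discriminate.
  intros E. injection E as E. unfold lf in E. split; auto. split; [|ring].
  rewrite <- E at 3. field. auto.
Qed.

(** Infinity is represented by (-1 : 0), for which the denominator b0 z - b1 of [coord] is 1 and the
    coordinate is z - al. *)
Lemma fixed_pt_eigen_infty a b c d : (a * d - b * c)%C <> 0 -> fixed_pt a b c d None ->
  eigen a b c d (-(1)) 0 a /\ a <> 0 /\ c = 0.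
Proof.
  unfold fixed_pt, lf_ext. intros Hdet. destruct (Ceq_dec c 0) as [->|Hn]; [|discriminate].
  intros _. split; [split; ring|]. split; auto. intros ->. apply Hdet. ring.
Qed.

(** The second fixed point is given homogeneously as (b1 : b0), so a finite one and infinity are
    treated together. *)
Definition coord (al b0 b1 z : C) : C := ((z - al) / (b0 * z - b1))%C.

(** The row (1, -al) annihilates the eigenvector (al, 1), hence is a left eigenvector for the other
    eigenvalue mu; likewise (b0, -b1) for nu. This is why numerator and denominator of [coord] are
    multiplied by mu and nu. *)
Lemma eigen_pair_identities a b c d al nu b0 b1 mu :
  eigen a b c d al 1 nu -> eigen a b c d b1 b0 mu -> (b1 - al * b0)%C <> 0 ->
  (a - al * c = mu /\ b0 * a - b1 * c = nu * b0 /\ b0 * b - b1 * d = - (nu * b1))%C.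
Proof.
  intros [A1 A2] [B1 B2] HD.
  assert (Eb : b = (nu * al - a * al)%C). { rewrite <- A1. ring. }
  assert (Ed : d = (nu - c * al)%C).
  { replace nu with (nu * 1)%C by ring. rewrite <- A2. ring. }
  assert (E1 : (a - al * c)%C = mu).
  { apply Csub_zero. apply Cmult_zero_l with (b1 - al * b0)%C; auto.
    replace ((a - al * c - mu) * (b1 - al * b0))%C with
      ((a * b1 + (nu * al - a * al) * b0 - mu * b1) - al * (c * b1 + (nu - c * al) * b0 - mu * b0))%C by ring.
    rewrite <- Eb, <- Ed, B1, B2. ring. }
  assert (E2 : (b0 * a - b1 * c)%C = (nu * b0)%C).
  { replace (b1 * c)%C with (c * b1 + d * b0 - d * b0)%C by ring. rewrite B2, Ed, <- E1. ring. }
  split; auto. split; auto.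
  replace (b0 * b - b1 * d)%C with (al * (nu * b0 - (b0 * a - b1 * c)) - nu * b1)%C.
  rewrite E2. ring. rewrite Eb, Ed. ring.
Qed.

Lemma coord_lf a b c d al nu b0 b1 mu z :
  eigen a b c d al 1 nu -> eigen a b c d b1 b0 mu -> (b1 - al * b0)%C <> 0 -> nu <> 0 ->
  (c * z + d)%C <> 0 -> (b0 * z - b1)%C <> 0 ->
  coord al b0 b1 (lf a b c d z) = (mu / nu * coord al b0 b1 z)%C.
Proof.
  intros HA HB HD Hnu Hz Hb.
  destruct (eigen_pair_identities a b c d al nu b0 b1 mu HA HB HD) as (E1 & E2 & E3).
  destruct HA as [A1 A2].
  assert (N1 : (lf a b c d z - al)%C = (mu * (z - al) / (c * z + d))%C).
  { unfold lf. rewrite <- E1. apply Csub_zero.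
    replace ((a * z + b) / (c * z + d) - al - (a - al * c) * (z - al) / (c * z + d))%C
      with (((a * al + b * 1) - al * (c * al + d * 1)) / (c * z + d))%C by (field; auto).
    rewrite A1, A2. field. auto. }
  assert (N2 : (b0 * lf a b c d z - b1)%C = (nu * (b0 * z - b1) / (c * z + d))%C).
  { unfold lf. replace (b0 * ((a * z + b) / (c * z + d)) - b1)%C
      with (((b0 * a - b1 * c) * z + (b0 * b - b1 * d)) / (c * z + d))%C by (field; auto).
    rewrite E2, E3. field. auto. }
  unfold coord. rewrite N1, N2. field. auto.
Qed.

Lemma selfmap_iter a b c d k z : lf_selfmap a b c d -> in_disk z ->
  in_disk (Nat.iter k (lf a b c d) z).
Proof.
  intros [_ H] Hz. induction k as [|k IH]; auto. simpl. now apply H.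
Qed.

Lemma coord_denom_nz al b0 b1 z : (b1 - al * b0)%C <> 0 -> Cmod b0 <= Cmod b1 -> in_disk z ->
  (b0 * z - b1)%C <> 0.
Proof.
  intros HD Hb Hz E. apply Csub_zero in E. unfold in_disk in Hz.
  assert (Em : Cmod b0 * Cmod z = Cmod b1) by now rewrite <- Cmod_mult, E.
  assert (B0 := Cmod_ge_0 b0). assert (Z0 := Cmod_ge_0 z).
  assert (Cmod b0 = 0) by nra.
  assert (E0 : b0 = 0) by now apply Cmod_eq_0.
  apply HD. rewrite <- E, E0. ring.
Qed.

Lemma coord_iter a b c d al nu b0 b1 mu z k :
  lf_selfmap a b c d ->
  eigen a b c d al 1 nu -> eigen a b c d b1 b0 mu -> (b1 - al * b0)%C <> 0 -> nu <> 0 ->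
  Cmod b0 <= Cmod b1 -> in_disk z ->
  coord al b0 b1 (Nat.iter k (lf a b c d) z) = ((mu / nu) ^ k * coord al b0 b1 z)%C.
Proof.
  intros Hs HA HB HD Hnu Hb Hz. induction k as [|k IH]. simpl; ring.
  assert (Hk := selfmap_iter a b c d k z Hs Hz).
  simpl Nat.iter. rewrite (coord_lf a b c d al nu b0 b1 mu); auto.
  - rewrite IH. simpl. ring.
  - now apply Hs.
  - now apply (coord_denom_nz al).
Qed.

(* In the coordinate [u] the disk is [A - 2 Re (B u) + D |u|^2 < 0]. *)
Definition qform (al b0 b1 u : C) : R :=
  (Cmod al ^ 2 - 1) - 2 * Re ((Cconj al * b1 - b0) * u)%C + (Cmod b1 ^ 2 - Cmod b0 ^ 2) * Cmod u ^ 2.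

Lemma qform_alt al b0 b1 u :
  qform al b0 b1 u = Cmod (al - b1 * u) ^ 2 - Cmod (1 - b0 * u) ^ 2.
Proof.
  unfold qform. rewrite !Cmod2_alt. destruct al, b0, b1, u. simpl. ring.
Qed.

Lemma qform_coord al b0 b1 z : (b1 - al * b0)%C <> 0 -> (b0 * z - b1)%C <> 0 ->
  in_disk z -> qform al b0 b1 (coord al b0 b1 z) < 0.
Proof.
  intros HD Hb Hz. rewrite qform_alt.
  assert (E1 : (al - b1 * coord al b0 b1 z)%C = (- (b1 - al * b0) * z / (b0 * z - b1))%C).
  { unfold coord. field. auto. }
  assert (E2 : (1 - b0 * coord al b0 b1 z)%C = (- (b1 - al * b0) / (b0 * z - b1))%C).
  { unfold coord. field. auto. }
  rewrite E1, E2, !Cmod_div, Cmod_mult, !Cmod_opp by auto.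
  assert (D1 : 0 < Cmod (b1 - al * b0)) by now apply Cmod_gt_0.
  assert (D2 : 0 < Cmod (b0 * z - b1)) by now apply Cmod_gt_0.
  unfold in_disk in Hz. assert (Z0 := Cmod_ge_0 z).
  assert (Q : 0 < Cmod (b1 - al * b0) / Cmod (b0 * z - b1)) by now apply Rdiv_lt_0_compat.
  replace (Cmod (b1 - al * b0) * Cmod z / Cmod (b0 * z - b1))
    with (Cmod z * (Cmod (b1 - al * b0) / Cmod (b0 * z - b1))) by (field; lra).
  set (q := Cmod (b1 - al * b0) / Cmod (b0 * z - b1)) in *. 
  assert (0 < q * q) by nra. assert (Cmod z * Cmod z < 1) by nra.
  replace ((Cmod z * q) ^ 2 - q ^ 2) with (- (1 - Cmod z * Cmod z) * (q * q)) by ring. nra.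
Qed.

Lemma coord_surj al b0 b1 u : (b1 - al * b0)%C <> 0 -> qform al b0 b1 u < 0 ->
  exists z, in_disk z /\ coord al b0 b1 z = u.
Proof.
  intros HD Hq. rewrite qform_alt in Hq.
  assert (P1 := Cmod_ge_0 (al - b1 * u)). assert (P2 := Cmod_ge_0 (1 - b0 * u)).
  assert (Hn : 0 < Cmod (1 - b0 * u)) by nra. assert (Hn' := Hn). apply Cmod_gt_0 in Hn'.
  exists ((al - b1 * u) / (1 - b0 * u))%C. split.
  - unfold in_disk. rewrite Cmod_div by auto. apply Rmult_lt_reg_r with (Cmod (1 - b0 * u)); auto.
    unfold Rdiv. rewrite Rmult_assoc, Rinv_l; nra.
  - unfold coord.
    assert (HD2 : (al * b0 - b1)%C <> 0).
    { intros E. apply HD. replace (b1 - al * b0)%C with (- (al * b0 - b1))%C by ring. rewrite E. ring. }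
    assert (E2 : (b0 * ((al - b1 * u) / (1 - b0 * u)) - b1)%C = ((al * b0 - b1) / (1 - b0 * u))%C) by (field; auto).
    assert (E1 : ((al - b1 * u) / (1 - b0 * u) - al)%C = ((al * b0 - b1) * u / (1 - b0 * u))%C) by (field; auto).
    rewrite E1, E2. field. auto.
Qed.

(** With both fixed points outside the open disk the constant and quadratic terms of the form are
    nonnegative, so the linear term must make it negative. *)
Lemma qform_Re_pos al b0 b1 u : 1 <= Cmod al -> Cmod b0 <= Cmod b1 -> qform al b0 b1 u < 0 ->
  0 < Re ((Cconj al * b1 - b0) * u)%C.
Proof.
  intros Ha Hb Hq. unfold qform in Hq.
  assert (0 <= (Cmod b1 ^ 2 - Cmod b0 ^ 2) * Cmod u ^ 2).
  { apply Rmult_le_pos. generalize (Cmod_ge_0 b0). nra. apply pow2_ge_0. }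
  nra.
Qed.

Lemma positive_multiplier (k : C) :
  (forall v, 0 < Re v -> 0 < Re (k * v)%C) -> 0 < Re k /\ Im k = 0.
Proof.
  intros H. assert (H1 := H 1 ltac:(simpl; lra)).
  replace (k * 1)%C with k in H1 by ring. split; auto.
  destruct (Req_dec (Im k) 0) as [E|E]; auto. exfalso.
  (* If Im k were nonzero, this v of real part 1 would be sent to a point of real part -1. *)
  specialize (H (1, (Re k + 1) / Im k)). simpl in H. specialize (H ltac:(lra)).
  fold (Re k) (Im k) in H.
  replace (Re k * 1 - Im k * ((Re k + 1) / Im k)) with (-1) in H by (field; auto). lra.
Qed.

(** As |al| = 1, the image of the disk in the coordinate u is the half-plane Re (B u) > 0 or a disk
    tangent to its boundary at 0, so every u of the half-plane enters it after scaling by a small t.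
    Multiplication by mu / nu commutes with this scaling and therefore preserves the half-plane,
    which forces it to be positive. *)
Lemma eigen_multiplier_pos a b c d al nu b0 b1 mu :
  lf_selfmap a b c d ->
  eigen a b c d al 1 nu -> eigen a b c d b1 b0 mu -> (b1 - al * b0)%C <> 0 -> nu <> 0 ->
  Cmod b0 <= Cmod b1 -> Cmod al = 1 -> (Cconj al * b1 - b0)%C <> 0 ->
  0 < Re (mu / nu)%C /\ Im (mu / nu)%C = 0.
Proof.
  intros Hs HA HB HD Hnu Hb Ha HB0. apply positive_multiplier. intros v Hv.
  set (B := (Cconj al * b1 - b0)%C) in *. set (Q := Cmod b1 ^ 2 - Cmod b0 ^ 2).
  assert (HQ : 0 <= Q). { unfold Q. generalize (Cmod_ge_0 b0). nra. }
  set (t := Re v / (Q * Cmod (v / B) ^ 2 + 1)).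
  assert (Hd : 0 <= Q * Cmod (v / B) ^ 2) by (apply Rmult_le_pos; auto; apply pow2_ge_0).
  assert (Ht : 0 < t) by (apply Rdiv_lt_0_compat; lra).
  assert (Et : t * (Q * Cmod (v / B) ^ 2 + 1) = Re v) by (unfold t; field; lra).
  destruct (coord_surj al b0 b1 (RtoC t * (v / B))%C HD) as (z & Hz & Ez).
  { unfold qform. fold B Q. rewrite Ha.
    replace (B * (RtoC t * (v / B)))%C with (RtoC t * v)%C by (field; auto).
    replace (Re (RtoC t * v)%C) with (t * Re v) by (destruct v; simpl; ring).
    rewrite Cmod_mult, Cmod_R, Rabs_pos_eq by lra. 
    replace (1 ^ 2 - 1 - 2 * (t * Re v) + Q * (t * Cmod (v / B)) ^ 2)
      with (t * (t * (Q * Cmod (v / B) ^ 2) - 2 * Re v)) by ring.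
    nra. }
  assert (Hz2 := proj2 (proj2 Hs z Hz)).
  assert (K := qform_coord al b0 b1 _ HD (coord_denom_nz al b0 b1 _ HD Hb Hz2) Hz2).
  rewrite (coord_lf a b c d al nu b0 b1 mu) in K; auto.
  2: now apply Hs. 2: now apply (coord_denom_nz al).
  rewrite Ez in K. apply qform_Re_pos in K; auto; [|lra]. fold B in K.
  replace (B * (mu / nu * (RtoC t * (v / B))))%C with (RtoC t * (mu / nu * v))%C in K by (field; auto).
  replace (Re (RtoC t * (mu / nu * v))%C) with (t * Re (mu / nu * v)%C) in K
    by (destruct (mu / nu * v)%C; simpl; ring).
  nra.
Qed.

(** All estimates come from |1 + y|^2 >= 1 + |y|^2 and 1 - 1 / (1 + y) = y / (1 + y). The value s =
    1 / (1 + y) is near 1 where y is small and near 0 where y is large. *)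
Lemma cayley_bounds (y : C) : 0 < Re y ->
  (1 + y)%C <> 0 /\
  Cmod (/ (1 + y)) ^ 2 * (1 + Cmod y ^ 2) <= 1 /\
  Cmod (1 - / (1 + y)) ^ 2 * (1 + Cmod y ^ 2) <= Cmod y ^ 2 /\
  Cmod (/ (1 + y)) <= 1 /\ Cmod (1 - / (1 + y)) <= 1 /\
  Cmod (/ (1 + y)) * Cmod y <= 1 /\ Cmod (1 - / (1 + y)) <= Cmod y.
Proof.
  intros Hy.
  assert (E : Cmod (1 + y) ^ 2 = 1 + 2 * Re y + Cmod y ^ 2).
  { rewrite !Cmod2_alt. destruct y. simpl. ring. }
  assert (Y0 := Cmod_ge_0 y). assert (P0 := Cmod_ge_0 (1 + y)).
  assert (Hm : 1 < Cmod (1 + y)) by nra.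
  assert (Hn : (1 + y)%C <> 0) by (apply nz_of_Cmod; lra).
  assert (E2 : (1 - / (1 + y))%C = (y * / (1 + y))%C) by (field; auto).
  rewrite E2, Cmod_mult, Cmod_inv by auto.
  set (m := Cmod (1 + y)) in *. set (x := Cmod y) in *.
  assert (Hi : 0 < / m) by (apply Rinv_0_lt_compat; lra).
  assert (Hi1 : / m * m = 1) by (apply Rinv_l; lra).
  set (i := / m) in *.
  assert (Hxm : x <= m) by nra.
  assert (Q : i ^ 2 * (1 + x ^ 2) <= 1).
  { apply Rle_trans with (i ^ 2 * m ^ 2). apply Rmult_le_compat_l. apply pow2_ge_0. lra.
    rewrite <- Rpow_mult_distr, Hi1. lra. }
  split; auto. split; auto. split.
  { replace ((x * i) ^ 2 * (1 + x ^ 2)) with (x ^ 2 * (i ^ 2 * (1 + x ^ 2))) by ring.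
    rewrite <- (Rmult_1_r (x ^ 2)) at 3. apply Rmult_le_compat_l; auto. apply pow2_ge_0. }
  assert (Hile : i <= 1) by nra.
  repeat split; nra.
Qed.

(** Two Moebius functions with the common pole 1 / g are affine functions of each other; e1 + e0 g
    <> 0 says that (e1 z + e0) / (1 - g z) is not constant. *)
Lemma affine_blaschke (g e0 e1 z : C) : Cmod g < 1 -> in_disk z -> (e1 + e0 * g)%C <> 0 ->
  blaschke g z = ((1 - g * Cconj g) / (e1 + e0 * g) * ((e1 * z + e0) / (1 - g * z))
                  + (- Cconj g - (1 - g * Cconj g) / (e1 + e0 * g) * e0))%C.
Proof.
  intros Hg Hz He. unfold in_disk in Hz. assert (Hn := one_minus_nz g z Hg ltac:(lra)).
  unfold blaschke. field. auto.
Qed.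

(** [bs] is the radial projection onto the circle of the pole b1 / b0. The pole is at distance |b1 /
    b0| - 1 from it, no more than from z, so being dl away from [bs] means being dl / 2 away from
    the pole. For b0 = 0 the pole is infinity and any point of the circle serves. *)
Lemma unit_denom_bound (b0 b1 : C) : Cmod b0 <= Cmod b1 -> b1 <> 0 -> exists bs, Cmod bs = 1 /\
  forall dl, 0 < dl -> exists m, 0 < m /\ forall z, away_from bs dl z -> m <= Cmod (b0 * z - b1).
Proof.
  intros Hb Hb1. assert (P1 : 0 < Cmod b1) by now apply Cmod_gt_0.
  destruct (Ceq_dec b0 0) as [->|Hb0].
  - exists 1. split. apply Cmod_1. intros dl Hd. exists (Cmod b1). split; auto.
    intros z _. replace (0 * z - b1)%C with (- b1)%C by ring. rewrite Cmod_opp. lra.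
  - assert (P0 : 0 < Cmod b0) by now apply Cmod_gt_0.
    set (be := (b1 / b0)%C).
    assert (Hbe : 1 <= Cmod be).
    { unfold be. rewrite Cmod_div by auto. apply Rmult_le_reg_r with (Cmod b0); auto.
      unfold Rdiv. rewrite Rmult_assoc, Rinv_l; lra. }
    assert (Hr : RtoC (Cmod be) <> 0). { apply nz_of_Cmod. rewrite Cmod_R, Rabs_pos_eq; lra. }
    exists (be / RtoC (Cmod be))%C. split.
    + rewrite Cmod_div, Cmod_R, Rabs_pos_eq by (auto; lra). field. lra.
    + intros dl Hd. exists (Cmod b0 * (dl / 2)). split. { apply Rmult_lt_0_compat; lra. }
      intros z [Hz Hzd]. unfold in_disk in Hz.
      replace (b0 * z - b1)%C with (b0 * (z - be))%C by (unfold be; field; auto).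
      rewrite Cmod_mult. apply Rmult_le_compat_l. lra.
      assert (T1 := Cmod_triangle_rev be z). rewrite Cmod_sub_sym in T1.
      assert (T2 : Cmod (z - be / RtoC (Cmod be)) <= Cmod (z - be) + (Cmod be - 1)).
      { replace (z - be / RtoC (Cmod be))%C with ((z - be) + RtoC (Cmod be - 1) * (be / RtoC (Cmod be)))%C.
        2:{ rewrite RtoC_minus. field. auto. }
        eapply Rle_trans. apply Cmod_triangle. apply Rplus_le_compat_l.
        rewrite Cmod_mult, Cmod_div, !Cmod_R, !Rabs_pos_eq by (auto; lra). right. field. lra. }
      lra.
Qed.

Lemma frac_lt_1 x : 0 <= x -> 0 <= x / (1 + x) < 1.
Proof.
  intros Hx. split. apply Rmult_le_pos; auto. apply Rlt_le, Rinv_0_lt_compat; lra.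
  apply Rmult_lt_reg_r with (1 + x). lra. unfold Rdiv. rewrite Rmult_assoc, Rinv_l; lra.
Qed.

(** Here [a0] is the only boundary point at which y may be unbounded; elsewhere s stays away from 0
    in the sense that |1 - s| < 1 uniformly. The next lemma is the counterpart for zeros of y. *)
Lemma cayley_away_infinity (y : C -> C) a0 : (forall z, in_disk z -> 0 < Re (y z)) ->
  (forall dl, 0 < dl -> exists Y, forall z, away_from a0 dl z -> Cmod (y z) <= Y) ->
  forall dl, 0 < dl -> exists q, 0 <= q < 1 /\
    forall z, away_from a0 dl z -> Cmod (1 - / (1 + y z)) ^ 2 <= q.
Proof.
  intros Hy Hup dl Hd. destruct (Hup dl Hd) as (Y & HYz). exists (Y ^ 2 / (1 + Y ^ 2)).
  split. apply frac_lt_1, pow2_ge_0. intros z Hz.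
  destruct (cayley_bounds (y z) (Hy z (proj1 Hz))) as (_ & _ & Q & _).
  assert (P := pow2_ge_0 Y). assert (Px := pow2_ge_0 (Cmod (y z))).
  assert (HY2 : Cmod (y z) ^ 2 <= Y ^ 2) by (apply pow_incr; split; auto; apply Cmod_ge_0).
  apply Rmult_le_reg_r with (1 + Y ^ 2). lra. unfold Rdiv. rewrite Rmult_assoc, Rinv_l by lra.
  assert (W0 := pow2_ge_0 (Cmod (1 - / (1 + y z)))). nra.
Qed.

Lemma cayley_away_zero (y : C -> C) a1 : (forall z, in_disk z -> 0 < Re (y z)) ->
  (forall dl, 0 < dl -> exists m, 0 < m /\ forall z, away_from a1 dl z -> m <= Cmod (y z)) ->
  forall dl, 0 < dl -> exists q, 0 <= q < 1 /\
    forall z, away_from a1 dl z -> Cmod (/ (1 + y z)) ^ 2 <= q.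
Proof.
  intros Hy Hlo dl Hd. destruct (Hlo dl Hd) as (m & Hm & Hmz). exists (1 / (1 + m ^ 2)).
  assert (M2 : 0 < m ^ 2) by now apply pow_lt.
  split. { split. apply Rlt_le, Rdiv_lt_0_compat; lra. apply Rmult_lt_reg_r with (1 + m ^ 2). lra.
    unfold Rdiv. rewrite Rmult_assoc, Rinv_l; lra. }
  intros z Hz. destruct (cayley_bounds (y z) (Hy z (proj1 Hz))) as (_ & Q & _).
  specialize (Hmz z Hz). assert (HY2 : m ^ 2 <= Cmod (y z) ^ 2) by (apply pow_incr; lra).
  apply Rmult_le_reg_r with (1 + m ^ 2). lra. unfold Rdiv. rewrite Rmult_assoc, Rinv_l by lra.
  assert (W0 := pow2_ge_0 (Cmod (/ (1 + y z)))). nra.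
Qed.

Lemma hyperbolic_recurrent a b c d al nu b0 b1 mu :
  lf_selfmap a b c d ->
  eigen a b c d al 1 nu -> eigen a b c d b1 b0 mu -> (b1 - al * b0)%C <> 0 -> nu <> 0 ->
  Cmod b0 <= Cmod b1 -> Cmod al = 1 -> Cmod (mu / nu) < 1 ->
  recurrent (comp_op (lf a b c d)).
Proof.
  intros Hs HA HB HD Hnu Hb Ha Hk1.
  set (B := (Cconj al * b1 - b0)%C). set (y := fun z => (B * coord al b0 b1 z)%C).
  assert (Hden : forall z, in_disk z -> (b0 * z - b1)%C <> 0).
  { intros z Hz. now apply (coord_denom_nz al). }
  assert (Hy : forall z, in_disk z -> 0 < Re (y z)).
  { intros z Hz. apply qform_Re_pos; auto. lra. apply qform_coord; auto. }
  assert (Z0 : in_disk 0) by (unfold in_disk; rewrite Cmod_0; lra).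
  assert (HBn : B <> 0).
  { intros E. specialize (Hy 0 Z0). unfold y in Hy. rewrite E, Cmult_0_l in Hy. simpl in Hy. lra. }
  assert (PB : 0 < Cmod B) by now apply Cmod_gt_0.
  destruct (eigen_multiplier_pos a b c d al nu b0 b1 mu) as [Kp Ki]; auto.
  set (k := Re (mu / nu)%C) in *.
  assert (Ek : (mu / nu)%C = RtoC k).
  { rewrite (surjective_pairing (mu / nu)%C). unfold RtoC. f_equal. exact Ki. }
  rewrite Ek, Cmod_R, Rabs_pos_eq in Hk1 by lra.
  assert (Hb1 : b1 <> 0). { intros E. apply (Hden 0 Z0). rewrite E. ring. }
  assert (Hyt : forall t z, 0 < t -> in_disk z -> 0 < Re (RtoC t * y z)%C).
  { intros t z Ht Hz. specialize (Hy z Hz). destruct (y z) as [y1 y2]. simpl in *. nra. }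
  set (S := fun (t : R) z => (/ (1 + RtoC t * y z))%C).
  assert (Hyh : holo y).
  { apply (holo_mult (fun _ => B)). apply holo_const.
    apply (holo_mult (fun z => z - al)%C (fun z => / (b0 * z - b1))%C).
    apply holo_minus. apply holo_id. apply holo_const.
    apply (holo_inv (fun z => b0 * z - b1)%C); auto.
    apply holo_minus. apply (holo_mult (fun _ => b0)). apply holo_const. apply holo_id. apply holo_const. }
  assert (HSh : forall t, 0 < t -> holo (S t)).
  { intros t Ht. apply (holo_inv (fun z => 1 + RtoC t * y z)%C).
    - apply (holo_plus (fun _ => RtoC 1)). apply holo_const. apply (holo_mult (fun _ => RtoC t)); auto. apply holo_const.
    - intros z Hz. now apply cayley_bounds, Hyt. }
  assert (Kn : forall n, 0 < k ^ n) by (intros; now apply pow_lt).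
  assert (Kin : forall n, 0 < (/ k) ^ n) by (intros; apply pow_lt; now apply Rinv_0_lt_compat).
  assert (Hyi : forall n z, in_disk z -> y (Nat.iter n (lf a b c d) z) = (RtoC (k ^ n) * y z)%C).
  { intros n z Hz. unfold y. rewrite (coord_iter a b c d al nu b0 b1 mu) by auto.
    rewrite Ek, RtoC_pow. ring. }
  assert (Hymod : forall z, in_disk z -> Cmod (y z) = Cmod B * (Cmod (z - al) / Cmod (b0 * z - b1))).
  { intros z Hz. unfold y, coord. rewrite Cmod_mult, Cmod_div; auto. }
  destruct (unit_denom_bound b0 b1 Hb Hb1) as (bs & Hbs & Hlow).
  assert (Hup : forall dl, 0 < dl -> exists Y, 0 < Y /\ forall z, away_from bs dl z -> Cmod (y z) <= Y).
  { intros dl Hd. destruct (Hlow dl Hd) as (m & Hm & Hmz). exists (Cmod B * (2 / m)). split.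
    { apply Rmult_lt_0_compat; auto. apply Rdiv_lt_0_compat; lra. }
    intros z Hz. rewrite Hymod by apply Hz. apply Rmult_le_compat_l. lra.
    specialize (Hmz z Hz). unfold Rdiv. apply Rmult_le_compat.
    apply Cmod_ge_0. apply Rlt_le, Rinv_0_lt_compat; lra.
    destruct Hz as [Hz _]. unfold in_disk in Hz. eapply Rle_trans. apply Cmod_triangle_sub. lra.
    apply Rinv_le_contravar; auto. }
  assert (Hlo : forall dl, 0 < dl -> exists m, 0 < m /\ forall z, away_from al dl z -> m <= Cmod (y z)).
  { intros dl Hd. assert (B0 := Cmod_ge_0 b0). assert (B1 : 0 < Cmod b1) by now apply Cmod_gt_0.
    exists (Cmod B * (dl / (Cmod b0 + Cmod b1))). split.
    { apply Rmult_lt_0_compat; auto. apply Rdiv_lt_0_compat; lra. }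
    intros z Hz. rewrite Hymod by apply Hz. apply Rmult_le_compat_l. lra.
    destruct Hz as [Hz Hzd]. unfold in_disk in Hz.
    unfold Rdiv. apply Rmult_le_compat; auto. lra. apply Rlt_le, Rinv_0_lt_compat; lra.
    apply Rinv_le_contravar. apply Cmod_gt_0; auto.
    eapply Rle_trans. apply Cmod_triangle_sub. rewrite Cmod_mult. nra. }
  (* For |al| = 1 one finds 1 + y = (conj al b1 z - D0) / (b0 z - b1), so s = 1 / (1 + y) has its
     pole at 1 / g with g = conj al b1 / D0; [e0] and [e1] are the coefficients of its numerator. *)
  set (D0 := (2 * b1 - b0 * al)%C).
  assert (Hal : (al * Cconj al)%C = 1).
  { rewrite <- Cmod2_conj, Ha. f_equal. ring. }
  (* Written as |b1|^2 plus nonnegative terms, one of them positive since the fixed points differ;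
     hence |g| < 1. *)
  assert (HD0 : Cmod D0 ^ 2 = Cmod b1 ^ 2 + 2 * Cmod (b1 - al * b0) ^ 2 + (Cmod b1 ^ 2 - Cmod b0 ^ 2)).
  { unfold D0. assert (Hal' : Cmod al ^ 2 = 1) by (rewrite Ha; ring).
    apply Rplus_eq_reg_r with ((1 - Cmod al ^ 2) * Cmod b0 ^ 2).
    rewrite Hal' at 1. rewrite !Cmod2_alt in *. destruct al as [x1 x2], b0 as [p1 p2], b1 as [q1 q2].
    simpl in *. nra. }
  assert (PD : 0 < Cmod (b1 - al * b0)) by now apply Cmod_gt_0.
  assert (HD0gt : Cmod b1 < Cmod D0).
  { assert (X0 := Cmod_ge_0 b0). assert (X1 := Cmod_ge_0 b1). assert (X2 := Cmod_ge_0 D0). nra. }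
  assert (X1 := Cmod_ge_0 b1).
  assert (HD0n : D0 <> 0) by (apply nz_of_Cmod; lra).
  set (g := (Cconj al * b1 / D0)%C).
  assert (Hg : Cmod g < 1).
  { unfold g. rewrite Cmod_div, Cmod_mult, Cmod_conj, Ha by auto.
    apply Rmult_lt_reg_r with (Cmod D0). lra. unfold Rdiv. rewrite Rmult_assoc, Rinv_l; lra. }
  set (e0 := (b1 / D0)%C). set (e1 := (- b0 / D0)%C).
  (* By |al| = 1 this number is conj al (b1 - al b0)^2 / D0^2: s is not constant because the fixed
     points differ. *)
  assert (He : (e1 + e0 * g)%C <> 0).
  { assert (Q : (e1 + e0 * g)%C = (Cconj al * ((b1 - al * b0) * (b1 - al * b0)) / (D0 * D0))%C).
    { replace (Cconj al * ((b1 - al * b0) * (b1 - al * b0)))%C with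
       (Cconj al * b1 * b1 - 2 * (al * Cconj al) * b1 * b0 + (al * Cconj al) * al * b0 * b0)%C by ring.
      rewrite Hal. unfold e1, e0, g.
      replace (- b0 / D0 + b1 / D0 * (Cconj al * b1 / D0))%C
        with ((- b0 * D0 + b1 * Cconj al * b1) / (D0 * D0))%C by (field; auto).
      f_equal. unfold D0. ring. }
    rewrite Q. assert (Hca : Cconj al <> 0). { apply nz_of_Cmod. rewrite Cmod_conj. lra. }
    apply Cmult_neq_0. apply Cmult_neq_0; auto. now apply Cmult_neq_0.
    apply nz_of_Cmod. rewrite Cmod_inv by now apply Cmult_neq_0.
    apply Rinv_0_lt_compat. apply Cmod_gt_0. now apply Cmult_neq_0. }
  assert (HS1 : forall z, in_disk z -> S 1 z = ((e1 * z + e0) / (1 - g * z))%C).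
  { intros z Hz. assert (Hz' := Hz). unfold in_disk in Hz'.
    assert (N1 := one_minus_nz g z Hg ltac:(lra)). assert (N2 := Hden z Hz).
    assert (N3 : (D0 - Cconj al * b1 * z)%C <> 0).
    { intros E. apply N1. replace (1 - g * z)%C with ((D0 - Cconj al * b1 * z) / D0)%C.
      rewrite E. unfold Cdiv. ring. unfold g. field. auto. }
    assert (E1 : (1 + RtoC 1 * y z)%C = ((Cconj al * b1 * z - D0) / (b0 * z - b1))%C).
    { unfold y, coord, B. apply Csub_zero.
      replace (1 + 1 * ((Cconj al * b1 - b0) * ((z - al) / (b0 * z - b1))) - (Cconj al * b1 * z - D0) / (b0 * z - b1))%C
       with ((D0 - b1 - (al * Cconj al) * b1 + b0 * al) / (b0 * z - b1))%C by (field; auto).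
      rewrite Hal. unfold D0. field. auto. }
    unfold S. rewrite E1. unfold e0, e1, g. field.
    repeat split; auto.
    intros E. apply N3. replace (D0 - Cconj al * b1 * z)%C with (- (Cconj al * b1 * z - D0))%C by ring. rewrite E. ring. }
  (* y can be unbounded only near [bs] and small only near [al]. Forward, k^n y -> 0 and s -> 1 away
     from [bs]; backward, k^(-n) y -> infinity and s -> 0 away from [al]. *)
  apply (recurrent_escape (lf a b c d) g ((1 - g * Cconj g) / (e1 + e0 * g))%C
     (- Cconj g - (1 - g * Cconj g) / (e1 + e0 * g) * e0)%C
     (S 1) (fun n => S (k ^ n)) (fun n => S ((/ k) ^ n)) bs al bs al 1 0); auto.
  - apply HSh. lra.
  - intros z Hz. rewrite HS1 by auto. now apply affine_blaschke.
  - intros z Hz. assert (Q := cayley_bounds (RtoC 1 * y z) (Hyt 1 z ltac:(lra) Hz)). unfold S; tauto.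
  - intros n z Hz. split.
    + assert (Q := cayley_bounds _ (Hyt (k ^ n) z (Kn n) Hz)). unfold S; tauto.
    + assert (Q := cayley_bounds _ (Hyt ((/ k) ^ n) z (Kin n) Hz)). unfold S; tauto.
  - intros n z Hz. unfold S. rewrite Hyi by auto. split; f_equal; f_equal.
    + ring.
    + rewrite Cmult_assoc, <- RtoC_mult, <- Rpow_mult_distr, Rinv_l, pow1 by lra. reflexivity.
  - apply (cayley_away_infinity (fun z => RtoC 1 * y z)%C). { intros z Hz. apply Hyt; auto. lra. }
    intros dl Hd. destruct (Hup dl Hd) as (Y & _ & HYz). exists Y. intros z Hz. rewrite Cmult_1_l. auto.
  - apply (cayley_away_zero (fun z => RtoC 1 * y z)%C). { intros z Hz. apply Hyt; auto. lra. }
    intros dl Hd. destruct (Hlo dl Hd) as (m & Hm & Hmz). exists m. split; auto.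
    intros z Hz. rewrite Cmult_1_l. auto.
  - intros dl eps Hd He'. destruct (Hup dl Hd) as (Y & HY & HYz).
    destruct (pow_small k (eps / Y)) as [n0 Hn0]; try lra. now apply Rdiv_lt_0_compat.
    exists n0. intros n z Hn Hz. specialize (Hn0 n Hn). specialize (HYz z Hz).
    assert (Q := cayley_bounds _ (Hyt (k ^ n) z (Kn n) (proj1 Hz))).
    destruct Q as (_ & _ & _ & _ & _ & _ & Q). rewrite Cmod_sub_sym. unfold S.
    eapply Rle_trans. exact Q. rewrite Cmod_mult, Cmod_R, Rabs_pos_eq by (apply Rlt_le, Kn).
    apply Rle_trans with (eps / Y * Y); [|right; field; lra].
    apply Rmult_le_compat; try lra. apply Rlt_le, Kn. apply Cmod_ge_0.
  - intros dl eps Hd He'. destruct (Hlo dl Hd) as (m & Hm & Hmz).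
    destruct (pow_small k (eps * m)) as [n0 Hn0]; try lra. now apply Rmult_lt_0_compat.
    exists n0. intros n z Hn Hz. specialize (Hn0 n Hn). specialize (Hmz z Hz).
    assert (Q := cayley_bounds _ (Hyt ((/ k) ^ n) z (Kin n) (proj1 Hz))).
    destruct Q as (_ & _ & _ & _ & _ & Q & _). unfold S.
    rewrite Cmod_mult, Cmod_R, Rabs_pos_eq in Q by (apply Rlt_le, Kin).
    rewrite pow_inv in Q. specialize (Kn n). rewrite pow_inv.
    match goal with |- Cmod (?u - RtoC 0)%C <= _ => replace (u - 0)%C with u by ring; set (W := Cmod u) in * end.
    change (W * (/ k ^ n * Cmod (y z)) <= 1) in Q.
    assert (W0 : 0 <= W) by apply Cmod_ge_0.
    assert (Q2 : W * Cmod (y z) <= k ^ n).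
    { apply (Rmult_le_compat_l (k ^ n)) in Q; [|lra].
      replace (k ^ n * (W * (/ k ^ n * Cmod (y z)))) with (W * Cmod (y z)) in Q by (field; lra). lra. }
    assert (W * m <= eps * m) by nra. now apply Rmult_le_reg_r with m.
Qed.

(** * Parabolic automorphisms *)

Lemma Re_plus (x y : C) : Re (x + y) = Re x + Re y.
Proof. reflexivity. Qed.

Lemma Re_RtoC (x : R) : Re (RtoC x) = x.
Proof. reflexivity. Qed.

(* Maps the disk onto the right half-plane and [al] to infinity, when [|al| = 1]. *)
Definition half_plane_coord (al z : C) : C := (- (2 * al) / (z - al) - 1)%C.

Lemma unit_sub_nz (al z : C) : Cmod al = 1 -> in_disk z -> (z - al)%C <> 0.
Proof. intros Ha Hz. apply Csub_nz. intros ->. unfold in_disk in Hz. lra. Qed.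

(** The real part is the Poisson kernel (1 - |z|^2) / |z - al|^2. *)
Lemma half_plane_coord_Re al z : Cmod al = 1 -> in_disk z -> 0 < Re (half_plane_coord al z).
Proof.
  intros Ha Hz. assert (Hn := unit_sub_nz al z Ha Hz).
  assert (Hd : 0 < Cmod (z - al) ^ 2) by (apply pow_lt; now apply Cmod_gt_0).
  assert (E : Re (half_plane_coord al z) * Cmod (z - al) ^ 2 = Cmod al ^ 2 - Cmod z ^ 2).
  { unfold half_plane_coord.
    replace (- (2 * al) / (z - al) - 1)%C with (RtoC (/ Cmod (z - al) ^ 2) * (- (z + al) * Cconj (z - al)))%C.
    - rewrite !Cmod2_alt in *. destruct al as [x1 x2], z as [z1 z2]. simpl in *. field.
      intros F. apply (Rlt_irrefl 0). eapply Rlt_le_trans. exact Hd. right. rewrite <- F. ring.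
    - rewrite RtoC_inv by lra. rewrite Cmod2_conj. field. split; auto.
      intros F. apply Hn. rewrite <- (Cconj_conj (z - al)), F. unfold Cconj, RtoC; simpl. f_equal; ring. }
  rewrite Ha in E. unfold in_disk in Hz. assert (Z0 := Cmod_ge_0 z).
  assert (0 < Re (half_plane_coord al z) * Cmod (z - al) ^ 2) by (rewrite E; nra).
  nra.
Qed.

Lemma half_plane_coord_surj al X : Cmod al = 1 -> 0 < Re X ->
  exists z, in_disk z /\ half_plane_coord al z = X.
Proof.
  intros Ha HX. assert (Hal : al <> 0) by (apply nz_of_Cmod; lra).
  assert (E : Cmod (X + 1) ^ 2 - Cmod (X - 1) ^ 2 = 4 * Re X).
  { rewrite !Cmod2_alt. destruct X. simpl. ring. }
  assert (P1 := Cmod_ge_0 (X + 1)). assert (P2 := Cmod_ge_0 (X - 1)).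
  assert (Hn : 0 < Cmod (X + 1)) by nra. assert (Hn' := Hn). apply Cmod_gt_0 in Hn'.
  exists (al * (X - 1) / (X + 1))%C. split.
  - unfold in_disk. rewrite Cmod_div, Cmod_mult, Ha by auto. rewrite Rmult_1_l.
    apply Rmult_lt_reg_r with (Cmod (X + 1)); auto. unfold Rdiv. rewrite Rmult_assoc, Rinv_l; nra.
  - unfold half_plane_coord.
    replace (al * (X - 1) / (X + 1) - al)%C with (- (2 * al) / (X + 1))%C by (field; auto).
    field. auto.
Qed.

Lemma half_plane_coord_inj al z w : Cmod al = 1 -> in_disk z -> in_disk w ->
  half_plane_coord al z = half_plane_coord al w -> z = w.
Proof.
  intros Ha Hz Hw E. assert (Nz := unit_sub_nz al z Ha Hz). assert (Nw := unit_sub_nz al w Ha Hw).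
  assert (Hal : al <> 0) by (apply nz_of_Cmod; lra).
  apply Csub_zero. apply Cmult_zero_l with (2 * al / ((z - al) * (w - al)))%C.
  - replace ((z - w) * (2 * al / ((z - al) * (w - al))))%C
      with (half_plane_coord al z - half_plane_coord al w)%C by (unfold half_plane_coord; field; auto).
    rewrite E. ring.
  - apply Cmult_neq_0.
    + apply Cmult_neq_0; auto. apply nz_of_Cmod. rewrite Cmod_R, Rabs_pos_eq; lra.
    + apply nz_of_Cmod. assert (N := Cmult_neq_0 _ _ Nz Nw). rewrite Cmod_inv by auto.
      apply Rinv_0_lt_compat. now apply Cmod_gt_0.
Qed.

Definition translation (al c nu : C) : C := (- (2 * al) * c / nu)%C.

(** The trace condition says that nu is a double eigenvalue. With the eigenvector (al, 1) it
    determines a, b and d from c, al and nu, and then 1 / (z - al) is shifted by c / nu. *)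
Lemma half_plane_coord_lf a b c d al nu z :
  lf_selfmap a b c d -> eigen a b c d al 1 nu -> nu <> 0 -> (a + d)%C = (2 * nu)%C ->
  Cmod al = 1 -> in_disk z ->
  half_plane_coord al (lf a b c d z) = (half_plane_coord al z + translation al c nu)%C.
Proof.
  intros Hs [A1 A2] Hnu Htr Ha Hz.
  assert (Hcd := proj1 (proj2 Hs z Hz)). assert (Nz := unit_sub_nz al z Ha Hz).
  assert (Ed : d = (nu - c * al)%C).
  { replace nu with (nu * 1)%C by ring. rewrite <- A2. ring. }
  assert (Ea : a = (nu + c * al)%C).
  { replace a with (a + d - d)%C by ring. rewrite Htr, Ed. ring. }
  assert (Eb : b = (- (c * al * al))%C).
  { replace b with ((a * al + b * 1) - a * al)%C by ring. rewrite A1, Ea. ring. }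
  assert (E : (lf a b c d z - al)%C = (nu * (z - al) / (c * z + d))%C).
  { unfold lf. replace ((a * z + b) / (c * z + d) - al)%C
      with ((a * z + b - al * (c * z + d)) / (c * z + d))%C by (field; auto).
    f_equal. rewrite Ea, Eb, Ed. ring. }
  unfold half_plane_coord, translation. rewrite E.
  replace (- (2 * al) / (nu * (z - al) / (c * z + d)))%C
    with (- (2 * al) * (c * z + d) / (nu * (z - al)))%C by (field; auto).
  rewrite Ed. field. auto.
Qed.

Lemma half_plane_coord_iter a b c d al nu z n :
  lf_selfmap a b c d -> eigen a b c d al 1 nu -> nu <> 0 -> (a + d)%C = (2 * nu)%C ->
  Cmod al = 1 -> in_disk z ->
  half_plane_coord al (Nat.iter n (lf a b c d) z)
    = (half_plane_coord al z + RtoC (INR n) * translation al c nu)%C.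
Proof.
  intros Hs HA Hnu Htr Ha Hz. induction n as [|n IH].
  - simpl. ring.
  - simpl Nat.iter. rewrite (half_plane_coord_lf a b c d al nu) by (auto; now apply selfmap_iter).
    rewrite IH, S_INR, RtoC_plus. ring.
Qed.

Lemma translation_Re_nonneg a b c d al nu :
  lf_selfmap a b c d -> eigen a b c d al 1 nu -> nu <> 0 -> (a + d)%C = (2 * nu)%C ->
  Cmod al = 1 -> 0 <= Re (translation al c nu).
Proof.
  intros Hs HA Hnu Htr Ha. apply Rnot_lt_le. intros Hneg.
  set (w := translation al c nu) in *.
  destruct (half_plane_coord_surj al (RtoC (- Re w / 2)) Ha) as (z & Hz & Ez). { rewrite Re_RtoC. lra. }
  assert (P := half_plane_coord_Re al _ Ha (proj2 (proj2 Hs z Hz))).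
  rewrite (half_plane_coord_lf a b c d al nu), Ez in P by auto. fold w in P.
  rewrite Re_plus in P. rewrite Re_RtoC in P. lra.
Qed.

(** The translation maps the half-plane onto {Re > Re w}; when Re w > 0 the point Re w / 2 is
    missed. *)
Lemma translation_automorphism a b c d al nu :
  lf_selfmap a b c d -> eigen a b c d al 1 nu -> nu <> 0 -> (a + d)%C = (2 * nu)%C ->
  Cmod al = 1 -> (lf_automorphism a b c d <-> Re (translation al c nu) = 0).
Proof.
  intros Hs HA Hnu Htr Ha.
  assert (Hnn := translation_Re_nonneg a b c d al nu Hs HA Hnu Htr Ha).
  set (w := translation al c nu) in *. split.
  - intros [_ Hsurj]. apply Rle_antisym; auto. apply Rnot_lt_le. intros Hp.
    destruct (half_plane_coord_surj al (RtoC (Re w / 2)) Ha) as (u & Hu & Eu). { rewrite Re_RtoC. lra. }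
    destruct (Hsurj u Hu) as (z & Hz & Ez).
    assert (E := half_plane_coord_lf a b c d al nu z Hs HA Hnu Htr Ha Hz). rewrite Ez, Eu in E. fold w in E.
    assert (P := half_plane_coord_Re al z Ha Hz).
    apply (f_equal Re) in E. rewrite Re_plus in E. rewrite Re_RtoC in E. lra.
  - intros E. split; auto. intros u Hu.
    assert (P := half_plane_coord_Re al u Ha Hu).
    destruct (half_plane_coord_surj al (half_plane_coord al u - w)%C Ha) as (z & Hz & Ez).
    { unfold Cminus. rewrite Re_plus. change (Re (- w)) with (- Re w). lra. }
    exists z. split; auto. apply (half_plane_coord_inj al); auto. now apply Hs.
    rewrite (half_plane_coord_lf a b c d al nu) by auto. rewrite Ez. fold w. ring.
Qed.

Lemma parabolic_recurrent a b c d al nu :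
  lf_selfmap a b c d -> eigen a b c d al 1 nu -> nu <> 0 -> (a + d)%C = (2 * nu)%C ->
  Cmod al = 1 -> c <> 0 -> lf_automorphism a b c d ->
  recurrent (comp_op (lf a b c d)).
Proof.
  intros Hs HA Hnu Htr Ha Hc Hauto.
  assert (Hre := proj1 (translation_automorphism a b c d al nu Hs HA Hnu Htr Ha) Hauto).
  set (w := translation al c nu) in *. set (x := half_plane_coord al).
  assert (Hal : al <> 0) by (apply nz_of_Cmod; lra).
  assert (Hw : 0 < Cmod w).
  { unfold w, translation. rewrite Cmod_div, !Cmod_mult, Cmod_opp, Cmod_mult by auto.
    rewrite Ha, Cmod_R, Rabs_pos_eq by lra. apply Rdiv_lt_0_compat.
    assert (0 < Cmod c) by now apply Cmod_gt_0. lra. now apply Cmod_gt_0. }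
  assert (Hnal : forall z, in_disk z -> (z - al)%C <> 0) by (intros; now apply unit_sub_nz).
  assert (Hy : forall t z, in_disk z -> 0 < Re (x z + RtoC t * w)%C).
  { intros t z Hz. assert (P := half_plane_coord_Re al z Ha Hz). fold x in P.
    rewrite Re_plus. replace (Re (RtoC t * w)) with (t * Re w) by (simpl; unfold Re; ring).
    rewrite Hre. lra. }
  set (S := fun (t : R) z => (/ (1 + (x z + RtoC t * w)))%C).
  assert (Hxh : holo x).
  { apply (holo_minus (fun z => - (2 * al) * / (z - al))%C). 2: apply holo_const.
    apply (holo_mult (fun _ => - (2 * al))%C). apply holo_const.
    apply (holo_inv (fun z => z - al)%C); auto. apply holo_minus. apply holo_id. apply holo_const. }
  assert (HSh : forall t, holo (S t)).
  { intros t. apply (holo_inv (fun z => 1 + (x z + RtoC t * w))%C).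
    - apply (holo_plus (fun _ => RtoC 1)). apply holo_const. apply holo_plus; auto. apply holo_const.
    - intros z Hz. now apply cayley_bounds, Hy. }
  assert (Hxmod : forall z, in_disk z -> Cmod (x z) = Cmod (z + al) / Cmod (z - al)).
  { intros z Hz. rewrite <- Cmod_div by auto. rewrite <- Cmod_opp. f_equal.
    unfold x, half_plane_coord. field. auto. }
  assert (Hzd : forall z e, in_disk z -> Cmod e = 1 -> Cmod (z + e) <= 2).
  { intros z e Hz He. unfold in_disk in Hz. eapply Rle_trans. apply Cmod_triangle. lra. }
  assert (Hup : forall dl, 0 < dl -> forall z, away_from al dl z -> Cmod (x z) <= 2 / dl).
  { intros dl Hd z [Hz Hzd']. rewrite Hxmod by auto. unfold Rdiv. apply Rmult_le_compat.
    apply Cmod_ge_0. apply Rlt_le, Rinv_0_lt_compat, Cmod_gt_0; auto. auto.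
    apply Rinv_le_contravar; auto. }
  assert (Hlo : forall dl, 0 < dl -> forall z, away_from (- al)%C dl z -> dl / 2 <= Cmod (x z)).
  { intros dl Hd z [Hz Hzd']. replace (z - - al)%C with (z + al)%C in Hzd' by ring.
    rewrite Hxmod by auto. unfold Rdiv. apply Rmult_le_compat; auto; try lra.
    apply Rinv_le_contravar. apply Cmod_gt_0; auto.
    apply (Hzd z (- al)%C); auto. now rewrite Cmod_opp. }
  assert (Hmodal : Cmod (- al) = 1) by now rewrite Cmod_opp.
  assert (H00 : forall z, (x z + RtoC 0 * w)%C = x z) by (intros; ring).
  (* Both directions of time at once: away from al the start satisfies |x| <= 2 / dl, so once n |w|
     exceeds 1 / eps + 2 / dl the translated point has modulus at least 1 / eps, and s is at most
     eps. *)
  assert (Hlim : forall sg : R, Rabs sg = 1 -> forall dl eps, 0 < dl -> 0 < eps -> exists n0, forall n z, (n0 <= n)%nat ->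
      away_from al dl z -> Cmod (S (sg * INR n) z - 0) <= eps).
  { intros sg Hsg dl eps Hd He.
    destruct (INR_unbounded ((/ eps + 2 / dl) / Cmod w)) as [n0 Hn0].
    exists n0. intros n z Hn Hz.
    assert (Q := cayley_bounds _ (Hy (sg * INR n) z (proj1 Hz))).
    destruct Q as (_ & _ & _ & _ & _ & Q & _). fold (S (sg * INR n) z) in Q.
    replace (S (sg * INR n)%R z - 0)%C with (S (sg * INR n) z) by ring.
    assert (W0 := Cmod_ge_0 (S (sg * INR n) z)). set (W := Cmod (S (sg * INR n) z)) in *.
    assert (T : / eps <= Cmod (x z + RtoC (sg * INR n) * w)).
    { assert (T1 := Cmod_triangle_rev (RtoC (sg * INR n) * w) (- x z)).
      rewrite Cmod_opp in T1. replace (RtoC (sg * INR n) * w - - x z)%C with (x z + RtoC (sg * INR n) * w)%C in T1 by ring.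
      rewrite Cmod_mult, Cmod_R, Rabs_mult, Hsg, (Rabs_pos_eq (INR n)) in T1 by apply pos_INR.
      specialize (Hup dl Hd z Hz).
      apply le_INR in Hn. assert (Hn1 : (/ eps + 2 / dl) / Cmod w < INR n) by lra.
      apply (Rmult_lt_compat_r (Cmod w)) in Hn1; auto.
      replace ((/ eps + 2 / dl) / Cmod w * Cmod w) with (/ eps + 2 / dl) in Hn1 by (field; lra). lra. }
    assert (Hie : / eps * eps = 1) by (apply Rinv_l; lra).
    assert (0 < / eps) by now apply Rinv_0_lt_compat.
    set (V := Cmod (x z + RtoC (sg * INR n) * w)) in *. nra. }
  (* Here 1 + x = -2 al / (z - al), so s is affine in z and the Blaschke factor with g = 0 is z
     itself. The coordinate x is infinite at al and zero at -al, and s tends to 0 in both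
     directions. *)
  apply (recurrent_escape (lf a b c d) 0 (- (2 * al))%C al
     (S 0) (fun n => S (1 * INR n)) (fun n => S (-1 * INR n)) al (- al)%C al al 0 0); auto.
  - rewrite Cmod_0. lra.
  - intros z Hz. assert (N := Hnal z Hz). unfold S. rewrite H00. unfold x, half_plane_coord.
    replace (1 + (- (2 * al) / (z - al) - 1))%C with (- (2 * al) / (z - al))%C by ring.
    unfold blaschke. replace (Cconj 0) with (RtoC 0) by (unfold Cconj, RtoC; simpl; f_equal; ring).
    field. repeat split; auto.
  - intros z Hz. assert (Q := cayley_bounds _ (Hy 0 z Hz)). unfold S; tauto.
  - intros n z Hz. split.
    + assert (Q := cayley_bounds _ (Hy (1 * INR n) z Hz)). unfold S; tauto.
    + assert (Q := cayley_bounds _ (Hy (-1 * INR n) z Hz)). unfold S; tauto.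
  - intros n z Hz. unfold S, x. rewrite (half_plane_coord_iter a b c d al nu) by auto. fold w.
    split; f_equal; f_equal.
    + rewrite Rmult_1_l. ring.
    + rewrite RtoC_mult. replace (RtoC (-1)) with (- RtoC 1)%C. ring.
      unfold RtoC, Copp; simpl; f_equal; ring.
  - apply (cayley_away_infinity (fun z => x z + RtoC 0 * w)%C). { intros z Hz. now apply Hy. }
    intros dl Hd. exists (2 / dl). intros z Hz. rewrite H00. auto.
  - apply (cayley_away_zero (fun z => x z + RtoC 0 * w)%C). { intros z Hz. now apply Hy. }
    intros dl Hd. exists (dl / 2). split. lra. intros z Hz. rewrite H00. auto.
  - apply Hlim. apply Rabs_R1.
  - apply Hlim. rewrite Rabs_left; lra.
Qed.

(** * Interior fixed points *)

(* Each step halves the argument: some multiple of [psi] lies within [|psi|/2] of [2 PI]. *)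
Lemma unimodular_power_near_1 (om : C) : Cmod om = 1 ->
  forall j, exists n psi, (1 <= n)%nat /\ (om ^ n)%C = circ 1 psi /\ Rabs psi <= PI * (/ 2) ^ j.
Proof.
  intros Hom. assert (P := PI_RGT_0). induction j as [|j (n & psi & Hn & En & Hp)].
  - exists 1%nat. rewrite Cpow_1_r. destruct om as [x y].
    assert (E : x * x + y * y = 1).
    { assert (E0 : Cmod (x, y) ^ 2 = 1) by (rewrite Hom; ring). rewrite Cmod2_alt in E0. simpl in E0. lra. }
    assert (Hx : -1 <= x <= 1) by nra.
    assert (B := acos_bound x).
    assert (S0 : 0 <= sin (acos x)) by (apply sin_ge_0; lra).
    assert (Sq : sin (acos x) * sin (acos x) = y * y).
    { rewrite sin_acos by auto. rewrite sqrt_sqrt; unfold Rsqr; nra. }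
    destruct (Rle_lt_dec 0 y).
    + exists (acos x). split; auto. split.
      * unfold circ. rewrite cos_acos by auto. f_equal. ring. nra.
      * rewrite Rabs_pos_eq; simpl; lra.
    + exists (- acos x). split; auto. split.
      * unfold circ. rewrite cos_neg, sin_neg, cos_acos by auto. f_equal. ring. nra.
      * rewrite Rabs_Ropp, Rabs_pos_eq; simpl; lra.
  - destruct (Req_dec psi 0) as [->|Hpsi].
    { exists n, 0. split; auto. split; auto. rewrite Rabs_R0. apply Rmult_le_pos. lra. apply pow_le. lra. }
    assert (Pa : 0 < Rabs psi) by now apply Rabs_pos_lt.
    assert (Pb : Rabs psi <= PI).
    { eapply Rle_trans. exact Hp. rewrite <- (Rmult_1_r PI) at 2. apply Rmult_le_compat_l. lra.
      rewrite <- (pow1 j). apply pow_incr. lra. }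
    (* [k] is the integer nearest to [2 PI / |psi|]. *)
    set (q := 2 * PI / Rabs psi + / 2). set (k := Z.to_nat (Int_part q)).
    assert (Hq : 2 <= q).
    { unfold q. assert (2 <= 2 * PI / Rabs psi).
      { apply Rmult_le_reg_r with (Rabs psi); auto. unfold Rdiv. rewrite Rmult_assoc, Rinv_l; lra. } lra. }
    destruct (base_Int_part q) as [I1 I2].
    assert (Hk : INR k = IZR (Int_part q)).
    { unfold k. rewrite INR_IZR_INZ, Z2Nat.id; auto. apply le_IZR. lra. }
    assert (Hk1 : (1 <= k)%nat) by (apply INR_le; simpl; lra).
    assert (Hkp : Rabs (INR k * Rabs psi - 2 * PI) <= Rabs psi / 2).
    { rewrite Hk. assert (E : 2 * PI = (q - / 2) * Rabs psi) by (unfold q; field; lra).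
      rewrite E. apply Rabs_le. nra. }
    assert (Hb : Rabs psi / 2 <= PI * (/ 2) ^ S j) by (simpl; lra).
    destruct (Rle_lt_dec 0 psi) as [Hs|Hs].
    + rewrite (Rabs_pos_eq psi Hs) in Hkp at 1.
      exists (n * k)%nat, (INR k * psi - 2 * PI). split; [nia|]. split; [|lra].
      rewrite Cpow_mult_r, En, circ_pow, pow1. rewrite <- (circ_period 1 (INR k * psi - 2 * PI)).
      f_equal. ring.
    + rewrite (Rabs_left psi Hs) in Hkp at 1.
      exists (n * k)%nat, (INR k * psi + 2 * PI). split; [nia|]. split.
      * rewrite Cpow_mult_r, En, circ_pow, pow1. now rewrite circ_period.
      * rewrite <- Rabs_Ropp. replace (- (INR k * psi + 2 * PI)) with (INR k * - psi - 2 * PI) by ring. lra.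
Qed.

Lemma unimodular_recurrence (om : C) eps : Cmod om = 1 -> 0 < eps ->
  exists n, (1 <= n)%nat /\ Cmod (om ^ n - 1) <= eps.
Proof.
  intros Hom He. destruct (pcont_circ 1 0 eps He) as (dl & Hd & H).
  destruct (pow_small (/ 2) (dl / (2 * PI))) as [j Hj]; try lra.
  { apply Rdiv_lt_0_compat; auto. apply two_PI_pos. }
  specialize (Hj j (le_n j)).
  destruct (unimodular_power_near_1 om Hom j) as (n & psi & Hn & En & Hp).
  exists n. split; auto. rewrite En.
  assert (E : RtoC 1 = circ 1 0). { unfold circ, RtoC. rewrite cos_0, sin_0. f_equal; ring. }
  rewrite E. apply H. rewrite Rminus_0_r. eapply Rle_lt_trans. exact Hp.
  assert (P := PI_RGT_0). apply (Rmult_lt_compat_l PI) in Hj; auto.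
  replace (PI * (dl / (2 * PI))) with (dl / 2) in Hj by (field; lra). lra.
Qed.

(** In the coordinate centred at p the map fixes 0, hence has the form lam v / (1 - e v); lam = (a d
    - b c) / (c p + d)^2 is the derivative at p, and e is read off from the expansion [E1] of the
    new denominator. *)
Lemma blaschke_conjugate a b c d p : lf_selfmap a b c d -> in_disk p ->
  fixed_pt a b c d (Some p) -> exists lam e : C, lam <> 0 /\
  (forall z, in_disk z -> (1 - e * blaschke (Cconj p) z)%C <> 0 /\
     blaschke (Cconj p) (lf a b c d z) = (lam * blaschke (Cconj p) z / (1 - e * blaschke (Cconj p) z))%C).
Proof.
  intros Hs Hp Hfix. destruct (fixed_pt_eigen a b c d p Hfix) as [[F1 F2] Hnu].
  set (nu := (c * p + d)%C) in *. destruct Hs as [Hdet Hmap].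
  set (Y := (c - Cconj p * a + Cconj p * nu)%C).
  exists ((a * d - b * c) / (nu * nu))%C, (- Y / nu)%C. split.
  { apply nz_of_Cmod. rewrite Cmod_div by now apply Cmult_neq_0. apply Rdiv_lt_0_compat; apply Cmod_gt_0; auto.
    now apply Cmult_neq_0. }
  intros z Hz. assert (Hp' := Hp). assert (Hz' := Hz). unfold in_disk in Hp', Hz'.
  assert (Hpc : Cmod (Cconj p) < 1) by now rewrite Cmod_conj.
  assert (N1 := one_minus_nz (Cconj p) z Hpc ltac:(lra)).
  destruct (Hmap z Hz) as [Hcd Hd]. assert (Hd' := Hd). unfold in_disk in Hd'.
  assert (N2 := one_minus_nz (Cconj p) (lf a b c d z) Hpc ltac:(lra)).
  assert (Ed : d = (nu - c * p)%C) by (unfold nu; ring).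
  assert (Eb : b = (nu * p - a * p)%C) by (rewrite <- F1; ring).
  assert (E1 : (1 - Cconj p * lf a b c d z)%C = (((1 - Cconj p * z) * nu + (z - p) * Y) / (c * z + d))%C).
  { unfold lf. replace (1 - Cconj p * ((a * z + b) / (c * z + d)))%C
     with ((c * z + d - Cconj p * (a * z + b)) / (c * z + d))%C by (field; auto).
    f_equal. rewrite Ed, Eb. unfold Y. ring. }
  assert (N3 : ((1 - Cconj p * z) * nu + (z - p) * Y)%C <> 0).
  { intros E. apply N2. rewrite E1, E. unfold Cdiv. ring. }
  assert (E2 : (1 - - Y / nu * blaschke (Cconj p) z)%C =
      (((1 - Cconj p * z) * nu + (z - p) * Y) / (nu * (1 - Cconj p * z)))%C).
  { unfold blaschke. rewrite Cconj_conj. field. auto. }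
  assert (E3 : (lf a b c d z - p)%C = ((a * d - b * c) * (z - p) / (nu * (c * z + d)))%C).
  { unfold lf. rewrite Ed in *. rewrite Eb. field. auto. }
  split.
  - rewrite E2. apply nz_of_Cmod. rewrite Cmod_div by now apply Cmult_neq_0.
    apply Rdiv_lt_0_compat; apply Cmod_gt_0; auto. now apply Cmult_neq_0.
  - rewrite E2. unfold blaschke at 1. rewrite Cconj_conj, E1, E3. unfold blaschke. rewrite Cconj_conj.
    field. repeat split; auto.
Qed.

Lemma blaschke_surj g v : Cmod g < 1 -> Cmod v < 1 -> exists z, in_disk z /\ blaschke g z = v.
Proof.
  intros Hg Hv. assert (Hg' : Cmod (- g) < 1) by now rewrite Cmod_opp.
  exists (blaschke (- g) v). split. now apply blaschke_le_1.
  assert (N := one_minus_nz (- g) v Hg' ltac:(lra)).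
  unfold blaschke. rewrite Copp_conj.
  assert (N2 : (1 - g * Cconj g)%C <> 0) by (apply one_minus_nz; auto; rewrite Cmod_conj; lra).
  replace ((v - - Cconj g) / (1 - - g * v) - Cconj g)%C
   with (v * (1 - g * Cconj g) / (1 - - g * v))%C by (field; auto).
  replace (1 - g * ((v - - Cconj g) / (1 - - g * v)))%C
   with ((1 - g * Cconj g) / (1 - - g * v))%C by (field; auto).
  field. auto.
Qed.

Lemma blaschke_inj g z w : Cmod g < 1 -> in_disk z -> in_disk w ->
  blaschke g z = blaschke g w -> z = w.
Proof.
  intros Hg Hz Hw E. assert (Hz' := Hz). assert (Hw' := Hw). unfold in_disk in Hz', Hw'.
  assert (N1 := one_minus_nz g z Hg ltac:(lra)). assert (N2 := one_minus_nz g w Hg ltac:(lra)).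
  assert (N3 : (1 - g * Cconj g)%C <> 0) by (apply one_minus_nz; auto; rewrite Cmod_conj; lra).
  apply Csub_zero. apply Cmult_zero_l with ((1 - g * Cconj g) / ((1 - g * z) * (1 - g * w)))%C.
  - replace ((z - w) * ((1 - g * Cconj g) / ((1 - g * z) * (1 - g * w))))%C
     with (blaschke g z - blaschke g w)%C by (unfold blaschke; field; auto).
    rewrite E. ring.
  - apply nz_of_Cmod. rewrite Cmod_div by now apply Cmult_neq_0.
    apply Rdiv_lt_0_compat; apply Cmod_gt_0; auto. now apply Cmult_neq_0.
Qed.

(* Let [v] tend to the unit circle along the radius on which [e v >= 0]. *)
Lemma schwarz_coeff lam e :
  (forall v, Cmod v < 1 -> (1 - e * v)%C <> 0 /\ Cmod (lam * v / (1 - e * v)) < 1) ->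
  Cmod lam + Cmod e <= 1.
Proof.
  intros H. apply le_epsilon. intros eps He.
  assert (L0 := Cmod_ge_0 lam). assert (E0 := Cmod_ge_0 e).
  assert (Hu : exists u, Cmod u = 1 /\ (e * u)%C = RtoC (Cmod e)).
  { destruct (Ceq_dec e 0) as [->|Hn].
    - exists 1. split. apply Cmod_1. rewrite Cmod_0. ring.
    - assert (P : 0 < Cmod e) by now apply Cmod_gt_0.
      exists (RtoC (Cmod e) / e)%C. split. rewrite Cmod_div, Cmod_R, Rabs_pos_eq by auto. field; lra. field. auto. }
  destruct Hu as (u & Hu & Eu).
  assert (Hall : forall t, 0 <= t < 1 -> t * Cmod lam + t * Cmod e < 1).
  { assert (He1 : Cmod e <= 1).
    { apply Rnot_lt_le. intros K. destruct (H (RtoC (/ Cmod e) * u)%C) as [N _].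
      - rewrite Cmod_mult, Cmod_R, Hu, Rabs_pos_eq. rewrite Rmult_1_r, <- Rinv_1. apply Rinv_lt_contravar; lra.
        apply Rlt_le, Rinv_0_lt_compat; lra.
      - apply N. replace (e * (RtoC (/ Cmod e) * u))%C with (RtoC (/ Cmod e) * (e * u))%C by ring.
        rewrite Eu, <- RtoC_mult, Rinv_l by lra. ring. }
    intros t Ht. destruct (H (RtoC t * u)%C) as [N K].
    { rewrite Cmod_mult, Cmod_R, Hu, Rabs_pos_eq; lra. }
    replace (e * (RtoC t * u))%C with (RtoC t * (e * u))%C in K, N by ring. rewrite Eu, <- RtoC_mult in K, N.
    rewrite Cmod_div, !Cmod_mult, Cmod_R, Hu, Rabs_pos_eq in K by (auto; lra).
    rewrite <- RtoC_minus, Cmod_R in K. rewrite Rabs_pos_eq in K by nra.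
    assert (Q : 0 < 1 - t * Cmod e).
    { assert (0 <= 1 - t * Cmod e) by nra. destruct (Req_dec (1 - t * Cmod e) 0) as [Z|Z]; [|lra].
      exfalso. apply N. rewrite <- RtoC_minus, Z. reflexivity. }
    apply (Rmult_lt_compat_r (1 - t * Cmod e)) in K; auto.
    unfold Rdiv in K. rewrite Rmult_assoc, Rinv_l in K by lra. lra. }
  apply Rnot_lt_le. intros K. set (m := Cmod lam + Cmod e) in *.
  specialize (Hall (/ m)). rewrite <- Rmult_plus_distr_l in Hall. fold m in Hall.
  rewrite Rinv_l in Hall by lra. apply (Rlt_irrefl 1). apply Hall. split.
  apply Rlt_le, Rinv_0_lt_compat; lra. rewrite <- Rinv_1. apply Rinv_lt_contravar; lra.
Qed.

Lemma surjective_coeff (lam e : C) : lam <> 0 -> Cmod lam + Cmod e <= 1 ->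
  (forall w, Cmod w < 1 -> exists v, Cmod v < 1 /\ (1 - e * v)%C <> 0 /\ (lam * v / (1 - e * v))%C = w) ->
  Cmod lam = 1.
Proof.
  intros Hl Hle H. assert (L0 : 0 < Cmod lam) by now apply Cmod_gt_0. assert (E0 := Cmod_ge_0 e).
  apply Rle_antisym; [lra|]. apply Rnot_lt_le. intros Hlt.

  (* [w = |lam| u] with [e u = - |e| lam / |lam|] has the preimage [u / (lam/|lam| (1 - |e|))], which is not in the disk *)
  assert (Hu : exists u, Cmod u = 1 /\ (e * u)%C = (- RtoC (Cmod e) * lam / RtoC (Cmod lam))%C).
  { assert (Nl : RtoC (Cmod lam) <> 0) by (apply nz_of_Cmod; rewrite Cmod_R, Rabs_pos_eq; lra).
    destruct (Ceq_dec e 0) as [->|Hn].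
    - exists 1. split. apply Cmod_1. rewrite Cmod_0. field. auto.
    - assert (P : 0 < Cmod e) by now apply Cmod_gt_0.
      exists (- RtoC (Cmod e) * lam / (RtoC (Cmod lam) * e))%C. split.
      + rewrite Cmod_div, !Cmod_mult, Cmod_opp, !Cmod_R, !Rabs_pos_eq by (auto; try lra; now apply Cmult_neq_0). field. lra.
      + field. auto. }
  destruct Hu as (u & Hu & Eu).
  destruct (H (RtoC (Cmod lam) * u)%C) as (v & Hv & Hn & Ev).
  { rewrite Cmod_mult, Cmod_R, Hu, Rabs_pos_eq; lra. }
  assert (Nl : RtoC (Cmod lam) <> 0) by (apply nz_of_Cmod; rewrite Cmod_R, Rabs_pos_eq; lra).
  assert (E : (lam * v)%C = (RtoC (Cmod lam) * u - RtoC (Cmod lam) * (e * u) * v)%C).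
  { replace (RtoC (Cmod lam) * u - RtoC (Cmod lam) * (e * u) * v)%C with ((RtoC (Cmod lam) * u) * (1 - e * v))%C by ring.
    rewrite <- Ev. field. auto. }
  rewrite Eu in E.
  assert (E2 : (RtoC (1 - Cmod e) * lam * v)%C = (RtoC (Cmod lam) * u)%C).
  { rewrite RtoC_minus. replace ((1 - RtoC (Cmod e)) * lam * v)%C with (lam * v - RtoC (Cmod e) * lam * v)%C by ring.
    rewrite E. field. auto. }
  assert (E3 : (1 - Cmod e) * Cmod lam * Cmod v = Cmod lam).
  { transitivity (Cmod (RtoC (1 - Cmod e) * lam * v)).
    rewrite !Cmod_mult, Cmod_R, Rabs_pos_eq; lra.
    rewrite E2, Cmod_mult, Cmod_R, Hu, Rabs_pos_eq; lra. }
  assert (V0 := Cmod_ge_0 v).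
  assert (E4 : (1 - Cmod e) * Cmod v = 1).
  { apply Rmult_eq_reg_l with (Cmod lam); [|lra]. lra. }
  assert (0 <= Cmod e * Cmod v) by now apply Rmult_le_pos. lra.
Qed.

Lemma interior_fixed_coeff a b c d p lam e : lf_selfmap a b c d -> in_disk p ->
  (forall z, in_disk z -> (1 - e * blaschke (Cconj p) z)%C <> 0 /\
     blaschke (Cconj p) (lf a b c d z) = (lam * blaschke (Cconj p) z / (1 - e * blaschke (Cconj p) z))%C) ->
  Cmod lam + Cmod e <= 1.
Proof.
  intros Hs Hp Hconj. assert (Hpc : Cmod (Cconj p) < 1) by now rewrite Cmod_conj.
  apply schwarz_coeff. intros v Hv. destruct (blaschke_surj (Cconj p) v Hpc Hv) as (z & Hz & <-).
  destruct (Hconj z Hz) as [N E]. split; auto. rewrite <- E. apply blaschke_le_1; auto. now apply Hs.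
Qed.

Lemma elliptic_recurrent a b c d : elliptic_automorphism a b c d -> recurrent (comp_op (lf a b c d)).
Proof.
  intros [[Hs Hsurj] (p & Hp & Hfix)].
  destruct (blaschke_conjugate a b c d p Hs Hp Hfix) as (lam & e & Hl & Hconj).
  assert (Hle := interior_fixed_coeff a b c d p lam e Hs Hp Hconj).
  assert (Hpc : Cmod (Cconj p) < 1) by now rewrite Cmod_conj.
  set (v := blaschke (Cconj p)) in *.
  assert (Hl1 : Cmod lam = 1).
  { apply (surjective_coeff lam e); auto. intros w Hw.
    destruct (blaschke_surj (Cconj p) w Hpc Hw) as (u & Hu & <-).
    destruct (Hsurj u Hu) as (z & Hz & <-). exists (v z). split. now apply blaschke_le_1.
    destruct (Hconj z Hz) as [N E]. split; auto. }
  (* |lam| = 1 uses up the whole inequality |lam| + |e| <= 1, so the map is a rotation in the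
     coordinate v. *)
  assert (He : e = 0). { apply Cmod_eq_0. generalize (Cmod_ge_0 e). lra. }
  assert (Hit : forall n z, in_disk z -> v (Nat.iter n (lf a b c d) z) = (lam ^ n * v z)%C).
  { intros n z Hz. induction n as [|n IH]. simpl; ring.
    simpl Nat.iter. destruct (Hconj _ (selfmap_iter a b c d n z Hs Hz)) as [_ ->].
    rewrite IH, He. simpl. field. }
  apply recurrent_intro. intros f eps [Hf [B HB]] Hep. apply holo_iff in Hf.
  destruct (blaschke_dense (Cconj p) f B (eps / 4) Hpc Hf HB ltac:(lra)) as (P & HP & HPm). fold v in HPm.
  destruct (polyfun_lipschitz P 1 HP) as (L & HL & HLp).
  set (dl := Rmin 1 (eps / 4)). assert (Hd0 : 0 < dl) by (apply Rmin_pos; lra).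
  assert (D1 := Rmin_l 1 (eps / 4)). assert (D2 := Rmin_r 1 (eps / 4)). fold dl in D1, D2.
  destruct (unimodular_recurrence lam (dl / (L + 1)) Hl1) as (k & Hk & Hkp). { apply Rdiv_lt_0_compat; lra. }
  assert (Hv : holo v) by now apply holo_blaschke.
  assert (Hg : holo (fun z => P (v z))) by now apply holo_polyfun.
  assert (Hg2 : holo (fun z => P (lam ^ k * v z)%C)).
  { apply (holo_polyfun P (fun z => lam ^ k * v z)%C); auto. apply (holo_mult (fun _ => lam ^ k)%C); auto. apply holo_const. }
  exists k, (fun z => P (v z)). split; auto. split; auto. split; [|split].
  - apply (holo_ext (fun z => P (lam ^ k * v z)%C)); auto. intros z Hz. now rewrite Hit.
  - intros r Hr. specialize (HPm r Hr). lra.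
  - assert (Hd : means_le (fun z => P (v z) - P (lam ^ k * v z))%C (dl ^ 2)).
    { apply means_le_sup; try lra. now apply holo_minus. intros z Hz.
      assert (Hvz : Cmod (v z) < 1) by now apply blaschke_le_1.
      eapply Rle_trans. { apply HLp. lra. rewrite Cmod_mult, Cmod_pow, Hl1, pow1. lra. }
      rewrite Cmod_sub_sym. replace (lam ^ k * v z - v z)%C with ((lam ^ k - 1) * v z)%C by ring.
      rewrite Cmod_mult. apply Rle_trans with ((L + 1) * (dl / (L + 1) * 1)); [|right; field; lra].
      apply Rmult_le_compat; try lra. apply Rmult_le_pos; apply Cmod_ge_0.
      apply Rmult_le_compat; try lra; apply Cmod_ge_0. }
    assert (Hfg : holo (fun z => f z - P (v z))%C) by now apply holo_minus.
    assert (Hgg : holo (fun z => P (v z) - P (lam ^ k * v z))%C) by now apply holo_minus.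
    assert (Q := means_le_add _ _ _ _ Hfg Hgg HPm Hd). intros r Hr. specialize (Q r Hr).
    rewrite (int_mean2_ext _ (fun z => f z - P (v z) + (P (v z) - P (lam ^ k * v z)))%C); auto.
    + assert (dl ^ 2 <= eps / 4) by nra. lra.
    + intros z Hz. rewrite Hit by auto. ring.
Qed.

(** * Non-recurrence *)

Lemma sq_le_sq x y : 0 <= y -> x ^ 2 <= y ^ 2 -> x <= y.
Proof. intros Hy H. nra. Qed.

Lemma interior_automorphism a b c d p lam e : lf_selfmap a b c d -> in_disk p ->
  (forall z, in_disk z -> (1 - e * blaschke (Cconj p) z)%C <> 0 /\
     blaschke (Cconj p) (lf a b c d z) = (lam * blaschke (Cconj p) z / (1 - e * blaschke (Cconj p) z))%C) ->
  Cmod lam = 1 -> lf_automorphism a b c d.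
Proof.
  intros Hs Hp Hconj Hl. assert (Hle := interior_fixed_coeff a b c d p lam e Hs Hp Hconj).
  assert (He : e = 0). { apply Cmod_eq_0. generalize (Cmod_ge_0 e). lra. }
  assert (Hpc : Cmod (Cconj p) < 1) by now rewrite Cmod_conj.
  assert (Hln : lam <> 0) by (apply nz_of_Cmod; lra).
  split; auto. intros w Hw. assert (Hv := blaschke_le_1 _ w Hpc Hw).
  destruct (blaschke_surj (Cconj p) (blaschke (Cconj p) w / lam)%C Hpc) as (z & Hz & Ez).
  { rewrite Cmod_div, Hl by auto. lra. }
  exists z. split; auto. apply (blaschke_inj (Cconj p)); auto. now apply Hs.
  destruct (Hconj z Hz) as [_ ->]. rewrite Ez, He. field. auto.
Qed.

(** The map sends |v| <= 1 / 2 into |v| <= th / 2 with th < 1. For f close to v, f(z_k) is near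
    v(z_k), of modulus at most th / 2; for the image of f close to v, evaluation at the starting
    point makes f(z_k) near 1 / 2. This excludes every k >= 1 at once. *)
Lemma interior_not_recurrent a b c d : lf_selfmap a b c d -> has_fixed_pt_in_disk a b c d ->
  ~ lf_automorphism a b c d -> ~ recurrent (comp_op (lf a b c d)).
Proof.
  intros Hs (p & Hp & Hfix) Hna Hrec.
  destruct (blaschke_conjugate a b c d p Hs Hp Hfix) as (lam & e & Hl & Hconj).
  assert (Hle := interior_fixed_coeff a b c d p lam e Hs Hp Hconj).
  assert (Hl1 : Cmod lam <> 1) by (intros E; apply Hna; now apply (interior_automorphism a b c d p lam e)).
  assert (E0 := Cmod_ge_0 e). assert (L0 := Cmod_ge_0 lam).
  assert (Hpc : Cmod (Cconj p) < 1) by now rewrite Cmod_conj.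
  set (v := blaschke (Cconj p)) in *.
  (* On |v| <= 1 / 2 the denominator satisfies |1 - e v| >= 1 - |e| / 2. The quotient is below 1:
     for e = 0 because |lam| < 1, otherwise because |lam| <= 1 - |e|. *)
  set (th := Cmod lam / (1 - Cmod e / 2)).
  assert (Hth : 0 <= th < 1).
  { unfold th. split. apply Rmult_le_pos; auto. apply Rlt_le, Rinv_0_lt_compat; lra.
    apply Rmult_lt_reg_r with (1 - Cmod e / 2). lra. unfold Rdiv at 1. rewrite Rmult_assoc, Rinv_l by lra. lra. }
  destruct (blaschke_surj (Cconj p) (RtoC (1 / 2)) Hpc) as (q & Hq & Eq).
  { rewrite Cmod_R, Rabs_pos_eq; lra. }
  fold v in Eq.
  set (z := fun k => Nat.iter k (lf a b c d) q).
  assert (Hz : forall k, in_disk (z k)) by (intros; now apply selfmap_iter).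
  assert (Hstep : forall k, Cmod (v (z k)) <= 1 / 2 -> Cmod (v (z (S k))) <= th * (1 / 2)).
  { intros k Hk. destruct (Hconj (z k) (Hz k)) as [N E]. change (z (S k)) with (lf a b c d (z k)).
    rewrite E, Cmod_div, Cmod_mult by auto.
    assert (T := Cmod_triangle_rev 1 (e * v (z k))). rewrite Cmod_1, Cmod_mult in T.
    assert (V0 := Cmod_ge_0 (v (z k))).
    assert (D : 1 - Cmod e / 2 <= Cmod (1 - e * v (z k))) by nra.
    unfold th. replace (Cmod lam / (1 - Cmod e / 2) * (1 / 2)) with (Cmod lam * (1 / 2) / (1 - Cmod e / 2)) by (field; lra).
    unfold Rdiv at 1 3. apply Rmult_le_compat.
    - now apply Rmult_le_pos.
    - apply Rlt_le, Rinv_0_lt_compat. lra.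
    - apply Rmult_le_compat_l; lra.
    - apply Rinv_le_contravar; lra. }
  assert (Hv : forall k, Cmod (v (z k)) <= 1 / 2).
  { induction k as [|k IH]. change (z O) with q. rewrite Eq, Cmod_R, Rabs_pos_eq; lra.
    specialize (Hstep k IH). nra. }
  (* By [blaschke_identity], |v| <= 1 / 2 keeps 1 - |z|^2 above this constant, so evaluation along
     the orbit is bounded independently of k. *)
  set (m := 3 / 4 * (1 - Cmod p) ^ 2). assert (Hp' := Hp). unfold in_disk in Hp'.
  assert (Hm : 0 < m). { unfold m. assert (0 < (1 - Cmod p) ^ 2) by (apply pow_lt; lra). lra. }
  assert (P0 := Cmod_ge_0 p).
  assert (Hzm : forall k, m <= 1 - Cmod (z k) ^ 2).
  { intros k. specialize (Hz k). specialize (Hv k). assert (Hz' := Hz). unfold in_disk in Hz'.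
    assert (E := blaschke_identity (Cconj p) (z k) Hpc ltac:(lra)). fold v in E. rewrite Cmod_conj in E.
    assert (N := one_minus_nz (Cconj p) (z k) Hpc ltac:(lra)).
    assert (T := Cmod_triangle_rev 1 (Cconj p * z k)). rewrite Cmod_1, Cmod_mult, Cmod_conj in T.
    assert (Z0 := Cmod_ge_0 (z k)). assert (V0 := Cmod_ge_0 (v (z k))).
    assert (T2 : 1 - Cmod p <= Cmod (1 - Cconj p * z k)) by nra.
    set (D := Cmod (1 - Cconj p * z k)) in *.
    assert (D2 : (1 - Cmod p) ^ 2 <= D ^ 2) by (apply pow_incr; lra).
    assert (Dp : 0 < D) by lra.
    assert (E2 : (1 - Cmod (v (z k)) ^ 2) * D ^ 2 = (1 - Cmod p ^ 2) * (1 - Cmod (z k) ^ 2)).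
    { rewrite E. field. lra. }
    assert (H34 : 3 / 4 <= 1 - Cmod (v (z k)) ^ 2) by nra.
    assert (Z1 : 0 <= 1 - Cmod (z k) ^ 2) by nra.
    apply Rle_trans with ((1 - Cmod (v (z k)) ^ 2) * D ^ 2).
    - unfold m. apply Rmult_le_compat; try lra. apply pow2_ge_0.
    - rewrite E2. rewrite <- (Rmult_1_l (1 - Cmod (z k) ^ 2)) at 2. apply Rmult_le_compat_r; auto. nra. }
  (* Two errors of eta stay below the gap (1 - th) / 2 between 1 / 2 and th / 2. *)
  set (eta := (1 - th) / 8).
  assert (Heta : 0 < eta) by (unfold eta; lra).
  assert (Hvh : holo v) by now apply holo_blaschke.
  destruct (recurrent_elim (lf a b c d) v (1 ^ 2) (m * eta ^ 2) Hvh) as (k & f & Hk & Hf & M1 & Hfk & M2); auto.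
  { apply means_le_sup; auto; try lra. intros w Hw. left. now apply blaschke_le_1. }
  { apply Rmult_lt_0_compat; auto. now apply pow_lt. }
  assert (B : forall h j, holo h -> means_le h (m * eta ^ 2) -> Cmod (h (z j)) <= eta).
  { intros h j Hh Mh. apply sq_le_sq. lra. eapply Rle_trans. apply (eval_le h _ (z j) Hh Mh (Hz j)).
    specialize (Hzm j). apply Rmult_le_reg_r with (1 - Cmod (z j) ^ 2). lra.
    unfold Rdiv. rewrite Rmult_assoc, Rinv_l by lra. assert (0 <= eta ^ 2) by apply pow2_ge_0. nra. }
  assert (B1 := B (fun w => f w - v w)%C k (holo_minus _ _ Hf Hvh) M1). simpl in B1.
  assert (B2 := B (fun w => f (Nat.iter k (lf a b c d) w) - v w)%C O (holo_minus _ _ Hfk Hvh) M2).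
  change (Cmod (f (z k) - v q) <= eta) in B2. rewrite Eq in B2.
  destruct k as [|k]. lia. specialize (Hstep k (Hv k)).
  set (u := f (z (S k))) in *. set (vk := v (z (S k))) in *.
  assert (T1 := Cmod_triangle_rev (RtoC (1 / 2)) u). rewrite Cmod_sub_sym, Cmod_R, Rabs_pos_eq in T1 by lra.
  assert (T2 := Cmod_triangle_rev u vk). unfold eta in *. nra.
Qed.

(** The orbits start at 0 and at al / 3, whose half-plane coordinates are 1 and 2. If f and its
    image under the k-th power are both near the identity function, then f(z_k) is near 0 and
    f(z'_k) near al / 3. For large k this contradicts the merging of the two orbits; for smaller k,
    f(z_k) is also near z_k, which is not near 0. *)
Lemma parabolic_not_recurrent a b c d al nu :
  lf_selfmap a b c d -> eigen a b c d al 1 nu -> nu <> 0 -> (a + d)%C = (2 * nu)%C ->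
  Cmod al = 1 -> ~ lf_automorphism a b c d -> ~ recurrent (comp_op (lf a b c d)).
Proof.
  intros Hs HA Hnu Htr Ha Hna Hrec.
  set (w := translation al c nu).
  assert (Hre : 0 < Re w).
  { destruct (translation_Re_nonneg a b c d al nu Hs HA Hnu Htr Ha) as [H|H]; auto.
    exfalso. apply Hna. apply (translation_automorphism a b c d al nu); auto. }
  set (rho := Re w) in *.
  assert (Hwm : rho <= Cmod w).
  { eapply Rle_trans; [|apply re_le_Cmod]. apply Rle_abs. }
  assert (Hal : al <> 0) by (apply nz_of_Cmod; lra).
  set (q' := (al / 3)%C).
  assert (N3 : RtoC 3 <> 0) by (apply nz_of_Cmod; rewrite Cmod_R, Rabs_pos_eq; lra).
  assert (Hq'm : Cmod q' = / 3). { unfold q'. rewrite Cmod_div, Cmod_R, Ha, Rabs_pos_eq by (auto; lra). field. }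
  assert (Hq0 : in_disk 0) by (unfold in_disk; rewrite Cmod_0; lra).
  assert (Hq' : in_disk q') by (unfold in_disk; lra).
  (* With X1 the half-plane coordinate plus 1, u = al - 2 al / X1 and (1 - |u|^2) |X1|^2 = 4 (Re X1
     - 1). Since |X1| grows linearly in k and Re X1 - 1 >= k rho, this gives 1 - |u|^2 >= const /
     k. *)
  assert (Hform : forall j k u, 1 <= j <= 2 -> (1 <= k)%nat -> in_disk u ->
     half_plane_coord al u = (RtoC j + RtoC (INR k) * w)%C ->
     u = (al - 2 * al / (RtoC (j + 1) + RtoC (INR k) * w))%C /\
     INR k * rho <= Cmod (RtoC (j + 1) + RtoC (INR k) * w) /\
     4 * rho / (INR k * (3 + Cmod w) ^ 2) <= 1 - Cmod u ^ 2).
  { intros j k u Hj Hk Hu Eu. assert (Nu := unit_sub_nz al u Ha Hu).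
    apply le_INR in Hk. simpl INR in Hk.
    set (X1 := (RtoC (j + 1) + RtoC (INR k) * w)%C).
    assert (EX : X1 = (- (2 * al) / (u - al))%C).
    { unfold X1. rewrite RtoC_plus. replace (RtoC j + 1 + RtoC (INR k) * w)%C with (half_plane_coord al u + 1)%C by (rewrite Eu; ring).
      unfold half_plane_coord. ring. }
    assert (ReX : Re X1 = j + 1 + INR k * rho). { unfold X1, rho. destruct w. simpl. ring. }
    assert (LX : INR k * rho <= Cmod X1).
    { eapply Rle_trans; [|apply re_le_Cmod]. eapply Rle_trans; [|apply Rle_abs]. rewrite ReX. lra. }
    assert (PX : 0 < Cmod X1).
    { eapply Rlt_le_trans; [|exact LX]. apply Rmult_lt_0_compat; lra. }
    assert (NX : X1 <> 0) by now apply Cmod_gt_0.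
    assert (Eu2 : u = (al - 2 * al / X1)%C). { rewrite EX. field. repeat split; auto. }
    split; auto. split; auto.
    assert (UX : Cmod X1 <= INR k * (3 + Cmod w)).
    { unfold X1. eapply Rle_trans. apply Cmod_triangle. rewrite Cmod_mult, !Cmod_R, !Rabs_pos_eq by lra. nra. }
    assert (E : (1 - Cmod u ^ 2) * Cmod X1 ^ 2 = 4 * (Re X1 - 1)).
    { assert (Em : Cmod u * Cmod X1 = Cmod (X1 - 2)).
      { rewrite Eu2. rewrite <- Cmod_mult. replace ((al - 2 * al / X1) * X1)%C with (al * (X1 - 2))%C by (field; auto).
        rewrite Cmod_mult, Ha. ring. }
      rewrite Rmult_minus_distr_r, <- Rpow_mult_distr, Em, !Cmod2_alt. clear. destruct X1. simpl. ring. }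
    apply Rmult_le_reg_r with (Cmod X1 ^ 2). now apply pow_lt. rewrite E, ReX.
    assert (W0 := Cmod_ge_0 w).
    assert (U2 : Cmod X1 ^ 2 <= (INR k * (3 + Cmod w)) ^ 2) by (apply pow_incr; lra).
    assert (P3 : 0 < (3 + Cmod w) ^ 2) by (apply pow_lt; lra).
    apply Rle_trans with (4 * rho / (INR k * (3 + Cmod w) ^ 2) * (INR k * (3 + Cmod w)) ^ 2).
    - apply Rmult_le_compat_l; auto. apply Rmult_le_pos. lra.
      apply Rlt_le, Rinv_0_lt_compat. apply Rmult_lt_0_compat; lra.
    - replace (4 * rho / (INR k * (3 + Cmod w) ^ 2) * (INR k * (3 + Cmod w)) ^ 2) with (4 * (INR k * rho)).
      lra. field. split; lra. }
  set (cc := 4 * rho / (3 + Cmod w) ^ 2). assert (W0 := Cmod_ge_0 w).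
  assert (P3 : 0 < (3 + Cmod w) ^ 2) by (apply pow_lt; lra).
  assert (Hcc : 0 < cc) by (apply Rdiv_lt_0_compat; lra).
  (* A lower bound, for all k >= 1, of |z_k| = k |w| / |2 + k w|. *)
  set (dl := Cmod w / (2 + Cmod w)). assert (Hdl : 0 < dl) by (apply Rdiv_lt_0_compat; lra).
  assert (Hx0 : half_plane_coord al 0 = 1). { unfold half_plane_coord. field. repeat split; auto. }
  assert (Hx1 : half_plane_coord al q' = 2).
  { unfold half_plane_coord. replace (q' - al)%C with (- (2 * al) / 3)%C by (unfold q'; field; auto).
    assert (N2 : RtoC 2 <> 0) by (apply nz_of_Cmod; rewrite Cmod_R, Rabs_pos_eq; lra).
    field. repeat split; auto. }
  set (z := fun k => Nat.iter k (lf a b c d) 0). set (z' := fun k => Nat.iter k (lf a b c d) q').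
  assert (Hz : forall k, in_disk (z k)) by (intros; now apply selfmap_iter).
  assert (Hz' : forall k, in_disk (z' k)) by (intros; now apply selfmap_iter).
  assert (Fz : forall k, (1 <= k)%nat -> z k = (al - 2 * al / (RtoC (1 + 1) + RtoC (INR k) * w))%C /\
     INR k * rho <= Cmod (RtoC (1 + 1) + RtoC (INR k) * w) /\ cc / INR k <= 1 - Cmod (z k) ^ 2).
  { intros k Hk. assert (Hk' := Hk). apply le_INR in Hk'. simpl INR in Hk'.
    replace (cc / INR k) with (4 * rho / (INR k * (3 + Cmod w) ^ 2)) by (unfold cc; field; lra).
    apply Hform; auto. lra. unfold z. rewrite (half_plane_coord_iter a b c d al nu) by auto. now rewrite Hx0. }
  assert (Fz' : forall k, (1 <= k)%nat -> z' k = (al - 2 * al / (RtoC (2 + 1) + RtoC (INR k) * w))%C /\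
     INR k * rho <= Cmod (RtoC (2 + 1) + RtoC (INR k) * w) /\ cc / INR k <= 1 - Cmod (z' k) ^ 2).
  { intros k Hk. assert (Hk' := Hk). apply le_INR in Hk'. simpl INR in Hk'.
    replace (cc / INR k) with (4 * rho / (INR k * (3 + Cmod w) ^ 2)) by (unfold cc; field; lra).
    apply Hform; auto. lra. unfold z'. rewrite (half_plane_coord_iter a b c d al nu) by auto. now rewrite Hx1. }
  assert (Hcc1 : cc <= 1).
  { destruct (Fz 1%nat (le_n 1)) as (_ & _ & F). simpl INR in F. generalize (pow2_ge_0 (Cmod (z 1%nat))). lra. }
  (* [eval_diff_le] with means bound 4, distance 2 / (k rho)^2 and 1 - R^2 = cc / k gives exactly C0
     / k for the squared difference; beyond 100 C0 it is at most (1 / 10)^2. *)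
  set (C0 := 32 / (rho ^ 4 * cc ^ 3)).
  assert (R4 : 0 < rho ^ 4) by now apply pow_lt. assert (C3 : 0 < cc ^ 3) by now apply pow_lt.
  assert (HC0 : 0 < C0). { apply Rdiv_lt_0_compat. lra. now apply Rmult_lt_0_compat. }
  destruct (INR_unbounded (1 + 100 * C0)) as [K HK].
  (* 1 / 400 is (1 / 20)^2, for the case of large k. The second bound makes eps k / cc at most (dl /
     4)^2 for all k < K. *)
  set (eps := Rmin (1 / 400) (cc * dl ^ 2 / (16 * INR K))).
  assert (D2 : 0 < dl ^ 2) by now apply pow_lt.
  assert (Heps : 0 < eps). { apply Rmin_pos. lra. apply Rdiv_lt_0_compat. now apply Rmult_lt_0_compat. lra. }
  assert (Ep1 := Rmin_l (1 / 400) (cc * dl ^ 2 / (16 * INR K))).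
  assert (Ep2 := Rmin_r (1 / 400) (cc * dl ^ 2 / (16 * INR K))). fold eps in Ep1, Ep2.
  assert (Hid : means_le (fun u => u) (1 ^ 2)).
  { apply means_le_sup. apply holo_id. lra. intros u Hu. now left. }
  destruct (recurrent_elim (lf a b c d) (fun u => u) (1 ^ 2) eps holo_id Hid Heps Hrec)
    as (k & f & Hk & Hf & M1 & Hfk & M2).
  assert (Hf1 : holo (fun u => f u - u)%C) by (apply holo_minus; auto; apply holo_id).
  assert (Hf2 : holo (fun u => f (Nat.iter k (lf a b c d) u) - u)%C) by (apply holo_minus; auto; apply holo_id).
  destruct (Fz k Hk) as (F1 & F2 & F3). destruct (Fz' k Hk) as (F1' & F2' & F3').
  assert (Hk' := Hk). apply le_INR in Hk'. simpl INR in Hk'.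
  assert (B0 : Cmod (f (z k)) ^ 2 <= eps).
  { assert (Q := eval_le _ _ 0 Hf2 M2 Hq0). cbv beta in Q. fold (z k) in Q. rewrite Cmod_0 in Q.
    replace (f (z k) - 0)%C with (f (z k)) in Q by ring.
    replace (eps / (1 - 0 ^ 2)) with eps in Q by field. exact Q. }
  (* For k >= K the errors 1 / 10, 1 / 10 and 1 / 20 would have to add up to |q'| = 1 / 3; for k < K
     two errors of dl / 4 would have to reach |z_k| >= dl. *)
  destruct (le_lt_dec K k) as [Hbig|Hsmall].
  - assert (Hf4 : means_le f 4).
    { intros r Hr. assert (Q := means_le_add _ _ _ _ Hf1 holo_id M1 Hid r Hr).
      rewrite (int_mean2_ext f (fun u => f u - u + u)%C) by (auto; intros; ring). lra. }
    assert (B1 : Cmod (f (z' k) - q') <= 1 / 10).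
    { assert (Q := eval_le _ _ q' Hf2 M2 Hq'). cbv beta in Q. fold (z' k) in Q. rewrite Hq'm in Q.
      apply sq_le_sq. lra. eapply Rle_trans. exact Q.
      replace (1 - (/ 3) ^ 2) with (8 / 9) by field. unfold Rdiv. lra. }
    assert (B0' : Cmod (f (z k)) <= 1 / 20). { apply sq_le_sq. lra. eapply Rle_trans. exact B0. lra. }
    set (t := cc / INR k) in *.
    assert (Ht : 0 < t) by (apply Rdiv_lt_0_compat; lra).
    assert (Ht1 : t <= 1) by (generalize (pow2_ge_0 (Cmod (z k))); lra).
    set (R := sqrt (1 - t)).
    assert (HR2 : R ^ 2 = 1 - t). { unfold R. simpl. rewrite Rmult_1_r, sqrt_sqrt; lra. }
    assert (HR0 : 0 <= R) by apply sqrt_pos.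
    assert (B2 := eval_diff_le f 4 (z k) (z' k) R Hf Hf4
       ltac:(apply sq_le_sq; lra) ltac:(apply sq_le_sq; lra) ltac:(nra)).
    assert (HX1 : 0 < INR k * rho) by (apply Rmult_lt_0_compat; lra).
    assert (Hdist : Cmod (z k - z' k) <= 2 / (INR k * rho) ^ 2).
    { rewrite F1, F1'.
      set (X := (RtoC (1 + 1) + RtoC (INR k) * w)%C) in *. set (X' := (RtoC (2 + 1) + RtoC (INR k) * w)%C) in *.
      assert (NX : X <> 0) by (apply nz_of_Cmod; lra). assert (NX' : X' <> 0) by (apply nz_of_Cmod; lra).
      replace (al - 2 * al / X - (al - 2 * al / X'))%C with (- (2 * al * (X' - X) / (X * X')))%C by (field; auto).
      replace (X' - X)%C with (RtoC 1).
      2:{ unfold X', X. replace (2 + 1) with ((1 + 1) + 1) by ring. rewrite (RtoC_plus (1 + 1) 1). ring. }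
      rewrite Cmod_opp, Cmod_div, !Cmod_mult, Ha, Cmod_1, Cmod_R, Rabs_pos_eq by (try lra; now apply Cmult_neq_0).
      unfold Rdiv. rewrite !Rmult_1_r. apply Rmult_le_compat_l. lra. apply Rinv_le_contravar.
      now apply pow_lt. simpl. rewrite Rmult_1_r. apply Rmult_le_compat; lra. }
    assert (B3 : Cmod (f (z k) - f (z' k)) <= 1 / 10).
    { apply sq_le_sq. lra. eapply Rle_trans. exact B2. rewrite HR2. replace (1 - (1 - t)) with t by ring.
      apply Rle_trans with (4 * ((2 / (INR k * rho) ^ 2) ^ 2 * (2 / t ^ 3))).
      - apply Rmult_le_compat_l. lra. apply Rmult_le_compat_r. apply Rlt_le, Rdiv_lt_0_compat. lra. now apply pow_lt.
        apply pow_incr. split; auto. apply Cmod_ge_0.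
      - replace (4 * ((2 / (INR k * rho) ^ 2) ^ 2 * (2 / t ^ 3))) with (C0 / INR k).
        2:{ unfold C0, t. field. repeat split; lra. }
        apply le_INR in Hbig. apply Rmult_le_reg_r with (INR k). lra.
        unfold Rdiv. rewrite Rmult_assoc, Rinv_l by lra. lra. }
    assert (T1 := Cmod_triangle_rev q' (f (z' k))). rewrite Cmod_sub_sym in T1.
    assert (T2 := Cmod_triangle_rev (f (z' k)) (f (z k))). rewrite (Cmod_sub_sym (f (z' k))) in T2. lra.
  - assert (HKk : INR k <= INR K) by (apply le_INR; lia).
    assert (E16 : eps * (16 * INR K) <= cc * dl ^ 2).
    { apply Rmult_le_reg_r with (/ (16 * INR K)). apply Rinv_0_lt_compat; lra.
      rewrite Rmult_assoc, Rinv_r by lra. lra. }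
    assert (B0' : Cmod (f (z k)) <= dl / 4).
    { apply sq_le_sq. lra. eapply Rle_trans. exact B0.
      assert (cc * dl ^ 2 <= 1 * dl ^ 2) by (apply Rmult_le_compat_r; lra).
      assert (eps * 1 <= eps * INR K) by (apply Rmult_le_compat_l; lra). lra. }
    assert (B1 : Cmod (f (z k) - z k) <= dl / 4).
    { apply sq_le_sq. lra. eapply Rle_trans. apply (eval_le _ _ (z k) Hf1 M1 (Hz k)).
      assert (Hck : 0 < cc / INR k) by (apply Rdiv_lt_0_compat; lra).
      apply Rle_trans with (eps / (cc / INR k)).
      - unfold Rdiv at 1 2. apply Rmult_le_compat_l. lra. now apply Rinv_le_contravar.
      - replace (eps / (cc / INR k)) with (eps * INR k / cc) by (field; lra).
        apply Rmult_le_reg_r with cc; auto. unfold Rdiv. rewrite Rmult_assoc, Rinv_l by lra.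
        assert (eps * INR k <= eps * INR K) by (apply Rmult_le_compat_l; lra). lra. }
    assert (Hfar : dl <= Cmod (z k)).
    { rewrite F1. set (X := (RtoC (1 + 1) + RtoC (INR k) * w)%C) in *.
      assert (HX1 : 0 < INR k * rho) by (apply Rmult_lt_0_compat; lra).
      assert (NX : X <> 0) by (apply nz_of_Cmod; lra).
      replace (al - 2 * al / X)%C with (al * (RtoC (INR k) * w) / X)%C.
      2:{ replace (RtoC (INR k) * w)%C with (X - 2)%C. field; auto. unfold X. rewrite RtoC_plus. 
          replace (RtoC 2) with (RtoC 1 + RtoC 1)%C. ring. rewrite <- RtoC_plus. f_equal. }
      rewrite Cmod_div, !Cmod_mult, Ha, Cmod_R, Rabs_pos_eq by (auto; lra).
      assert (UX : Cmod X <= 2 + INR k * Cmod w).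
      { unfold X. eapply Rle_trans. apply Cmod_triangle. rewrite Cmod_mult, !Cmod_R, !Rabs_pos_eq by lra. lra. }
      apply Rmult_le_reg_r with (Cmod X). lra. unfold Rdiv at 1. rewrite Rmult_assoc, Rinv_l, Rmult_1_r by lra.
      apply Rle_trans with (dl * (2 + INR k * Cmod w)). apply Rmult_le_compat_l; lra.
      apply Rmult_le_reg_r with (2 + Cmod w). lra. unfold dl.
      replace (Cmod w / (2 + Cmod w) * (2 + INR k * Cmod w) * (2 + Cmod w))
        with (Cmod w * (2 + INR k * Cmod w)) by (field; lra).
      nra. }
    assert (T := Cmod_triangle_rev (z k) (f (z k))). rewrite Cmod_sub_sym in T. lra.
Qed.

(** * Classification by fixed points *)

Lemma Csqrt_exists (w : C) : exists s, (s * s)%C = w.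
Proof.
  destruct w as [x y].
  set (m := Cmod (x, y)). assert (M0 : 0 <= m) by apply Cmod_ge_0.
  assert (E : m * m = x * x + y * y).
  { assert (E0 := Cmod2_alt (x, y)). fold m in E0. simpl in E0. lra. }
  assert (H1 : 0 <= (m + x) / 2) by nra. assert (H2 : 0 <= (m - x) / 2) by nra.
  assert (S1 := sqrt_sqrt _ H1). assert (S2 := sqrt_sqrt _ H2).
  assert (P1 := sqrt_pos ((m + x) / 2)). assert (P2 := sqrt_pos ((m - x) / 2)).
  set (p := sqrt ((m + x) / 2)) in *. set (q := sqrt ((m - x) / 2)) in *.
  assert (Hpq : (2 * (p * q)) * (2 * (p * q)) = y * y).
  { replace ((2 * (p * q)) * (2 * (p * q))) with (4 * (p * p) * (q * q)) by ring. rewrite S1, S2. lra. }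
  assert (P0 : 0 <= p * q) by now apply Rmult_le_pos.
  destruct (Rle_lt_dec 0 y) as [Hy|Hy].
  - exists (p, q). unfold Cmult; simpl. f_equal; nra.
  - exists (p, - q). unfold Cmult; simpl. f_equal; nra.
Qed.

Lemma fixed_pt_intro a b c d z : (c * z + d)%C <> 0 -> (a * z + b)%C = (z * (c * z + d))%C ->
  fixed_pt a b c d (Some z).
Proof.
  intros Hn E. unfold fixed_pt, lf_ext. destruct (Ceq_dec (c * z + d)%C 0) as [K|_]. contradiction.
  f_equal. unfold lf. rewrite E. field. auto.
Qed.

Lemma quadratic_root_denom a b c d z : (a * d - b * c)%C <> 0 ->
  (a * z + b)%C = (z * (c * z + d))%C -> (c * z + d)%C <> 0.
Proof.
  intros Hdet E K. apply Hdet. rewrite K in E.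
  replace (a * d - b * c)%C with (a * (c * z + d) - c * (a * z + b))%C by ring. rewrite E, K. ring.
Qed.

(** The orbit in the coordinate u is k^n u with k = mu / nu, and the half-plane condition Re (k^n y)
    > 0 excludes |k| = 1 for k <> 1. Then u tends to 0: this is attraction to al, and al, already
    outside the open disk, must lie on the circle. *)
Lemma two_fixed_points a b c d al nu b0 b1 mu :
  lf_selfmap a b c d ->
  eigen a b c d al 1 nu -> eigen a b c d b1 b0 mu -> (b1 - al * b0)%C <> 0 -> nu <> 0 ->
  Cmod b0 <= Cmod b1 -> 1 <= Cmod al -> Cmod (mu / nu) <= 1 -> mu <> nu ->
  Cmod al = 1 /\ attractive a b c d al.
Proof.
  intros Hs HA HB HD Hnu Hb Ha Hk Hne.
  set (B := (Cconj al * b1 - b0)%C). set (k := (mu / nu)%C) in *.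
  assert (Hit : forall n z, in_disk z ->
     coord al b0 b1 (Nat.iter n (lf a b c d) z) = (k ^ n * coord al b0 b1 z)%C).
  { intros n z Hz. now apply coord_iter. }
  assert (Hq : forall n z, in_disk z -> qform al b0 b1 (k ^ n * coord al b0 b1 z)%C < 0).
  { intros n z Hz. rewrite <- Hit by auto. assert (Hz2 := selfmap_iter a b c d n z Hs Hz).
    apply qform_coord; auto. now apply (coord_denom_nz al). }
  assert (Z0 : in_disk 0) by (unfold in_disk; rewrite Cmod_0; lra).
  set (y := (B * coord al b0 b1 0)%C).
  assert (Hpos : forall n, 0 < Re (k ^ n * y)%C).
  { intros n. specialize (Hq n 0 Z0). apply qform_Re_pos in Hq; auto. fold B in Hq.
    replace (k ^ n * y)%C with (B * (k ^ n * coord al b0 b1 0))%C by (unfold y; ring). exact Hq. }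
  assert (Hk1 : k <> 1).
  { intros E. apply Hne. apply Csub_zero. apply Cmult_zero_l with (/ nu)%C.
    replace ((mu - nu) * / nu)%C with (k - 1)%C by (unfold k; field; auto). rewrite E. ring.
    apply nz_of_Cmod. rewrite Cmod_inv by auto. apply Rinv_0_lt_compat. now apply Cmod_gt_0. }
  assert (N1 : (1 - k)%C <> 0) by (apply Csub_nz; auto).
  assert (Hkl : Cmod k < 1).
  { destruct Hk as [Hk|Hk]; auto. exfalso.
    (* otherwise the partial sums of [k^n y] return close to 0 although their real parts increase *)
    assert (H0 := Hpos O). simpl in H0.
    assert (Y0 : 0 < Cmod y).
    { eapply Rlt_le_trans. exact (Hpos O). replace (k ^ 0 * y)%C with y by (simpl; ring).
      eapply Rle_trans; [apply Rle_abs|apply re_le_Cmod]. }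
    assert (Hre0 : 0 < Re y). { specialize (Hpos O). now replace (k ^ 0 * y)%C with y in Hpos by (simpl; ring). }
    assert (P1 : 0 < Cmod (1 - k)) by now apply Cmod_gt_0.
    destruct (unimodular_recurrence k (Re y * Cmod (1 - k) / (2 * Cmod y)) Hk) as (n & Hn & Hkn).
    { apply Rdiv_lt_0_compat; [apply Rmult_lt_0_compat|]; lra. }
    set (S := csum (fun j => k ^ j * y)%C n).
    assert (ES : ((1 - k) * S)%C = ((1 - k ^ n) * y)%C).
    { unfold S. clear. induction n as [|n IH]; simpl. ring. rewrite Cmult_plus_distr_l, IH. ring. }
    assert (HS : forall m, (1 <= m)%nat -> Re y <= Re (csum (fun j => k ^ j * y)%C m)).
    { intros m Hm. induction Hm as [|m Hm IH].
      - simpl csum. replace (0 + 1 * y)%C with y by ring. lra.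
      - simpl csum. rewrite Re_plus. specialize (Hpos m). lra. }
    specialize (HS n Hn). fold S in HS.
    assert (HSm : Re y <= Cmod S).
    { eapply Rle_trans. exact HS. eapply Rle_trans; [apply Rle_abs|apply re_le_Cmod]. }
    apply (f_equal Cmod) in ES. rewrite !Cmod_mult, (Cmod_sub_sym 1 (k ^ n)) in ES.
    apply (Rmult_le_compat_r (Cmod y)) in Hkn; [|lra].
    replace (Re y * Cmod (1 - k) / (2 * Cmod y) * Cmod y) with (Re y * Cmod (1 - k) / 2) in Hkn by (field; lra).
    assert (Cmod (1 - k) * Re y <= Cmod (1 - k) * Cmod S) by (apply Rmult_le_compat_l; lra).
    assert (0 < Re y * Cmod (1 - k)) by now apply Rmult_lt_0_compat. lra. }
  assert (K0 := Cmod_ge_0 k).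
  split.
  (* As n grows the linear term of [qform] dies out and the quadratic one is nonnegative, so a
     positive constant |al|^2 - 1 would contradict [qform < 0]. *)
  - apply Rle_antisym; auto. apply Rnot_lt_le. intros K.
    assert (HA0 : 0 < Cmod al ^ 2 - 1) by nra.
    assert (Y0 := Cmod_ge_0 y).
    destruct (pow_small (Cmod k) ((Cmod al ^ 2 - 1) / (2 * (Cmod y + 1)))) as [n Hn]; try lra.
    { apply Rdiv_lt_0_compat; lra. }
    specialize (Hn n (le_n n)). specialize (Hq n 0 Z0). unfold qform in Hq. fold B in Hq.
    replace (B * (k ^ n * coord al b0 b1 0))%C with (k ^ n * y)%C in Hq by (unfold y; ring).
    assert (Q1 : 0 <= (Cmod b1 ^ 2 - Cmod b0 ^ 2) * Cmod (k ^ n * coord al b0 b1 0) ^ 2).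
    { apply Rmult_le_pos. generalize (Cmod_ge_0 b0). nra. apply pow2_ge_0. }
    assert (Q2 : Re (k ^ n * y)%C <= Cmod k ^ n * Cmod y).
    { eapply Rle_trans; [apply Rle_abs|]. eapply Rle_trans; [apply re_le_Cmod|]. rewrite Cmod_mult, Cmod_pow. lra. }
    assert (Q3 : 0 <= Cmod k ^ n) by (apply pow_le; lra).
    apply (Rmult_lt_compat_r (Cmod y + 1)) in Hn; [|lra].
    replace ((Cmod al ^ 2 - 1) / (2 * (Cmod y + 1)) * (Cmod y + 1)) with ((Cmod al ^ 2 - 1) / 2) in Hn by (field; lra).
    lra.
  - intros z Hz.
    set (M := Cmod (coord al b0 b1 z) * (Cmod b0 + Cmod b1)).
    apply is_lim_seq_le_le with (u := fun _ => 0) (w := fun n => Cmod k ^ n * M).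
    + intros n. split. apply Cmod_ge_0.
      assert (Hzn := selfmap_iter a b c d n z Hs Hz). assert (Hzn' := Hzn). unfold in_disk in Hzn'.
      set (zn := Nat.iter n (lf a b c d) z) in *.
      assert (N := coord_denom_nz al b0 b1 zn HD Hb Hzn).
      replace (zn - al)%C with (coord al b0 b1 zn * (b0 * zn - b1))%C by (unfold coord; field; auto).
      unfold zn at 1. rewrite Hit by auto. rewrite !Cmod_mult, Cmod_pow. unfold M.
      rewrite Rmult_assoc. apply Rmult_le_compat_l. apply pow_le; lra.
      apply Rmult_le_compat_l. apply Cmod_ge_0.
      eapply Rle_trans. apply Cmod_triangle_sub. rewrite Cmod_mult.
      assert (B0 := Cmod_ge_0 b0). assert (Z1 := Cmod_ge_0 zn). nra.
    + apply is_lim_seq_const.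
    + replace (Finite 0) with (Rbar_mult 0 M) by (simpl; f_equal; ring).
      apply (is_lim_seq_scal_r (fun n => Cmod k ^ n) M 0). apply is_lim_seq_geom.
      rewrite Rabs_pos_eq; lra.
Qed.

(** If |mu / nu| >= 1 the coordinate of the orbit of 0 never shrinks below its initial modulus,
    whereas convergence to al would make it tend to 0. *)
Lemma attractive_multiplier a b c d al nu b0 b1 mu :
  lf_selfmap a b c d ->
  eigen a b c d al 1 nu -> eigen a b c d b1 b0 mu -> (b1 - al * b0)%C <> 0 -> nu <> 0 ->
  Cmod b0 <= Cmod b1 -> Cmod al = 1 -> attractive a b c d al -> Cmod (mu / nu) < 1.
Proof.
  intros Hs HA HB HD Hnu Hb Ha Hat. apply Rnot_le_lt. intros Hk.
  assert (Z0 : in_disk 0) by (unfold in_disk; rewrite Cmod_0; lra).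
  specialize (Hat 0 Z0). set (u0 := coord al b0 b1 0).
  assert (N0 := coord_denom_nz al b0 b1 0 HD Hb Z0).
  assert (U0 : 0 < Cmod u0).
  { unfold u0, coord. rewrite Cmod_div by auto. apply Rdiv_lt_0_compat; apply Cmod_gt_0; auto.
    apply Csub_nz. intros E. rewrite <- E, Cmod_0 in Ha. lra. }
  assert (PD : 0 < Cmod (b1 - al * b0)) by now apply Cmod_gt_0.
  assert (B0 := Cmod_ge_0 b0).
  set (D := Cmod (b1 - al * b0)) in *.
  (* With x = |z_n - al| the denominator of the coordinate is at least D - |b0| x, so |u0| (D - |b0|
     x) <= x, that is x >= D |u0| / (|b0| |u0| + 1); e is half of this. *)
  set (e := D * Cmod u0 / (2 * (Cmod b0 * Cmod u0 + 1))).
  assert (Hbu : 0 <= Cmod b0 * Cmod u0) by (apply Rmult_le_pos; lra).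
  assert (He : 0 < e). { apply Rdiv_lt_0_compat. now apply Rmult_lt_0_compat. lra. }
  apply is_lim_seq_spec in Hat. destruct (Hat (mkposreal e He)) as [n Hn].
  specialize (Hn n (le_n n)). simpl in Hn. rewrite Rminus_0_r, Rabs_pos_eq in Hn by apply Cmod_ge_0.
  assert (Hzn := selfmap_iter a b c d n 0 Hs Z0).
  assert (E := coord_iter a b c d al nu b0 b1 mu 0 n Hs HA HB HD Hnu Hb Z0). fold u0 in E.
  set (zn := Nat.iter n (lf a b c d) 0) in *.
  assert (N := coord_denom_nz al b0 b1 zn HD Hb Hzn).
  assert (Hm : Cmod u0 <= Cmod (coord al b0 b1 zn)).
  { rewrite E, Cmod_mult, Cmod_pow. rewrite <- (Rmult_1_l (Cmod u0)) at 1. apply Rmult_le_compat_r. lra.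
    now apply pow_R1_Rle. }
  assert (E2 : Cmod (coord al b0 b1 zn) * Cmod (b0 * zn - b1) = Cmod (zn - al)).
  { rewrite <- Cmod_mult. f_equal. unfold coord. field. auto. }
  assert (T : D - Cmod b0 * Cmod (zn - al) <= Cmod (b0 * zn - b1)).
  { assert (T := Cmod_triangle_rev (b1 - al * b0) (b0 * (zn - al))). fold D in T.
    rewrite Cmod_mult in T. rewrite (Cmod_sub_sym (b0 * zn)).
    replace (b1 - b0 * zn)%C with (b1 - al * b0 - b0 * (zn - al))%C by ring. exact T. }
  assert (Q0 := Cmod_ge_0 (b0 * zn - b1)).
  assert (Q : Cmod u0 * (D - Cmod b0 * Cmod (zn - al)) <= Cmod (zn - al)).
  { rewrite <- E2 at 2. apply Rle_trans with (Cmod u0 * Cmod (b0 * zn - b1)).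
    apply Rmult_le_compat_l; lra. apply Rmult_le_compat_r; lra. }
  set (x := Cmod (zn - al)) in *.
  assert (Ee : e * (2 * (Cmod b0 * Cmod u0 + 1)) = D * Cmod u0) by (unfold e; field; lra).
  assert (x * (Cmod b0 * Cmod u0 + 1) < e * (Cmod b0 * Cmod u0 + 1)) by (apply Rmult_lt_compat_r; lra).
  assert (0 < D * Cmod u0) by now apply Rmult_lt_0_compat. lra.
Qed.

Lemma hyperbolic_is_recurrent a b c d : lf_selfmap a b c d -> hyperbolic a b c d ->
  recurrent (comp_op (lf a b c d)).
Proof.
  intros Hs (al & Ha & Hfa & Hat & beta & Hne & Hfb & Hout).
  destruct (fixed_pt_eigen a b c d al Hfa) as [HA Hnu].
  assert (Hex : exists b0 b1 mu, eigen a b c d b1 b0 mu /\ (b1 - al * b0)%C <> 0 /\ Cmod b0 <= Cmod b1).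
  { destruct beta as [be|].
    - destruct (fixed_pt_eigen a b c d be Hfb) as [HB _].
      exists 1, be, (c * be + d)%C. split; auto. split.
      + replace (be - al * 1)%C with (be - al)%C by ring. apply Csub_nz. intros E. apply Hne. now rewrite E.
      + rewrite Cmod_1. now apply Rnot_lt_le.
    - destruct (fixed_pt_eigen_infty a b c d (proj1 Hs) Hfb) as (HB & _ & _).
      exists 0, (-(1))%C, a. split; auto. split.
      + replace (- (1) - al * 0)%C with (-(1))%C by ring. apply nz_of_Cmod. rewrite Cmod_m1. lra.
      + rewrite Cmod_0, Cmod_m1. lra. }
  destruct Hex as (b0 & b1 & mu & HB & HD & Hb).
  apply (hyperbolic_recurrent a b c d al (c * al + d)%C b0 b1 mu); auto.
  now apply (attractive_multiplier a b c d al (c * al + d)%C b0 b1 mu).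
Qed.

(** If c were 0, infinity would be a second fixed point. The two roots of the fixed-point equation
    sum to (a - d) / c, so (a - d) / c - al is fixed too; its equality with al is the trace
    condition. *)
Lemma parabolic_data a b c d al : lf_selfmap a b c d -> fixed_pt a b c d (Some al) ->
  (forall w, fixed_pt a b c d w -> w = Some al) -> c <> 0 /\ (a + d)%C = (2 * (c * al + d))%C.
Proof.
  intros [Hdet _] Hfa Huniq.
  destruct (fixed_pt_eigen a b c d al Hfa) as [[A1 _] Hnu].
  assert (Hc : c <> 0).
  { intros E. assert (F : fixed_pt a b c d None).
    { unfold fixed_pt, lf_ext. destruct (Ceq_dec c 0); auto. contradiction. }
    specialize (Huniq None F). discriminate. }
  split; auto.
  set (be := ((a - d) / c - al)%C).
  assert (Eb : b = ((c * al + d) * al - a * al)%C) by (rewrite <- A1; ring).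
  assert (E : (a * be + b)%C = (be * (c * be + d))%C) by (rewrite Eb; unfold be; field; auto).
  assert (F := fixed_pt_intro a b c d be (quadratic_root_denom a b c d be Hdet E) E).
  specialize (Huniq _ F). injection Huniq as Eq.
  replace (a + d)%C with (c * (be + al) + 2 * d)%C by (unfold be; field; auto). rewrite Eq. ring.
Qed.

(** 1 / (z - al) is shifted by the nonzero c / nu at each step, so the orbit of 0 comes arbitrarily
    close to al, which therefore lies in the closed disk. *)
Lemma parabolic_fixed_unit a b c d al nu : lf_selfmap a b c d -> eigen a b c d al 1 nu -> nu <> 0 ->
  (a + d)%C = (2 * nu)%C -> c <> 0 -> 1 <= Cmod al -> Cmod al = 1.
Proof.
  intros Hs [A1 A2] Hnu Htr Hc Ha. apply Rle_antisym; auto. apply le_epsilon. intros eps He.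
  assert (Ed : d = (nu - c * al)%C). { replace nu with (nu * 1)%C by ring. rewrite <- A2. ring. }
  assert (Ea : a = (nu + c * al)%C). { replace a with (a + d - d)%C by ring. rewrite Htr, Ed. ring. }
  assert (Eb : b = (- (c * al * al))%C).
  { replace b with ((a * al + b * 1) - a * al)%C by ring. rewrite A1, Ea. ring. }
  assert (Hn : forall z, in_disk z -> (z - al)%C <> 0).
  { intros z Hz. apply Csub_nz. intros E. unfold in_disk in Hz. rewrite E in Hz. lra. }
  assert (Hstep : forall z, in_disk z -> (/ (lf a b c d z - al))%C = (/ (z - al) + c / nu)%C).
  { intros z Hz. assert (Hcd := proj1 (proj2 Hs z Hz)). specialize (Hn z Hz).
    assert (E : (lf a b c d z - al)%C = (nu * (z - al) / (c * z + d))%C).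
    { unfold lf. replace ((a * z + b) / (c * z + d) - al)%C
        with ((a * z + b - al * (c * z + d)) / (c * z + d))%C by (field; auto).
      f_equal. rewrite Ea, Eb, Ed. ring. }
    rewrite E. replace (/ (nu * (z - al) / (c * z + d)))%C with ((c * z + d) / (nu * (z - al)))%C by (field; auto).
    rewrite Ed. field. auto. }
  assert (Z0 : in_disk 0) by (unfold in_disk; rewrite Cmod_0; lra).
  assert (Hit : forall n, (/ (Nat.iter n (lf a b c d) 0 - al))%C = (/ (0 - al) + RtoC (INR n) * (c / nu))%C).
  { induction n as [|n IH]. simpl; ring. simpl Nat.iter. rewrite Hstep by now apply selfmap_iter.
    rewrite IH, S_INR, RtoC_plus. ring. }
  set (tau := (c / nu)%C) in *.
  assert (Ht : 0 < Cmod tau). { unfold tau. rewrite Cmod_div by auto. apply Rdiv_lt_0_compat; now apply Cmod_gt_0. }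
  set (m := Cmod (/ (0 - al))) in *.
  destruct (INR_unbounded ((/ eps + m) / Cmod tau)) as [n Hnb].
  specialize (Hit n). assert (Hzn := selfmap_iter a b c d n 0 Hs Z0).
  set (zn := Nat.iter n (lf a b c d) 0) in *. specialize (Hn zn Hzn).
  assert (T := Cmod_triangle_rev (RtoC (INR n) * tau) (- / (0 - al))).
  rewrite Cmod_opp in T. fold m in T.
  replace (RtoC (INR n) * tau - - / (0 - al))%C with (/ (zn - al))%C in T by (rewrite Hit; ring).
  rewrite Cmod_mult, Cmod_R, Rabs_pos_eq in T by apply pos_INR.
  apply (Rmult_gt_compat_r (Cmod tau)) in Hnb; auto.
  replace ((/ eps + m) / Cmod tau * Cmod tau) with (/ eps + m) in Hnb by (field; lra).
  rewrite Cmod_inv in T by auto.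
  assert (P : 0 < Cmod (zn - al)) by now apply Cmod_gt_0.
  assert (L : Cmod (zn - al) <= eps).
  { rewrite <- (Rinv_inv eps), <- (Rinv_inv (Cmod (zn - al))). apply Rinv_le_contravar.
    now apply Rinv_0_lt_compat. lra. }
  assert (T2 := Cmod_triangle_rev al zn). rewrite Cmod_sub_sym in T2. unfold in_disk in Hzn. lra.
Qed.

Lemma hyperbolic_intro a b c d al nu be b0 b1 mu :
  lf_selfmap a b c d -> ~ has_fixed_pt_in_disk a b c d ->
  eigen a b c d al 1 nu -> eigen a b c d b1 b0 mu -> (b1 - al * b0)%C <> 0 -> nu <> 0 ->
  Cmod b0 <= Cmod b1 -> Cmod (mu / nu) <= 1 -> mu <> nu ->
  fixed_pt a b c d (Some al) -> fixed_pt a b c d be -> be <> Some al ->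
  hyperbolic a b c d.
Proof.
  intros Hs Hnf HA HB HD Hnu Hb Hk Hne Hfa Hfb Hbe.
  assert (Ha : 1 <= Cmod al). { apply Rnot_lt_le. intros K. apply Hnf. now exists al. }
  destruct (two_fixed_points a b c d al nu b0 b1 mu) as [Ha1 Hat]; auto.
  exists al. repeat split; auto. exists be. repeat split; auto.
  destruct be as [be|]; simpl; auto. intros K. apply Hnf. now exists be.
Qed.

Lemma eigen_swap_modulus (mu nu : C) : mu <> 0 -> nu <> 0 -> Cmod (mu / nu) <= 1 \/ Cmod (nu / mu) <= 1.
Proof.
  intros Hm Hn. rewrite !Cmod_div by auto.
  assert (P1 : 0 < Cmod mu) by now apply Cmod_gt_0. assert (P2 : 0 < Cmod nu) by now apply Cmod_gt_0.
  destruct (Rle_lt_dec (Cmod mu) (Cmod nu)); [left|right].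
  - apply Rmult_le_reg_r with (Cmod nu); auto. unfold Rdiv. rewrite Rmult_assoc, Rinv_l; lra.
  - apply Rmult_le_reg_r with (Cmod mu); auto. unfold Rdiv. rewrite Rmult_assoc, Rinv_l; lra.
Qed.

(** The second fixed point is infinity. A nontrivial translation and a dilation by |a / d| > 1 are
    excluded because the orbit of 0 would leave the disk; the identity, because it fixes 0. *)
Lemma affine_classification a b d : lf_selfmap a b 0 d -> ~ has_fixed_pt_in_disk a b 0 d ->
  hyperbolic a b 0 d.
Proof.
  intros Hs Hnf. assert (Z0 : in_disk 0) by (unfold in_disk; rewrite Cmod_0; lra).
  assert (Hda : a <> 0 /\ d <> 0).
  { destruct Hs as [Hdet _]. split; intros E; apply Hdet; rewrite E; ring. }
  destruct Hda as [Hna Hnd].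
  assert (Hlf : forall z, lf a b 0 d z = ((a * z + b) / d)%C).
  { intros z. unfold lf. f_equal. ring. }
  assert (Hbound : forall n, Cmod (Nat.iter n (lf a b 0 d) 0) < 1).
  { intros n. now apply (selfmap_iter a b 0 d n 0). }
  destruct (Ceq_dec a d) as [E|Hne].
  - exfalso. subst d. destruct (Ceq_dec b 0) as [->|Hnb].
    + apply Hnf. exists 0. split; auto. apply fixed_pt_intro. intros K. apply Hna. rewrite <- K. ring. ring.
    + assert (Hit : forall n, Nat.iter n (lf a b 0 a) 0 = (RtoC (INR n) * (b / a))%C).
      { induction n as [|n IH]. simpl; ring. simpl Nat.iter. rewrite Hlf, IH, S_INR, RtoC_plus. field. auto. }
      assert (P : 0 < Cmod (b / a)). { rewrite Cmod_div by auto. apply Rdiv_lt_0_compat; now apply Cmod_gt_0. }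
      destruct (INR_unbounded (/ Cmod (b / a))) as [n Hn]. specialize (Hbound n).
      rewrite Hit, Cmod_mult, Cmod_R, Rabs_pos_eq in Hbound by apply pos_INR.
      apply (Rmult_gt_compat_r (Cmod (b / a))) in Hn; auto. rewrite Rinv_l in Hn by lra. lra.
  - set (al := (b / (d - a))%C).
    assert (Nda : (d - a)%C <> 0) by (apply Csub_nz; auto).
    assert (Eq : (a * al + b)%C = (al * (0 * al + d))%C) by (unfold al; field; auto).
    assert (Nd : (0 * al + d)%C <> 0) by (intros K; apply Hnd; rewrite <- K; ring).
    assert (Hfa := fixed_pt_intro a b 0 d al Nd Eq).
    assert (HA : eigen a b 0 d al 1 d). { split. replace (b * 1)%C with b by ring. rewrite Eq. ring. ring. }
    assert (Hfb : fixed_pt a b 0 d None).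
    { unfold fixed_pt, lf_ext. destruct (Ceq_dec 0 0); auto. contradiction. }
    destruct (fixed_pt_eigen_infty a b 0 d (proj1 Hs) Hfb) as (HB & _ & _).
    assert (Ha : 1 <= Cmod al). { apply Rnot_lt_le. intros K. apply Hnf. now exists al. }
    apply (hyperbolic_intro a b 0 d al d None 0 (-(1))%C a); auto.
    + replace (- (1) - al * 0)%C with (-(1))%C by ring. apply nz_of_Cmod. rewrite Cmod_m1. lra.
    + rewrite Cmod_0, Cmod_m1. lra.
    + apply Rnot_lt_le. intros K.
      assert (Hit : forall n, (Nat.iter n (lf a b 0 d) 0 - al)%C = (- ((a / d) ^ n * al))%C).
      { induction n as [|n IH]. simpl; ring. simpl Nat.iter.
        set (zn := Nat.iter n (lf a b 0 d) 0) in *.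
        replace (lf a b 0 d zn - al)%C with (a / d * (zn - al))%C.
        rewrite IH. simpl. ring.
        rewrite Hlf. unfold al. field. auto. }
      (* As |al| >= 1, this threshold puts the n-th iterate at distance at least |al| + 2 from al,
         hence outside the disk. *)
      destruct (Pow_x_infinity (Cmod (a / d))) with (b := 1 + Cmod al + 1) as [n Hn].
      { rewrite Rabs_pos_eq; [exact K|apply Cmod_ge_0]. }
      specialize (Hn n (le_n n)). rewrite Rabs_pos_eq in Hn by (apply pow_le, Cmod_ge_0).
      specialize (Hbound n).
      assert (T := Cmod_triangle_sub (Nat.iter n (lf a b 0 d) 0) al).
      rewrite Hit, Cmod_opp, Cmod_mult, Cmod_pow in T. nra.
    + discriminate.
Qed.

(** For c <> 0 the fixed points are the roots of c z^2 + (d - a) z - b, with discriminant s^2. For s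
    <> 0 the root whose eigenvalue has the larger modulus becomes the attractive point, either
    choice serving when the moduli agree; s = 0 is the parabolic case. *)
Lemma classification a b c d : lf_selfmap a b c d -> ~ has_fixed_pt_in_disk a b c d ->
  hyperbolic a b c d \/ parabolic a b c d.
Proof.
  intros Hs Hnf. destruct (Ceq_dec c 0) as [->|Hc].
  { left. now apply affine_classification. }
  assert (Hdet := proj1 Hs).
  destruct (Csqrt_exists ((a - d) * (a - d) + 4 * b * c)%C) as [s Es].
  assert (N2 : RtoC 2 <> 0) by (apply nz_of_Cmod; rewrite Cmod_R, Rabs_pos_eq; lra).
  assert (Hroot : forall t, (t * t)%C = (s * s)%C ->
    (a * ((a - d + t) / (2 * c)) + b)%C = ((a - d + t) / (2 * c) * (c * ((a - d + t) / (2 * c)) + d))%C).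
  { intros t Et. apply Csub_zero.
    replace (a * ((a - d + t) / (2 * c)) + b - (a - d + t) / (2 * c) * (c * ((a - d + t) / (2 * c)) + d))%C
      with (((a - d) * (a - d) + 4 * b * c - t * t) / (4 * c))%C.
    - rewrite Et, Es. unfold Cdiv. ring.
    - field. auto. }
  assert (Hfix : forall t, (t * t)%C = (s * s)%C -> fixed_pt a b c d (Some ((a - d + t) / (2 * c))%C)).
  { intros t Et. apply fixed_pt_intro; [apply (quadratic_root_denom a b); auto|auto]. }
  assert (Hs2 : (- s * - s)%C = (s * s)%C) by ring.
  assert (Hinf : ~ fixed_pt a b c d None).
  { unfold fixed_pt, lf_ext. destruct (Ceq_dec c 0); [contradiction|discriminate]. }
  destruct (Ceq_dec s 0) as [S0|Sn].
  - right. split; auto. set (al := ((a - d + s) / (2 * c))%C). assert (Hfa := Hfix s eq_refl). fold al in Hfa.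
    assert (Ha : 1 <= Cmod al). { apply Rnot_lt_le. intros K. apply Hnf. now exists al. }
    assert (Huniq : forall w, fixed_pt a b c d w -> w = Some al).
    { intros [w|] Hw; [|contradiction]. f_equal.
      destruct (fixed_pt_eigen a b c d w Hw) as [[W1 _] _].
      assert (E0 : ((2 * c * w - (a - d)) * (2 * c * w - (a - d)))%C = 0).
      { transitivity ((a - d) * (a - d) + 4 * b * c - 4 * c * ((a * w + b * 1) - (c * w + d) * w))%C. ring.
        rewrite W1, <- Es, S0. ring. }
      assert (E1 : (2 * c * w - (a - d))%C = 0).
      { destruct (Ceq_dec (2 * c * w - (a - d))%C 0) as [E|E]; auto. now apply Cmult_zero_l in E0. }
      apply Csub_zero. unfold al. rewrite S0.
      replace (w - (a - d + 0) / (2 * c))%C with ((2 * c * w - (a - d)) / (2 * c))%C by (field; auto).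
      rewrite E1. unfold Cdiv. ring. }
    destruct (parabolic_data a b c d al Hs Hfa Huniq) as [_ Htr].
    destruct (fixed_pt_eigen a b c d al Hfa) as [HA Hnu].
    exists al. repeat split; auto. now apply (parabolic_fixed_unit a b c d al (c * al + d)%C).
  - left. set (al := ((a - d + s) / (2 * c))%C). set (be := ((a - d + - s) / (2 * c))%C).
    assert (Hfa := Hfix s eq_refl). fold al in Hfa. assert (Hfb := Hfix (- s)%C Hs2). fold be in Hfb.
    destruct (fixed_pt_eigen a b c d al Hfa) as [HA Hnu]. destruct (fixed_pt_eigen a b c d be Hfb) as [HB Hmu].
    set (nu := (c * al + d)%C) in *. set (mu := (c * be + d)%C) in *.
    assert (Hab : al <> be).
    { intros E. apply Sn. replace s with (c * (al - be))%C by (unfold al, be; field; auto). rewrite E. ring. }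
    assert (Hmn : mu <> nu).
    { intros E. apply Hab. apply Csub_zero. apply Cmult_zero_l with c; auto.
      replace ((al - be) * c)%C with (nu - mu)%C by (unfold nu, mu; ring). rewrite E. ring. }
    assert (Hout : forall w, fixed_pt a b c d (Some w) -> Cmod 1 <= Cmod w).
    { intros w Hw. rewrite Cmod_1. apply Rnot_lt_le. intros K. apply Hnf. now exists w. }
    destruct (eigen_swap_modulus mu nu Hmu Hnu) as [Hk|Hk].
    + apply (hyperbolic_intro a b c d al nu (Some be) 1 be mu); auto.
      * replace (be - al * 1)%C with (be - al)%C by ring. apply Csub_nz; auto.
      * intros E. apply Hab. congruence.
    + apply (hyperbolic_intro a b c d be mu (Some al) 1 al nu); auto.
      * replace (al - be * 1)%C with (al - be)%C by ring. apply Csub_nz; auto.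
      * intros E. apply Hab. congruence.
Qed.

Theorem theorem6p12 (a b c d : C) :
  lf_selfmap a b c d ->
  (recurrent (comp_op (lf a b c d)) <->
     (hyperbolic a b c d /\ ~ has_fixed_pt_in_disk a b c d)
  \/ (parabolic a b c d /\ lf_automorphism a b c d)
  \/ elliptic_automorphism a b c d).
Proof.
  intros Hs. split.
  - intros Hrec. destruct (classic (has_fixed_pt_in_disk a b c d)) as [Hf|Hf].
    + right. right. split; auto. apply NNPP. intros Hna.
      now apply (interior_not_recurrent a b c d).
    + destruct (classification a b c d Hs Hf) as [Hh|Hp]; auto.
      right. left. split; auto. apply NNPP. intros Hna.
      destruct Hp as (_ & al & Ha & Hfa & Huniq).
      destruct (parabolic_data a b c d al Hs Hfa Huniq) as [_ Htr].
      destruct (fixed_pt_eigen a b c d al Hfa) as [HA Hnu].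
      now apply (parabolic_not_recurrent a b c d al (c * al + d)%C).
  - intros [[Hh _]|[[Hp Hauto]|He]].
    + now apply hyperbolic_is_recurrent.
    + destruct Hp as (_ & al & Ha & Hfa & Huniq).
      destruct (parabolic_data a b c d al Hs Hfa Huniq) as [Hc Htr].
      destruct (fixed_pt_eigen a b c d al Hfa) as [HA Hnu].
      now apply (parabolic_recurrent a b c d al (c * al + d)%C).
    + now apply elliptic_recurrent.
Qed.
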